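(* Suppose that the matrix $C=\int_{[0,1]}Q(x)\,dx$ has three eigenvalues $\mu_{j_1},\mu_{j_2},\mu_{j_3}$ such that \[ \min_{i_1,i_2,i_3\in\{1,\ldots,p\}}\operatorname{diam}\left(\{\mu_{j_1}+\mu_{i_1},\ \mu_{j_2}+\mu_{i_2},\ \mu_{j_3}+\mu_{i_3}\}\right)=d\neq0, \] where $\operatorname{diam}(E)=\sup_{x,y\in E}|x-y|$. Then there exists a number $H$ such that $(H,\infty)\subset\sigma(L(Q))$, that is, the number of the gaps in the spectrum of $L(Q)$ is finite.
   Context: Let $m\geq 1$ and let $Q(x)=(q_{s,j}(x))$ be an $m\times m$ matrix function on $(-\infty,\infty)$, Hermitian for all $x$, with complex-valued locally square summable entries and $Q(x+1)=Q(x)$. $L(Q)$ is the (self-adjoint) operator generated in $L_2^m(-\infty,\infty)$ (vector functions with $m$ components in $L_2(-\infty,\infty)$) by $-y''+Qy$, and $\sigma(L(Q))$ is its spectrum. For $t\in(-\pi,\pi]$, $L_t(Q)$ is the operator generated in $L_2^m[0,1]$ by $-y''+Qy$ and the quasiperiodic conditions $y(1)=e^{it}y(0)$, $y'(1)=e^{it}y'(0)$, with eigenvalues, counted with multiplicity, $\lambda_1(t)\leq\lambda_2(t)\leq\cdots$. The $n$-th band is $I_n(Q)=\{\lambda_n(t):t\in(-\pi,\pi]\}$, and $\sigma(L(Q))=\bigcup_{n\ge1}I_n(Q)$. The (nonempty) open intervals between consecutive bands $I_n(Q)$ and $I_{n+1}(Q)$, if they exist, are called the gaps in the spectrum of $L(Q)$.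 The distinct eigenvalues of the Hermitian matrix $C$ are denoted $\mu_1<\mu_2<\cdots<\mu_p$ (no assumption is made on their multiplicities). *)

(* Defs.v *)
From HB Require Import structures.
From mathcomp Require Export all_boot all_order all_algebra.
From mathcomp Require Export complex.
From mathcomp Require Export all_classical all_reals all_analysis.
Set Implicit Arguments.
Unset Strict Implicit.
Unset Printing Implicit Defensive.
Import Order.TTheory GRing.Theory Num.Theory.
Import numFieldNormedType.Exports.
Local Open Scope classical_set_scope.
Local Open Scope ring_scope.
Local Open Scope complex_scope.

(* The libraries have no integration theory for complex-valued functions of a
   real variable: measurability, integrability and integrals are taken on the
   real and imaginary parts.  Elements of L_2 are represented by functions,
   and equalities in L_2 are stated almost everywhere. *)

Definition abs2 (R : realType) (z : R[i]) : R := complex.Re z ^+ 2 + complex.Im z ^+ 2.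

Definition cmeasurable_fun (R : realType) (A : set R) (f : R -> R[i]) : Prop :=
  measurable_fun A (fun x => complex.Re (f x)) /\
  measurable_fun A (fun x => complex.Im (f x)).

Definition cintegrable (R : realType) (A : set R) (f : R -> R[i]) : Prop :=
  lebesgue_measure.-integrable A (fun x => (complex.Re (f x))%:E) /\
  lebesgue_measure.-integrable A (fun x => (complex.Im (f x))%:E).

Definition cintegral (R : realType) (A : set R) (f : R -> R[i]) : R[i] :=
  (\int[lebesgue_measure]_(x in A) complex.Re (f x)) +i*
  (\int[lebesgue_measure]_(x in A) complex.Im (f x)).

Definition square_summable (R : realType) (A : set R) (f : R -> R[i]) : Prop :=
  cmeasurable_fun A f /\ (\int[lebesgue_measure]_(x in A) (abs2 (f x))%:E < +oo)%E.

Definition in_L2 (R : realType) (m : nat) (A : set R) (f : R -> 'cV[R[i]]_m) : Prop :=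
  forall j, square_summable A (fun x => f x j 0).

Definition L2norm2 (R : realType) (m : nat) (A : set R) (f : R -> 'cV[R[i]]_m) : \bar R :=
  (\int[lebesgue_measure]_(x in A) (\sum_j abs2 (f x j 0))%:E)%E.

Definition periodic_potential (R : realType) (m : nat) (Q : R -> 'M[R[i]]_m) : Prop :=
  [/\ forall x, Q x \is hermsymmx,
      forall a b s j, square_summable `[a, b] (fun x => Q x s j)
    & forall x, Q (x + 1) = Q x].

Definition mean_matrix (R : realType) (m : nat) (Q : R -> 'M[R[i]]_m) : 'M[R[i]]_m :=
  \matrix_(s, j) cintegral `[0, 1] (fun x => Q x s j).

(* u is absolutely continuous on [a, b] with u' = v almost everywhere, phrased
   as: u is the indefinite integral of the summable function v. *)
Definition AC_with_derivative (R : realType) (m : nat) (a b : R)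
    (u v : R -> 'cV[R[i]]_m) : Prop :=
  forall j, cintegrable `[a, b] (fun x => v x j 0) /\
    forall x, a <= x <= b ->
      u x j 0 = u a j 0 + cintegral `[a, x] (fun s => v s j 0).

(* On [a, b]: y and y' = dy are absolutely continuous and -y'' + Q y = f
   almost everywhere.  As dy is continuous, y is C^1 and dy is its derivative
   everywhere, one-sided at the end points. *)
Definition schrodinger_on (R : realType) (m : nat) (Q : R -> 'M[R[i]]_m) (a b : R)
    (y dy f : R -> 'cV[R[i]]_m) : Prop :=
  AC_with_derivative a b y dy /\
  exists ddy : R -> 'cV[R[i]]_m,
    AC_with_derivative a b dy ddy /\
    {ae lebesgue_measure, forall x : R, a <= x <= b -> f x = - ddy x + Q x *m y x}.

(* The graph of L(Q): y and f = -y'' + Q y are in L_2^m(-oo, +oo), with y and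
   y' locally absolutely continuous. *)
Definition operator_L (R : realType) (m : nat) (Q : R -> 'M[R[i]]_m)
    (y f : R -> 'cV[R[i]]_m) : Prop :=
  [/\ in_L2 setT y, in_L2 setT f
    & exists dy : R -> 'cV[R[i]]_m, forall a b, a < b -> schrodinger_on Q a b y dy f].

(* L(Q) - z is onto L_2^m and bounded below, i.e. it has a bounded inverse
   defined on the whole space; (L(Q) - z) y = g is written L(Q) y = g + z y. *)
Definition resolvent_set (R : realType) (m : nat) (Q : R -> 'M[R[i]]_m) : set R[i] :=
  [set z | (forall g, in_L2 setT g ->
              exists y, operator_L Q y (fun x => g x + z *: y x)) /\
           (exists K : R, forall y g, in_L2 setT g ->
              operator_L Q y (fun x => g x + z *: y x) ->
              (L2norm2 setT y <= K%:E * L2norm2 setT g)%E)].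

Definition spectrum (R : realType) (m : nat) (Q : R -> 'M[R[i]]_m) : set R[i] :=
  ~` resolvent_set Q.

Definition expi (R : realType) (t : R) : R[i] := cos t +i* sin t.

(* The graph of L_t(Q) in L_2^m[0, 1]; functions matter only on [0, 1]. *)
Definition operator_Lt (R : realType) (m : nat) (Q : R -> 'M[R[i]]_m) (t : R)
    (y f : R -> 'cV[R[i]]_m) : Prop :=
  [/\ in_L2 `[0, 1] y, in_L2 `[0, 1] f
    & exists dy : R -> 'cV[R[i]]_m,
        [/\ schrodinger_on Q 0 1 y dy f, y 1 = expi t *: y 0
          & dy 1 = expi t *: dy 0]].

Definition eigenfunction (R : realType) (m : nat) (Q : R -> 'M[R[i]]_m) (t l : R)
    (y : R -> 'cV[R[i]]_m) : Prop :=
  operator_Lt Q t y (fun x => l%:C *: y x).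

(* The solution space of L_t(Q) y = l y in L_2^m[0, 1] has dimension k: it has
   a basis of k elements.  All functions involved are continuous on [0, 1], so
   that equality in L_2 is equality at every point of [0, 1]. *)
Definition has_multiplicity (R : realType) (m : nat) (Q : R -> 'M[R[i]]_m)
    (t l : R) (k : nat) : Prop :=
  exists e : 'I_k -> R -> 'cV[R[i]]_m,
    [/\ forall i, eigenfunction Q t l (e i),
        forall c : 'I_k -> R[i],
          (forall x, 0 <= x <= 1 -> \sum_i c i *: e i x = 0) -> forall i, c i = 0
      & forall y, eigenfunction Q t l y ->
          exists c : 'I_k -> R[i],
            forall x, 0 <= x <= 1 -> y x = \sum_i c i *: e i x].

(* lam 0 <= lam 1 <= ... lists the eigenvalues of the self-adjoint (hence with
   real eigenvalues) operator L_t(Q), each repeated according to its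
   multiplicity; lam n is lambda_{n+1}(t). *)
Definition eigenvalue_listing (R : realType) (m : nat) (Q : R -> 'M[R[i]]_m) (t : R)
    (lam : nat -> R) : Prop :=
  (forall n, lam n <= lam n.+1) /\
  forall l : R, exists k : nat,
    has_multiplicity Q t l k /\ ([set n | lam n = l] #= `I_k)%card.

Definition band (R : realType) (lam : R -> nat -> R) (n : nat) : set R :=
  [set lam t n | t in `]- pi, pi]].

(* The open interval ]sup I_n, inf I_{n+1}[, the bands being compact. *)
Definition gap (R : realType) (lam : R -> nat -> R) (n : nat) : set R :=
  [set x | (forall a, band lam n a -> a < x) /\
           (forall b, band lam n.+1 b -> x < b)].

Definition gaps (R : realType) (lam : R -> nat -> R) : set (set R) :=
  [set G | G !=set0 /\ exists n, G = gap lam n].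

Definition diam (R : realType) (E : set R) : R :=
  sup [set `|x - y| | x in E & y in E].

(* Main.v *)
Require Import Defs.
From mathcomp Require Import all_boot all_order all_algebra.
From mathcomp Require Import complex ring lra.
From mathcomp Require Import all_classical all_reals all_analysis measurable_realfun.
Import Order.TTheory GRing.Theory Num.Theory.
Import numFieldNormedType.Exports.
Local Open Scope classical_set_scope.
Local Open Scope ring_scope.
Local Open Scope complex_scope.
Set Implicit Arguments.
Unset Strict Implicit.
Unset Printing Implicit Defensive.

(** Every sufficiently large energy [l = r ^ 2] carries a Bloch solution, that is a
    nonzero solution of [- y'' + Q y = l y] with [y(1) = e^{it} y(0)] and
    [y'(1) = e^{it} y'(0)] for some [t] ([high_energy_bloch]); both conclusions
    follow from that.

    Writing [y = e^{irx} a + e^{-irx} b] turns the equation into a linear system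
    for [(a, b)] with coefficients of size [1 / r].  Successive approximation
    ([linear_system_solution]) determines its transfer matrix over one period up
    to [o(1 / r)]: the oscillating terms are negligible by the Riemann-Lebesgue
    lemma, and only the mean value [C] of [Q] remains ([transfer_asymptotics]).
    A Bloch solution exists as soon as the transfer matrix, multiplied by the
    free phases [e^{ir}], [e^{-ir}], has an eigenvalue on the unit circle
    ([bloch_solution]).

    Suppose that it has none.  As [Q] is Hermitian, this matrix preserves the
    form [|a| ^ 2 - |b| ^ 2] of signature [(m, m)] ([transfer_krein]).  Adding
    one eigenvector after the other, each automatically neutral because its
    eigenvalue is not unimodular, one obtains an invariant neutral subspace of
    dimension [m]; it is the graph of a unitary matrix [U]
    ([invariant_unitary_graph]).  To leading order the invariance of the graph
    says that [U] conjugates [C^T] to [kappa - C^T], where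
    [kappa = 2 i r (1 - e^{2ir})] depends on [r] only.  Thus every eigenvalue
    [mu_j] of [C] has a partner [mu_i] with [mu_j + mu_i] as close to [kappa] as
    desired when [r] is large ([resonance]).  For [j1], [j2], [j3] the three sums
    would form a set of diameter smaller than [d], a contradiction.

    A Bloch solution truncated by a smooth cutoff at scale [k] solves the
    equation up to an error whose squared norm is [O(1 / k)], while its own norm
    is bounded below; so [l] is in the spectrum ([bloch_in_spectrum]).

    The energy of a Bloch solution is an eigenvalue of some [L_t(Q)] and hence in
    no gap ([not_in_gap]), so every gap contains a point below a fixed [H].  The
    [n]-th gap lies above the [n]-th eigenvalue of the periodic problem, and
    these eigenvalues tend to infinity ([eigenvalues_unbounded]): a bounded
    interval contains finitely many of them, since many eigenfunctions would
    have a combination that vanishes on a fine grid, and such a function has too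
    much energy ([few_eigenvalues_below]).  Hence only finitely many indices
    occur. *)

Notation leb := lebesgue_measure.

(** * Integrals of complex-valued functions *)

Section ReIm.
Context {R : realType}.
Implicit Types (z w : R[i]).

Lemma ReD z w : complex.Re (z + w) = complex.Re z + complex.Re w.
Proof. by case: z w => [a b] [c d]. Qed.
Lemma ImD z w : complex.Im (z + w) = complex.Im z + complex.Im w.
Proof. by case: z w => [a b] [c d]. Qed.
Lemma ReN z : complex.Re (- z) = - complex.Re z.
Proof. by case: z. Qed.
Lemma ImN z : complex.Im (- z) = - complex.Im z.
Proof. by case: z. Qed.
Lemma ReM z w : complex.Re (z * w) =
  complex.Re z * complex.Re w - complex.Im z * complex.Im w.
Proof. by case: z w => [a b] [c d]. Qed.
Lemma ImM z w : complex.Im (z * w) =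
  complex.Re z * complex.Im w + complex.Im z * complex.Re w.
Proof. by case: z w => [a b] [c d]. Qed.
Lemma ReJ z : complex.Re z^* = complex.Re z.
Proof. by case: z. Qed.
Lemma ImJ z : complex.Im z^* = - complex.Im z.
Proof. by case: z. Qed.
Lemma complex_eq z w : complex.Re z = complex.Re w ->
  complex.Im z = complex.Im w -> z = w.
Proof. by case: z w => [a b] [c d] /= -> ->. Qed.
Lemma Re_sum I (s : seq I) (P : pred I) (F : I -> R[i]) :
  complex.Re (\sum_(i <- s | P i) F i) = \sum_(i <- s | P i) complex.Re (F i).
Proof. by apply: (big_morph _ ReD). Qed.
Lemma Im_sum I (s : seq I) (P : pred I) (F : I -> R[i]) :
  complex.Im (\sum_(i <- s | P i) F i) = \sum_(i <- s | P i) complex.Im (F i).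
Proof. by apply: (big_morph _ ImD). Qed.

(** The l^1 norm of the pair (real part, imaginary part), equivalent to the
    modulus.  It is real-valued and compatible with integration componentwise. *)
Definition n1 z : R := `|complex.Re z| + `|complex.Im z|.

Lemma n1_ge0 z : 0 <= n1 z. Proof. by rewrite addr_ge0. Qed.
Lemma n1_0 : n1 0 = 0. Proof. by rewrite /n1 /= normr0 addr0. Qed.
Lemma n1_eq0 z : n1 z = 0 -> z = 0.
Proof.
move=> /eqP; rewrite paddr_eq0// !normr_eq0 => /andP[/eqP a /eqP b].
exact: complex_eq.
Qed.
Lemma n1D z w : n1 (z + w) <= n1 z + n1 w.
Proof.
rewrite /n1 ReD ImD addrACA; apply: lerD; exact: ler_normD.
Qed.
Lemma n1N z : n1 (- z) = n1 z. Proof. by rewrite /n1 ReN ImN !normrN. Qed.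
Lemma n1B z w : n1 (z - w) <= n1 z + n1 w.
Proof. by rewrite -[n1 w]n1N n1D. Qed.
Lemma n1J z : n1 z^* = n1 z. Proof. by rewrite /n1 ReJ ImJ normrN. Qed.
Lemma n1M z w : n1 (z * w) <= n1 z * n1 w.
Proof.
rewrite /n1 ReM ImM.
have := ler_normB (complex.Re z * complex.Re w) (complex.Im z * complex.Im w).
have := ler_normD (complex.Re z * complex.Im w) (complex.Im z * complex.Re w).
rewrite !normrM; lra.
Qed.
Lemma n1_sum I (s : seq I) (P : pred I) (F : I -> R[i]) :
  n1 (\sum_(i <- s | P i) F i) <= \sum_(i <- s | P i) n1 (F i).
Proof.
elim/big_rec2: _ => [|i x y _ H]; first by rewrite n1_0.
by apply: (le_trans (n1D _ _)); rewrite lerD2l.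
Qed.
Lemma n1C (x : R) : n1 x%:C = `|x|. Proof. by rewrite /n1 /= normr0 addr0. Qed.
Lemma n1_Re z : `|complex.Re z| <= n1 z. Proof. by rewrite lerDl. Qed.
Lemma n1_Im z : `|complex.Im z| <= n1 z. Proof. by rewrite lerDr. Qed.
Lemma abs2_le_n1 z : abs2 z <= n1 z ^+ 2.
Proof.
rewrite /abs2 /n1 -(real_normK (num_real (complex.Re z)))
  -(real_normK (num_real (complex.Im z))).
have := normr_ge0 (complex.Re z); have := normr_ge0 (complex.Im z); nra.
Qed.
Lemma n1_le_abs2 z : n1 z ^+ 2 <= 2 * abs2 z.
Proof.
rewrite /abs2 /n1 -(real_normK (num_real (complex.Re z)))
  -(real_normK (num_real (complex.Im z))).
have := sqr_ge0 (`|complex.Re z| - `|complex.Im z|); lra.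
Qed.
Lemma abs2_ge0 z : 0 <= abs2 z. Proof. by rewrite addr_ge0 ?sqr_ge0. Qed.
Lemma abs2J z : (abs2 z)%:C = z * z^*.
Proof. by apply: complex_eq; case: z => a b; rewrite /abs2 /=; ring. Qed.
Lemma abs2M z w : abs2 (z * w) = abs2 z * abs2 w.
Proof. case: z w => [a b] [c d]; rewrite /abs2 /=; ring. Qed.
End ReIm.

Section RealIntegral.
Context {R : realType}.
Implicit Types (f g : R -> R) (A : set (measurableTypeR R)).

Lemma rintegrableD A f g : measurable A ->
  leb.-integrable A (EFin \o f) -> leb.-integrable A (EFin \o g) ->
  leb.-integrable A (EFin \o (fun x => f x + g x)).
Proof.
move=> mA fi gi; have := integrableD mA fi gi.
by apply: eq_integrable => // x _; rewrite /= EFinD.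
Qed.

Lemma rintegrableN A f : measurable A ->
  leb.-integrable A (EFin \o f) -> leb.-integrable A (EFin \o (fun x => - f x)).
Proof.
move=> mA fi; have := integrableN fi.
by apply: eq_integrable => // x _; rewrite /= EFinN.
Qed.

Lemma rintegrable_norm A f : measurable A ->
  leb.-integrable A (EFin \o f) -> leb.-integrable A (EFin \o (fun x => `|f x|)).
Proof.
move=> mA fi; have := integrable_abse fi.
by apply: eq_integrable => // x _; rewrite /=.
Qed.

Lemma rintegrable_dom A f g : measurable A -> measurable_fun A f ->
  (forall x, A x -> `|f x| <= g x) ->
  leb.-integrable A (EFin \o g) -> leb.-integrable A (EFin \o f).
Proof.
move=> mA mf fg; apply: le_integrable => //; first exact/measurable_EFinP.
move=> x Ax /=; rewrite lee_fin (le_trans (fg x Ax))// ler_norm//.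
Qed.

Lemma rintegrable_measurable A f : leb.-integrable A (EFin \o f) ->
  measurable_fun A f.
Proof. by move=> /measurable_int /measurable_EFinP. Qed.

Lemma rintegrableZ A f (r : R) : measurable A ->
  leb.-integrable A (EFin \o f) ->
  leb.-integrable A (EFin \o (fun x => r * f x)).
Proof.
move=> mA fi; have := integrableZl mA r fi.
by apply: eq_integrable => // x _; rewrite /= EFinM.
Qed.

Lemma Rintegral_split (a b c : R) f : a <= c <= b ->
  leb.-integrable `[a, b] (EFin \o f) ->
  \int[leb]_(x in `[a, b]) f x =
  \int[leb]_(x in `[a, c]) f x + \int[leb]_(x in `[c, b]) f x.
Proof.
move=> /andP[ac cb] fi.
have := @Rintegral_itvB R f (BLeft a) (BRight b) c fi.
rewrite !bnd_simp => /(_ ac cb) H.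
rewrite -[X in _ + X](Rintegral_itv_obnd_cbnd (r := c) (b := BRight b) (f := f)).
  by rewrite -H addrC subrK.
by apply: integrableS fi => //; apply: subset_itvr; rewrite bnd_simp.
Qed.

Lemma integrable_subitv (a b c d : R) (f : R -> \bar R) : a <= c -> d <= b ->
  leb.-integrable `[a, b] f -> leb.-integrable `[c, d] f.
Proof.
move=> ac db; apply: integrableS => //.
by apply: subset_itv; rewrite bnd_simp.
Qed.

Lemma Rintegral_ab_cst (a b r : R) : a <= b ->
  \int[leb]_(x in `[a, b]) r = r * (b - a).
Proof.
move=> ab; rewrite Rintegral_cst//= lebesgue_measure_itv /= lte_fin.
by case: ltgtP ab => // -> _; rewrite subrr.
Qed.

Lemma integrable_ab_cst (a b r : R) :
  leb.-integrable `[a, b] (EFin \o (fun=> r)).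
Proof.
apply: measurable_bounded_integrable => //.
- by rewrite /= lebesgue_measure_itv /=; case: ifP => _; rewrite -?EFinB ltry.
- by exists `|r|; split; rewrite ?num_real// => x /ltW rx y _.
Qed.

Lemma Rintegral0 A : \int[leb]_(x in A) (0 : R) = 0.
Proof. by rewrite /Rintegral integral0. Qed.

Lemma Rintegral_sub_le (a b c d : R) f : a <= c -> d <= b ->
  leb.-integrable `[a, b] (EFin \o f) -> (forall x, a <= x <= b -> 0 <= f x) ->
  \int[leb]_(x in `[c, d]) f x <= \int[leb]_(x in `[a, b]) f x.
Proof.
move=> ac db fi f0; have fi' := integrable_subitv ac db fi.
have sub : `[c, d]%classic `<=` `[a, b]%classic.
  by apply: subset_itv; rewrite bnd_simp.
have mf : measurable_fun (`[a, b] : set (measurableTypeR R)) (EFin \o f).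
  exact: measurable_int fi.
have H := @ge0_subset_integral _ _ R leb `[c, d]%classic `[a, b]%classic
  (measurable_itv _) (measurable_itv _) (EFin \o f) mf.
have {}H : (\int[leb]_(x in `[c, d]) (f x)%:E <= \int[leb]_(x in `[a, b]) (f x)%:E)%E.
  apply: H sub => x /=; rewrite in_itv /= => xab.
  by rewrite lee_fin f0.
apply: fine_le H.
- exact: (integrable_fin_num _ fi').
- exact: (integrable_fin_num _ fi).
Qed.

Lemma Rintegral_sum A I (s : seq I) (F : I -> R -> R) : measurable A ->
  (forall i, leb.-integrable A (EFin \o F i)) ->
  leb.-integrable A (EFin \o (fun x => \sum_(i <- s) F i x)) /\
  \int[leb]_(x in A) (\sum_(i <- s) F i x) =
  \sum_(i <- s) \int[leb]_(x in A) F i x.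
Proof.
move=> mA Fi; elim: s => [|i s [IH1 IH2]].
  split.
    have : leb.-integrable A (cst 0%E : R -> \bar R) by exact: integrable0.
    by apply: eq_integrable => // x _; rewrite /= big_nil.
  under eq_Rintegral do rewrite big_nil.
  by rewrite Rintegral0 big_nil.
split.
  have := rintegrableD mA (Fi i) IH1; apply: eq_integrable => // x _.
  by rewrite /= big_cons.
under eq_Rintegral do rewrite big_cons.
by rewrite RintegralD// IH2 big_cons.
Qed.
End RealIntegral.

Section ComplexIntegral.
Context {R : realType}.
Implicit Types (f g : R -> R[i]) (A : set (measurableTypeR R)).

Lemma cintegrable_measurable A f : cintegrable A f -> cmeasurable_fun A f.
Proof. by move=> [fr fi]; split; apply: rintegrable_measurable; [exact: fr|exact: fi]. Qed.

Lemma cmeasurableM A f g : measurable A ->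
  cmeasurable_fun A f -> cmeasurable_fun A g ->
  cmeasurable_fun A (fun x => f x * g x).
Proof.
move=> mA [fr fi] [gr gi]; split.
- under eq_fun do rewrite ReM.
  by apply: measurable_funB; apply: measurable_funM.
- under eq_fun do rewrite ImM.
  by apply: measurable_funD; apply: measurable_funM.
Qed.

Lemma eq_cintegrable A f g : measurable A -> (forall x, A x -> f x = g x) ->
  cintegrable A f -> cintegrable A g.
Proof.
move=> mA fg [fr fi]; split.
- by apply: eq_integrable fr => // x /[!inE] Ax; rewrite fg.
- by apply: eq_integrable fi => // x /[!inE] Ax; rewrite fg.
Qed.

Lemma eq_cintegral A f g : (forall x, A x -> f x = g x) ->
  cintegral A f = cintegral A g.
Proof.
by move=> fg; rewrite /cintegral; congr (_ +i* _);
  apply: eq_Rintegral => x /[!inE] Ax; rewrite fg.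
Qed.

Lemma cintegrableD A f g : measurable A -> cintegrable A f -> cintegrable A g ->
  cintegrable A (fun x => f x + g x).
Proof.
move=> mA [fr fi] [gr gi]; split.
- by under eq_fun do rewrite ReD; apply: rintegrableD.
- by under eq_fun do rewrite ImD; apply: rintegrableD.
Qed.

Lemma cintegralD A f g : measurable A -> cintegrable A f -> cintegrable A g ->
  cintegral A (fun x => f x + g x) = cintegral A f + cintegral A g.
Proof.
move=> mA [fr fi] [gr gi]; rewrite /cintegral.
under eq_Rintegral do rewrite ReD.
under [in X in _ +i* X]eq_Rintegral do rewrite ImD.
by rewrite RintegralD// RintegralD.
Qed.

Lemma cintegrableN A f : measurable A -> cintegrable A f ->
  cintegrable A (fun x => - f x).
Proof.
move=> mA [fr fi]; split.
- by under eq_fun do rewrite ReN; apply: rintegrableN.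
- by under eq_fun do rewrite ImN; apply: rintegrableN.
Qed.

Lemma cintegrableZ A f (c : R[i]) : measurable A -> cintegrable A f ->
  cintegrable A (fun x => c * f x).
Proof.
move=> mA [fr fi]; split.
- under eq_fun do rewrite ReM.
  by apply: rintegrableD => //; [|apply: rintegrableN => //]; apply: rintegrableZ.
- under eq_fun do rewrite ImM.
  by apply: rintegrableD => //; apply: rintegrableZ.
Qed.

Lemma cintegralZ A f (c : R[i]) : measurable A -> cintegrable A f ->
  cintegral A (fun x => c * f x) = c * cintegral A f.
Proof.
move=> mA [fr fi]; rewrite /cintegral.
under eq_Rintegral do rewrite ReM.
under [in X in _ +i* X]eq_Rintegral do rewrite ImM.
rewrite RintegralB ?RintegralD//; do ?exact: rintegrableZ.
rewrite !RintegralZl//; apply: complex_eq => //=.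
- by rewrite ReM.
- by rewrite ImM.
Qed.

Lemma cintegrable_n1 A f : measurable A -> cintegrable A f ->
  leb.-integrable A (EFin \o (fun x => n1 (f x))).
Proof. by move=> mA [fr fi]; apply: rintegrableD => //; apply: rintegrable_norm. Qed.

Lemma cintegrable_dom A f (g : R -> R) : measurable A -> cmeasurable_fun A f ->
  (forall x, A x -> n1 (f x) <= g x) ->
  leb.-integrable A (EFin \o g) -> cintegrable A f.
Proof.
move=> mA [fr fi] fg gi; split; apply: rintegrable_dom gi => // x Ax;
  by apply: le_trans (fg x Ax); rewrite ?n1_Re ?n1_Im.
Qed.

(** The norm [n1] is additive over real and imaginary parts, which makes the
    integral triangle inequality hold with constant one. *)
Lemma n1_cintegral_le A f : measurable A -> cintegrable A f ->
  n1 (cintegral A f) <= \int[leb]_(x in A) n1 (f x).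
Proof.
move=> mA [fr fi]; rewrite /n1 /= RintegralD//; try exact: rintegrable_norm.
by apply: lerD; apply: le_normr_Rintegral.
Qed.

Lemma cintegrableM A f g (B : R) : measurable A -> cintegrable A f ->
  cmeasurable_fun A g -> (forall x, A x -> n1 (g x) <= B) ->
  cintegrable A (fun x => f x * g x).
Proof.
move=> mA fi mg gB; apply: (@cintegrable_dom _ _ (fun x => B * n1 (f x))) => //.
- by apply: cmeasurableM => //; exact: cintegrable_measurable.
- move=> x Ax; apply: (le_trans (n1M _ _)).
  by rewrite mulrC ler_wpM2r ?n1_ge0 ?gB.
- by apply: rintegrableZ => //; exact: cintegrable_n1.
Qed.

Lemma cintegrable_subitv (a b c d : R) f : a <= c -> d <= b ->
  cintegrable `[a, b] f -> cintegrable `[c, d] f.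
Proof. by move=> ac db [fr fi]; split; apply: (@integrable_subitv _ a b). Qed.

Lemma cintegral_split (a b c : R) f : a <= c <= b -> cintegrable `[a, b] f ->
  cintegral `[a, b] f = cintegral `[a, c] f + cintegral `[c, b] f.
Proof.
move=> acb [fr fi]; rewrite /cintegral.
rewrite [in LHS](@Rintegral_split _ a b c)//.
by rewrite [in X in _ +i* X = _](@Rintegral_split _ a b c).
Qed.

Lemma cintegrable_itv_cst (a b : R) (c : R[i]) : cintegrable `[a, b] (fun=> c).
Proof. by split; apply: integrable_ab_cst. Qed.

Lemma cintegral_set1 (a : R) f : cintegral `[a, a] f = 0.
Proof. by rewrite /cintegral set_itv1 !Rintegral_set1. Qed.

Lemma cintegral0 A : cintegral A (fun=> 0 : R[i]) = 0.
Proof. by rewrite /cintegral /= Rintegral0. Qed.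

Lemma cintegrable0 A : measurable A -> cintegrable A (fun=> 0 : R[i]).
Proof.
by move=> mA; split; apply: integrable0.
Qed.

Lemma cintegrable_sum A I (s : seq I) (F : I -> R -> R[i]) : measurable A ->
  (forall i, cintegrable A (F i)) ->
  cintegrable A (fun x => \sum_(i <- s) F i x).
Proof.
move=> mA Fi; elim: s => [|i s IH].
  by apply: eq_cintegrable mA _ (cintegrable0 mA) => x _; rewrite big_nil.
apply: eq_cintegrable mA _ (cintegrableD mA (Fi i) IH) => x _.
by rewrite big_cons.
Qed.

Lemma cintegral_sum A I (s : seq I) (F : I -> R -> R[i]) : measurable A ->
  (forall i, cintegrable A (F i)) ->
  cintegral A (fun x => \sum_(i <- s) F i x) = \sum_(i <- s) cintegral A (F i).
Proof.
move=> mA Fi; elim: s => [|i s IH].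
  by rewrite big_nil -[RHS](cintegral0 A); apply: eq_cintegral => x _; rewrite big_nil.
rewrite big_cons -IH -cintegralD//; last exact: cintegrable_sum.
by apply: eq_cintegral => x _; rewrite big_cons.
Qed.

Lemma cintegrableJ A f : measurable A -> cintegrable A f ->
  cintegrable A (fun x => (f x)^*).
Proof.
move=> mA [fr fi]; split; first by under eq_fun do rewrite ReJ.
by under eq_fun do rewrite ImJ; apply: rintegrableN.
Qed.

Lemma cintegralJ A f : measurable A -> cintegrable A f ->
  cintegral A (fun x => (f x)^*) = (cintegral A f)^*.
Proof.
move=> mA [fr fi]; apply: complex_eq => /=.
  by apply: eq_Rintegral => x _; rewrite ReJ.
rewrite -mulN1r -RintegralZl//; apply: eq_Rintegral => x _.
by rewrite ImJ mulN1r.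
Qed.
End ComplexIntegral.

Section Shift.
Context {R : realType}.
Let phi (c : R) : measurableTypeR R -> measurableTypeR R := fun x => x + c.

Let mphi c : measurable_fun setT (phi c).
Proof. by apply: measurable_funD => //; exact: measurable_cst. Qed.

Lemma lebesgue_measure_shift (c : R) (A : set (measurableTypeR R)) :
  measurable A -> pushforward leb (phi c) A = leb A.
Proof.
move=> mA.
apply/esym/lebesgue_measure_unique => //= _ [[a b]] _ <-.
rewrite /pushforward /=.
have -> : phi c @^-1` `]a, b] = `](a - c), (b - c)]%classic.
  by apply/seteqP; split => x /=; rewrite !in_itv /= ltrBlDr lerBrDr.
rewrite !lebesgue_measure_itv /= !lte_fin ltrD2r -!EFinB.
by case: ifP => // _; congr (_%:E); ring.
Qed.

Lemma integrable_shift (a b c : R) (f : R -> R) :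
  leb.-integrable `[a, b] (EFin \o f) ->
  leb.-integrable `[a + c, b + c] (EFin \o (fun x => f (x - c))) /\
  \int[leb]_(x in `[a + c, b + c]) f (x - c) = \int[leb]_(x in `[a, b]) f x.
Proof.
move=> fi.
pose g := fun x : measurableTypeR R => ((f \_ `[a, b]%classic) (x - c))%:E.
have mg : measurable_fun [set: measurableTypeR R] g.
  apply/measurable_EFinP.
  have mr : measurable_fun [set: measurableTypeR R] (f \_ `[a, b]%classic).
    have mf : measurable_fun (`[a, b]%classic : set (measurableTypeR R)) f.
      exact: rintegrable_measurable fi.
    exact: (proj1 (@measurable_restrictT _ _ (measurableTypeR R) _
      `[a, b]%classic f (measurable_itv _)) mf).
  exact: (measurableT_comp mr (mphi (- c))).
have pre : phi c @^-1` `[a + c, b + c]%classic = `[a, b]%classic.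
  by apply/seteqP; split => x /=; rewrite !in_itv /= /phi !lerD2r.
have gphi x : x \in `[a, b]%classic -> (g \o phi c) x = (f x)%:E.
  by move=> xab; rewrite /g /phi /= addrK patchE xab.
have gE x : x \in `[a + c, b + c]%classic -> g x = (f (x - c))%:E.
  move=> /[!inE] /= xab; rewrite /g patchE ifT//.
  by rewrite inE /= in_itv /= lerBrDr lerBlDr; rewrite in_itv in xab.
have gi : leb.-integrable (phi c @^-1` `[a + c, b + c]%classic) (g \o phi c).
  by rewrite pre; apply: eq_integrable fi => // x xab; rewrite gphi.
have mD : measurable (`[a + c, b + c]%classic : set (measurableTypeR R)).
  exact: measurable_itv.
have eqm (h : R -> \bar R) :
    (\int[pushforward leb (phi c)]_(x in `[(a + c)%R, (b + c)%R]) h x =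
     \int[leb]_(x in `[(a + c)%R, (b + c)%R]) h x)%E.
  by apply: eq_measure_integral => //= B mB _; exact: lebesgue_measure_shift.
split.
  have /integrableP[_] := integrable_pushforward (mphi c) mg gi mD.
  rewrite eqm => gfin; apply: (@eq_integrable _ _ _ _ _ mD g).
    by move=> x xab; rewrite gE.
  by apply/integrableP; split => //; exact: measurable_funTS.
congr fine; transitivity (\int[leb]_(x in `[(a + c)%R, (b + c)%R]) g x)%E.
  by apply: eq_integral => x xab; rewrite gE.
rewrite -eqm integral_pushforward// pre.
by apply: eq_integral => x xab; exact: gphi.
Qed.

Lemma cintegrable_shift (a b c : R) (f : R -> R[i]) :
  cintegrable `[a, b] f ->
  cintegrable `[a + c, b + c] (fun x => f (x - c)) /\
  cintegral `[a + c, b + c] (fun x => f (x - c)) = cintegral `[a, b] f.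
Proof.
move=> [/(integrable_shift c)[fr fr'] /(integrable_shift c)[fi fi']].
by split; [split|rewrite /cintegral fr' fi'].
Qed.
End Shift.

(** * Absolutely continuous functions *)

Section AbsolutelyContinuous.
Context {R : realType}.
Implicit Types (u v f g : R -> R[i]) (a b c : R).

(** The scalar form of [AC_with_derivative]. *)
Definition CAC a b u f : Prop := cintegrable `[a, b] f /\
  forall x, a <= x <= b -> u x = u a + cintegral `[a, x] f.

Lemma CAC_incr a b u f x y : CAC a b u f -> a <= x -> x <= y -> y <= b ->
  u y = u x + cintegral `[x, y] f.
Proof.
move=> [fi uE] ax xy yb.
rewrite (uE y) ?(le_trans ax)// (uE x) ?ax ?(le_trans xy)// -addrA.
congr (_ + _); apply: cintegral_split; first by rewrite ax.
exact: cintegrable_subitv fi.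
Qed.

Lemma CAC_sub a b c d u f : CAC a b u f -> a <= c -> d <= b -> CAC c d u f.
Proof.
move=> uf ac db; split; first exact: cintegrable_subitv (proj1 uf).
move=> x /andP[cx xd]; apply: (CAC_incr uf) => //; exact: le_trans db.
Qed.

Lemma CAC_eq a b u v f g : CAC a b u f ->
  (forall x, a <= x <= b -> u x = v x) -> (forall x, a <= x <= b -> f x = g x) ->
  CAC a b v g.
Proof.
move=> [fi uE] uv fg; split.
  by apply: eq_cintegrable fi => // x /=; rewrite in_itv => /fg.
move=> x /andP[ax xb]; rewrite -!uv ?lexx ?ax ?(le_trans ax)//.
rewrite uE ?ax//; congr (_ + _); apply: eq_cintegral => y /=.
by rewrite in_itv /= => /andP[ay yx]; apply: fg; rewrite ay (le_trans yx).
Qed.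

Lemma CAC_continuous a b u f : a <= b -> CAC a b u f ->
  {within `[a, b], continuous (fun x => complex.Re (u x))} /\
  {within `[a, b], continuous (fun x => complex.Im (u x))}.
Proof.
move=> ab [[fr fi] uE]; split.
- apply: (@subspace_eq_continuous _ _ _
    (fun x => complex.Re (u a) + parameterized_integral leb a x (fun t => complex.Re (f t)))).
    by move=> x; rewrite inE /= in_itv /= /from_subspace => xab; rewrite (uE x xab) ReD.
  move=> x; apply: cvgD; first exact: cvg_cst.
  exact: (parameterized_integral_continuous ab fr).
- apply: (@subspace_eq_continuous _ _ _
    (fun x => complex.Im (u a) + parameterized_integral leb a x (fun t => complex.Im (f t)))).
    by move=> x; rewrite inE /= in_itv /= /from_subspace => xab; rewrite (uE x xab) ImD.
  move=> x; apply: cvgD; first exact: cvg_cst.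
  exact: (parameterized_integral_continuous ab fi).
Qed.

Lemma CAC_measurable a b u f : CAC a b u f -> cmeasurable_fun `[a, b] u.
Proof.
have [ab|ba] := leP a b; last first.
  move=> _; rewrite set_itv_ge ?bnd_simp -?ltNge//.
  by split; exact: measurable_fun_set0.
move=> /(CAC_continuous ab)[ur ui].
by split; apply: subspace_continuous_measurable_fun.
Qed.

Lemma CAC_bounded a b u f : CAC a b u f ->
  exists B : R, forall x, a <= x <= b -> n1 (u x) <= B.
Proof.
move=> [fi uE]; exists (n1 (u a) + \int[leb]_(t in `[a, b]) n1 (f t)) => x xab.
have /andP[ax xb] := xab.
rewrite (uE x xab) (le_trans (n1D _ _))// lerD2l.
apply: (le_trans (n1_cintegral_le _ _)) => //; first exact: cintegrable_subitv fi.
by apply: Rintegral_sub_le => //; [exact: cintegrable_n1|move=> *; exact: n1_ge0].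
Qed.

Lemma CAC_cintegrableM a b u f g : CAC a b u f -> cintegrable `[a, b] g ->
  cintegrable `[a, b] (fun x => g x * u x).
Proof.
move=> uf gi; have [B uB] := CAC_bounded uf.
by apply: (cintegrableM (B := B)) => //; exact: CAC_measurable uf.
Qed.

(** A function whose increments are quadratic in those of a continuous function
    is constant: cut the interval at the points where [h] takes equidistant
    values, so that [N] steps contribute at most [N * (1 / N) ^ 2]. *)
Lemma quadratic_increments_cst a b (h : R -> R) (F : R -> R[i]) : a <= b ->
  {within `[a, b], continuous h} ->
  (forall x y, a <= x -> x <= y -> y <= b -> n1 (F y - F x) <= (h y - h x) ^+ 2) ->
  F b = F a.
Proof.
move=> ab hc incr.
have incr' x y : a <= x <= b -> a <= y <= b -> n1 (F y - F x) <= (h y - h x) ^+ 2.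
  move=> /andP[ax xb] /andP[ay yb]; have [xy|yx] := leP x y; first exact: incr.
  by rewrite -opprB n1N -sqrrN opprB incr// ltW.
suff bnd N : n1 (F b - F a) * N.+1%:R <= (h b - h a) ^+ 2.
  apply/subr0_eq/n1_eq0/eqP; rewrite eq_le n1_ge0 andbT leNgt; apply/negP => F0.
  have := bnd (Num.truncn ((h b - h a) ^+ 2 / n1 (F b - F a))).
  have := truncnS_gt ((h b - h a) ^+ 2 / n1 (F b - F a)).
  by rewrite ltr_pdivrMr// mulrC => lt1 /(lt_le_trans lt1); rewrite ltxx.
pose D := (h b - h a) / N.+1%:R.
have ND : N.+1%:R * D = h b - h a by rewrite /D mulrC divfK// pnatr_eq0.
have step k : (k <= N.+1)%N -> exists c, [/\ a <= c <= b, h c = h a + k%:R * D &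
    n1 (F c - F a) <= k%:R * D ^+ 2].
  elim: k => [_|k IH kN].
    by exists a; rewrite lexx ab subrr n1_0 !mul0r addr0.
  have [|c [cab hcE Fc]] := IH; first exact: ltnW.
  have [|c' c'ab hc'] := @IVT R h a b (h a + k.+1%:R * D) ab hc.
    have -> : h b = h a + N.+1%:R * D by rewrite ND addrC subrK.
    have k0 : 0 <= (k.+1%:R : R) by [].
    have kN' : (k.+1%:R : R) <= N.+1%:R by rewrite ler_nat.
    by have [D0|D0] := leP 0 D; rewrite ?ge_min ?le_max;
      apply/andP; split; apply/orP; (left; nra) || (right; nra).
  rewrite in_itv /= in c'ab.
  exists c'; split=> //.
  have -> : F c' - F a = (F c' - F c) + (F c - F a) by rewrite addrA subrK.
  apply: (le_trans (n1D _ _)).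
  have := incr' c c' cab c'ab; rewrite hc' hcE -natr1 => le1.
  have -> : (k%:R + 1) * D ^+ 2 = (h a + (k%:R + 1) * D - (h a + k%:R * D)) ^+ 2 +
    k%:R * D ^+ 2 by ring.
  exact: lerD.
have [c [cab hcE Fc]] := step N.+1 (leqnn _).
have Fbc : n1 (F b - F c) <= 0.
  have := incr' c b cab; rewrite ab lexx hcE ND => /(_ isT).
  have -> : h b - (h a + (h b - h a)) = 0 by ring.
  by rewrite expr0n.
have : n1 (F b - F a) <= N.+1%:R * D ^+ 2.
  have -> : F b - F a = (F b - F c) + (F c - F a) by rewrite addrA subrK.
  by apply: (le_trans (n1D _ _)); rewrite -[leRHS]add0r lerD.
move=> /(ler_wpM2r (ler0n _ N.+1)) /le_trans; apply.
have -> : N.+1%:R * D ^+ 2 * N.+1%:R = (N.+1%:R * D) ^+ 2 by ring.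
by rewrite ND.
Qed.

(** The product rule.  With [h] the integral of [n1 f + n1 g], the increments of
    the difference of the two sides over [[x, y]] are
    [\int f(s) (v(y) - v(s)) + (u(x) - u(s)) g(s)], at most [(h y - h x) ^ 2]. *)
Lemma CAC_mul a b u v f g : CAC a b u f -> CAC a b v g ->
  CAC a b (fun x => u x * v x) (fun x => f x * v x + u x * g x).
Proof.
have [ab|ba] := leP a b; last first.
  move=> _ _; split; first by rewrite set_itv_ge ?bnd_simp -?ltNge//;
    split; exact: integrable_set0.
  by move=> x /andP[ax xb]; have := le_lt_trans (le_trans ax xb) ba; rewrite ltxx.
move=> uf vg.
have [fi _] := uf; have [gi _] := vg.
pose k := fun x => f x * v x + u x * g x.
have ki : cintegrable `[a, b] k.
  apply: cintegrableD => //; first exact: CAC_cintegrableM vg fi.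
  have := CAC_cintegrableM uf gi; apply: eq_cintegrable => // x _.
  exact: mulrC.
split => // y /andP[ay yb].
pose w := fun t => n1 (f t) + n1 (g t).
have wi : leb.-integrable `[a, b] (EFin \o w).
  by apply: rintegrableD => //; exact: cintegrable_n1.
have w0 t : 0 <= w t by rewrite addr_ge0 ?n1_ge0.
pose h := fun x => parameterized_integral leb a x w.
have hc : {within `[a, y], continuous h}.
  by apply: parameterized_integral_continuous => //; exact: integrable_subitv wi.
pose F := fun x => u x * v x - cintegral `[a, x] k.
suff : F y = F a by rewrite /F cintegral_set1 subr0 => <-; rewrite subrK.
apply: (quadratic_increments_cst ay hc) => x z ax xz zy.
have zb : z <= b := le_trans zy yb.
have xb : x <= b := le_trans xz zb.
have az : a <= z := le_trans ax xz.
have sub r : cintegrable `[a, b] r -> cintegrable `[x, z] r.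
  exact: cintegrable_subitv.
have hE : h z - h x = \int[leb]_(t in `[x, z]) w t.
  rewrite /h /parameterized_integral (@Rintegral_split _ a z x)//.
  - by rewrite addrAC subrr add0r.
  - by rewrite ax.
  - exact: integrable_subitv wi.
set om := \int[leb]_(t in `[x, z]) w t in hE.
have inc r s : CAC a b r s -> (forall t, n1 (s t) <= w t) ->
    forall p q, x <= p -> p <= q -> q <= z -> n1 (r q - r p) <= om.
  move=> rs sw p q xp pq qz.
  have si : cintegrable `[a, b] s by case: rs.
  have sub' : cintegrable `[p, q] s.
    by apply: cintegrable_subitv si; [exact: le_trans xp|exact: le_trans zb].
  rewrite (CAC_incr rs (le_trans ax xp) pq (le_trans qz zb)) addrAC subrr add0r.
  apply: (le_trans (n1_cintegral_le _ sub')) => //.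
  apply: (@le_trans _ _ (\int[leb]_(t in `[p, q]) w t)).
    apply: le_Rintegral => //; first exact: cintegrable_n1.
    by apply: (integrable_subitv _ _ wi); [exact: le_trans xp|exact: le_trans zb].
  apply: Rintegral_sub_le => //.
  exact: (integrable_subitv _ _ wi).
have om0 : 0 <= om by apply: Rintegral_ge0.
have FE : F z - F x = cintegral `[x, z] (fun s => f s * (v z - v s) + (u x - u s) * g s).
  have kE : cintegral `[a, z] k = cintegral `[a, x] k + cintegral `[x, z] k.
    by apply: cintegral_split; [rewrite ax|exact: cintegrable_subitv ki].
  have uvE : u z * v z - u x * v x =
      cintegral `[x, z] (fun s => v z * f s + u x * g s).
    rewrite cintegralD//; try by apply: cintegrableZ => //; exact: sub.
    rewrite !cintegralZ//; try exact: sub.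
    have -> : u z = u x + cintegral `[x, z] f by apply: CAC_incr uf _ _ _.
    have -> : v z = v x + cintegral `[x, z] g by apply: CAC_incr vg _ _ _.
    by ring.
  rewrite /F kE.
  have -> : u z * v z - (cintegral `[a, x] k + cintegral `[x, z] k) -
    (u x * v x - cintegral `[a, x] k) =
    (u z * v z - u x * v x) + (- 1) * cintegral `[x, z] k by ring.
  rewrite uvE -cintegralZ//; last exact: sub.
  rewrite -cintegralD//.
  - by apply: eq_cintegral => s _; rewrite /k; ring.
  - by apply: cintegrableD => //; apply: cintegrableZ => //; exact: sub.
  - by apply: cintegrableZ => //; exact: sub.
rewrite FE hE.
have int1 : cintegrable `[x, z] (fun s => f s * (v z - v s)).
  have := cintegrableD (measurable_itv _) (cintegrableZ (v z) (measurable_itv _) (sub _ fi))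
    (cintegrableZ (- 1) (measurable_itv _) (sub _ (CAC_cintegrableM vg fi))).
  by apply: eq_cintegrable => // s _; ring.
have int2 : cintegrable `[x, z] (fun s => (u x - u s) * g s).
  have := cintegrableD (measurable_itv _) (cintegrableZ (u x) (measurable_itv _) (sub _ gi))
    (cintegrableZ (- 1) (measurable_itv _) (sub _ (CAC_cintegrableM uf gi))).
  by apply: eq_cintegrable => // s _; ring.
have int12 := cintegrableD (measurable_itv _) int1 int2.
apply: (le_trans (n1_cintegral_le _ int12)) => //.
rewrite expr2 -[X in _ <= _ * X]/(\int[leb]_(t in `[x, z]) w t) -RintegralZl//; last first.
  exact: integrable_subitv wi.
apply: le_Rintegral => //; first exact: cintegrable_n1.
  by apply: rintegrableZ => //; exact: integrable_subitv wi.
move=> s /=; rewrite in_itv /= => /andP[xs sz].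
apply: (le_trans (n1D _ _)); rewrite /w [om * _]mulrDr; apply: lerD.
  apply: (le_trans (n1M _ _)); rewrite mulrC ler_wpM2r ?n1_ge0//.
  by apply: (inc v g) => // t; rewrite lerDr n1_ge0.
apply: (le_trans (n1M _ _)); rewrite ler_wpM2r ?n1_ge0// -n1N opprB.
by apply: (inc u f) => // t; rewrite lerDl n1_ge0.
Qed.

Lemma CAC_D a b u v f g : CAC a b u f -> CAC a b v g ->
  CAC a b (fun x => u x + v x) (fun x => f x + g x).
Proof.
move=> [fi uE] [gi vE]; split; first exact: cintegrableD.
move=> x xab; have /andP[ax xb] := xab; rewrite uE// vE// cintegralD//.
- by rewrite addrACA.
- exact: cintegrable_subitv fi.
- exact: cintegrable_subitv gi.
Qed.

Lemma CAC_Z a b (c : R[i]) u f : CAC a b u f ->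
  CAC a b (fun x => c * u x) (fun x => c * f x).
Proof.
move=> [fi uE]; split; first exact: cintegrableZ.
move=> x xab; have /andP[ax xb] := xab; rewrite uE// cintegralZ//.
- by rewrite mulrDr.
- exact: cintegrable_subitv fi.
Qed.

Lemma CAC_J a b u f : CAC a b u f ->
  CAC a b (fun x => (u x)^*) (fun x => (f x)^*).
Proof.
move=> [fi uE]; split; first exact: cintegrableJ.
move=> x xab; have /andP[ax xb] := xab; rewrite uE// cintegralJ//.
- by rewrite rmorphD.
- exact: cintegrable_subitv fi.
Qed.

Lemma CAC_cst a b (c : R[i]) : CAC a b (fun=> c) (fun=> 0).
Proof.
by split => [|x _]; [exact: cintegrable0|rewrite cintegral0 addr0].
Qed.

Lemma CAC_sum a b I (s : seq I) (u f : I -> R -> R[i]) :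
  (forall i, CAC a b (u i) (f i)) ->
  CAC a b (fun x => \sum_(i <- s) u i x) (fun x => \sum_(i <- s) f i x).
Proof.
move=> uf; elim: s => [|i s IH].
  by apply: CAC_eq (CAC_cst _ _ 0) _ _ => x _; rewrite big_nil.
by apply: CAC_eq (CAC_D (uf i) IH) _ _ => x _; rewrite big_cons.
Qed.

Lemma integrable_itv_glue a b c (f : R -> \bar R) : a <= c <= b ->
  leb.-integrable `[a, c] f -> leb.-integrable `[c, b] f ->
  leb.-integrable `[a, b] f.
Proof.
move=> /andP[ac cb] fi fi'.
have gi : leb.-integrable `]c, b] f.
  by apply: integrableS fi' => //; apply: subset_itv; rewrite bnd_simp.
have abE : `[a, b]%classic = `[a, c] `|` `]c, b] :> set (measurableTypeR R).
  by apply: itv_bndbnd_setU; rewrite bnd_simp.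
have mf : measurable_fun (`[a, c] `|` `]c, b] : set (measurableTypeR R)) f.
  by apply/measurable_funU => //; split; [exact: measurable_int fi|exact: measurable_int gi].
rewrite abE; apply/integrableP; split => //.
have /integrableP[_ ff] := fi; have /integrableP[_ gf] := gi.
rewrite ge0_integral_setU//.
- exact: lte_add_pinfty.
- exact: measurableT_comp.
- apply/disj_setPS => x [/=]; rewrite !in_itv /= => /andP[_ xc] /andP[cx _].
  by have := lt_le_trans cx xc; rewrite ltxx.
Qed.

Lemma CAC_glue a b c u f : a <= c <= b -> CAC a c u f -> CAC c b u f ->
  CAC a b u f.
Proof.
move=> /andP[ac cb] [[fr fi] uE] [[gr gi] vE].
have fab : cintegrable `[a, b] f.
  have acb : a <= c <= b by rewrite ac.
  by split; apply: (integrable_itv_glue acb).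
split=> // x /andP[ax xb]; have [xc|cx] := leP x c; first by rewrite uE ?ax.
rewrite vE ?(ltW cx)// uE ?ac ?lexx// -addrA; congr (_ + _); apply/esym/cintegral_split.
- by rewrite ac ltW.
- exact: cintegrable_subitv fab.
Qed.

Lemma CAC_shift a b c u f : CAC a b u f ->
  CAC (a + c) (b + c) (fun x => u (x - c)) (fun x => f (x - c)).
Proof.
move=> [fi uE]; split; first by have [] := cintegrable_shift c fi.
move=> x /andP[ax' xb'].
have ax : a <= x - c by rewrite lerBrDr.
have xb : x - c <= b by rewrite lerBlDr.
have fi' : cintegrable `[a, x - c] f by exact: cintegrable_subitv fi.
rewrite addrK uE ?ax//; congr (_ + _).
by have [_ <-] := cintegrable_shift c fi'; rewrite subrK.
Qed.

(** The fundamental theorem of calculus. *)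
Lemma CAC_C1 a b u f :
  (forall x : R, is_derive x 1 (fun y : R => complex.Re (u y)) (complex.Re (f x))) ->
  (forall x : R, is_derive x 1 (fun y : R => complex.Im (u y)) (complex.Im (f x))) ->
  continuous (fun x : R => complex.Re (f x)) ->
  continuous (fun x : R => complex.Im (f x)) ->
  CAC a b u f.
Proof.
move=> ur ui cr ci.
have ci' (g : R -> R) c d : continuous g -> leb.-integrable `[c, d] (EFin \o g).
  move=> cg; apply: continuous_compact_integrable; first exact: segment_compact.
  exact: continuous_subspaceT.
split; first by split; exact: ci'.
have ftc (g G : R -> R) x : a <= x -> (forall t : R, is_derive t 1 G (g t)) ->
    continuous g -> G x = G a + \int[leb]_(t in `[a, x]) g t.
  rewrite le_eqVlt => /predU1P[<- _ _|ax dG cg].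
    by rewrite set_itv1 Rintegral_set1 addr0.
  have dG' t : derivable G t 1 by have := dG t; case.
  have cG : continuous G.
    by move=> t; apply/differentiable_continuous/derivable1_diffP.
  rewrite /Rintegral (continuous_FTC2 (F := G))//.
  - by rewrite /=; ring.
  - exact: continuous_subspaceT.
  - split=> [t _||]; first exact: dG'.
    + exact/cvg_at_right_filter/cG.
    + exact/cvg_at_left_filter/cG.
  - by move=> t _; rewrite derive1E; have := dG t; case.
move=> x /andP[ax xb]; apply: complex_eq; rewrite ?ReD ?ImD /=.
- exact: (ftc _ (fun x => complex.Re (u x))).
- exact: (ftc _ (fun x => complex.Im (u x))).
Qed.
End AbsolutelyContinuous.

(** * Linear systems with small coefficients *)

Section Picard.
Context {R : realType}.

(** The limit lies between the increasing sequence [a N - 2 C / 2 ^ N] and the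
    decreasing sequence [a N + 2 C / 2 ^ N]. *)
Lemma geometric_steps_limit (a : nat -> R) (C : R) :
  (forall N, `|a N.+1 - a N| <= C / 2 ^+ N) ->
  exists l, forall N, `|l - a N| <= 2 * C / 2 ^+ N.
Proof.
move=> aC.
pose lo N := a N - 2 * C / 2 ^+ N; pose hi N := a N + 2 * C / 2 ^+ N.
have twice N : 2 * C / 2 ^+ N.+1 = C / 2 ^+ N.
  by rewrite exprS; field; rewrite expf_neq0.
have twice' N : 2 * C / 2 ^+ N = 2 * (C / 2 ^+ N) by rewrite mulrA.
have lo_incr : nondecreasing_seq lo.
  apply/nondecreasing_seqP => N; rewrite /lo twice twice'.
  by have := aC N; rewrite ler_norml => /andP[]; lra.
have hi_decr : nonincreasing_seq hi.
  apply/nonincreasing_seqP => N; rewrite /hi twice twice'.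
  by have := aC N; rewrite ler_norml => /andP[]; lra.
have C0 N : 0 <= 2 * C / 2 ^+ N.
  rewrite twice' mulr_ge0//; exact: le_trans (aC N).
have lohi M N : lo M <= hi N.
  have [MN|/ltnW NM] := leqP M N.
    by apply: (le_trans (lo_incr _ _ MN)); rewrite /lo /hi; have := C0 N; lra.
  by apply: le_trans (hi_decr _ _ NM); rewrite /lo /hi; have := C0 M; lra.
exists (sup (range lo)) => N.
have ub : has_ubound (range lo) by exists (hi 0%N) => _ [M _ <-].
have l1 : lo N <= sup (range lo) by apply: ub_le_sup => //; exists N.
have l2 : sup (range lo) <= hi N.
  by apply: ge_sup; [exists (lo 0%N); exists 0%N|move=> _ [M _ <-]].
by rewrite ler_norml; move: l1 l2; rewrite /lo /hi => l1 l2; apply/andP; split; lra.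
Qed.

Lemma cmeasurableB (A : set (measurableTypeR R)) (f g : R -> R[i]) : measurable A ->
  cmeasurable_fun A f -> cmeasurable_fun A g ->
  cmeasurable_fun A (fun x => f x - g x).
Proof.
move=> mA [fr fi] [gr gi]; split.
- by under eq_fun do rewrite ReD ReN; apply: measurable_funB.
- by under eq_fun do rewrite ImD ImN; apply: measurable_funB.
Qed.

Variables (n : nat) (G : 'I_n -> 'I_n -> R -> R[i]) (q : R).
Hypothesis Gi : forall k l, cintegrable `[0, 1] (G k l).
Let gs x := \sum_k \sum_l n1 (G k l x).
Hypothesis qG : \int[leb]_(x in `[0, 1]) gs x <= q.

Lemma gs_integrable : leb.-integrable `[0, 1] (EFin \o gs).
Proof.
have [|H _] := @Rintegral_sum R `[0, 1]%classic _ (index_enum 'I_n)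
  (fun k x => \sum_l n1 (G k l x)) (measurable_itv _); last exact: H.
move=> k; have [|H _] := @Rintegral_sum R `[0, 1]%classic _ (index_enum 'I_n)
  (fun l x => n1 (G k l x)) (measurable_itv _); last exact: H.
by move=> l; exact: cintegrable_n1.
Qed.

(** Bounded measurable vector functions, the space on which the integral
    operator of the system acts. *)
Let bm (w : 'I_n -> R -> R[i]) := forall k, cmeasurable_fun `[0, 1] (w k) /\
  exists B : R, forall x, 0 <= x <= 1 -> n1 (w k x) <= B.

Lemma system_integrable w k : bm w ->
  cintegrable `[0, 1] (fun x => \sum_l G k l x * w l x).
Proof.
move=> bw; apply: cintegrable_sum => // l.
have [mw [B wB]] := bw l.
by apply: (cintegrableM (B := B)).
Qed.

Lemma system_integral_le w k d x : bm w ->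
  (forall l x, 0 <= x <= 1 -> n1 (w l x) <= d) -> 0 <= x <= 1 -> 0 <= d ->
  n1 (cintegral `[0, x] (fun x => \sum_l G k l x * w l x)) <= q * d.
Proof.
move=> bw wd /andP[x0 x1] d0.
have si := system_integrable k bw.
have si' : cintegrable `[0, x] (fun x => \sum_l G k l x * w l x).
  exact: cintegrable_subitv si.
apply: (le_trans (n1_cintegral_le _ si')) => //.
apply: (@le_trans _ _ (\int[leb]_(t in `[0, x]) (d * gs t))).
  apply: le_Rintegral => //; first exact: cintegrable_n1.
    by apply: rintegrableZ => //; exact: integrable_subitv gs_integrable.
  move=> t /=; rewrite in_itv /= => /andP[t0 tx].
  apply: (le_trans (n1_sum _ _ _)).
  apply: (@le_trans _ _ (\sum_l d * n1 (G k l t))).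
    apply: ler_sum => l _; apply: (le_trans (n1M _ _)).
    by rewrite mulrC ler_wpM2r ?n1_ge0// wd// t0 (le_trans tx).
  rewrite -mulr_sumr ler_wpM2l// /gs [leRHS](bigD1 k)//= lerDl sumr_ge0// => i _.
  by rewrite sumr_ge0// => l _; exact: n1_ge0.
rewrite RintegralZl//; last exact: integrable_subitv gs_integrable.
rewrite mulrC ler_wpM2r// (le_trans _ qG)//.
apply: Rintegral_sub_le => //; first exact: gs_integrable.
by move=> t _; rewrite sumr_ge0// => i _; rewrite sumr_ge0// => l _; exact: n1_ge0.
Qed.

Hypothesis q_half : q <= 2^-1.

(** Successive approximations converge geometrically because the coefficient
    matrix has integral at most [1 / 2]. *)
Lemma linear_system_solution (w0 : 'I_n -> R[i]) :
  (forall k, n1 (w0 k) <= 1) ->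
  exists w : 'I_n -> R -> R[i],
    [/\ forall k, CAC 0 1 (w k) (fun x => \sum_l G k l x * w l x),
        forall k, w k 0 = w0 k
      & forall k x, 0 <= x <= 1 -> n1 (w k x - w0 k) <= 4 * q].
Proof.
move=> w01.
have q0 : 0 <= q.
  apply: le_trans qG; apply: Rintegral_ge0 => t _.
  by rewrite sumr_ge0// => i _; rewrite sumr_ge0// => l _; exact: n1_ge0.
pose T (w : 'I_n -> R -> R[i]) k x := w0 k + cintegral `[0, x] (fun x => \sum_l G k l x * w l x).
have T_CAC w : bm w -> forall k, CAC 0 1 (T w k) (fun x => \sum_l G k l x * w l x).
  move=> bw k; split; first exact: system_integrable.
  by move=> x x01; rewrite /T cintegral_set1 addr0.
have CAC_bm w f : (forall k, CAC 0 1 (w k) (f k)) -> bm w.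
  by move=> wf k; split; [exact: CAC_measurable (wf k)|exact: CAC_bounded (wf k)].
pose W := fix W N := if N is N'.+1 then T (W N') else fun k _ => w0 k.
have Wbm N : bm (W N).
  elim: N => [|N IH]; last by apply: (CAC_bm _ _); exact: T_CAC.
  by apply: (CAC_bm _ (fun _ _ => 0)) => k; exact: CAC_cst.
have bmB w v : bm w -> bm v -> bm (fun k x => w k x - v k x).
  move=> bw bv k; have [mw [B wB]] := bw k; have [mv [B' vB]] := bv k.
  split; last first.
    by exists (B + B') => x x01; apply: (le_trans (n1B _ _)); rewrite lerD ?wB ?vB.
  exact: cmeasurableB.
have TB w v k x : bm w -> bm v -> 0 <= x <= 1 -> T w k x - T v k x =
    cintegral `[0, x] (fun x => \sum_l G k l x * (w l x - v l x)).
  move=> bw bv /andP[x0 x1].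
  have sub r : bm r -> cintegrable `[0, x] (fun x => \sum_l G k l x * r l x).
    by move=> br; exact: cintegrable_subitv (system_integrable k br).
  rewrite /T opprD addrACA subrr add0r -mulN1r -cintegralZ//; last exact: sub.
  rewrite -cintegralD//; [|exact: sub|by apply: cintegrableZ => //; exact: sub].
  apply: eq_cintegral => t _; rewrite mulN1r -sumrB.
  by apply: eq_bigr => l _; rewrite mulrBr.
have step N k x : 0 <= x <= 1 -> n1 (W N.+1 k x - W N k x) <= q / 2 ^+ N.
  elim: N k x => [|N IH] k x x01.
    rewrite /= /T addrAC subrr add0r expr0 divr1 -[leRHS]mulr1.
    by apply: (@system_integral_le (fun k _ => w0 k)) => //; exact: (Wbm 0%N).
  rewrite [W N.+2]/= [in X in _ - X]/= TB//; try exact: (Wbm N.+1); try exact: (Wbm N).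
  have d0 : 0 <= q / 2 ^+ N by rewrite divr_ge0// exprn_ge0.
  have H := @system_integral_le (fun l x => W N.+1 l x - W N l x) k _ x
    (bmB _ _ (Wbm N.+1) (Wbm N)) (fun l x => @IH l x) x01 d0.
  apply: (le_trans H).
  have -> : q / 2 ^+ N.+1 = 2^-1 * (q / 2 ^+ N).
    by rewrite exprS; field; rewrite expf_neq0.
  by rewrite ler_wpM2r.
have limit k x : exists z : R[i], 0 <= x <= 1 -> forall N, n1 (z - W N k x) <= 4 * q / 2 ^+ N.
  have [x01|] := boolP (0 <= x <= 1); last by exists 0.
  have [|lr lrP] := @geometric_steps_limit (fun N => complex.Re (W N k x)) q.
    by move=> N; rewrite -ReN -ReD; apply: le_trans (step N k x x01); exact: n1_Re.
  have [|li liP] := @geometric_steps_limit (fun N => complex.Im (W N k x)) q.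
    by move=> N; rewrite -ImN -ImD; apply: le_trans (step N k x x01); exact: n1_Im.
  exists (lr +i* li) => _ N; rewrite /n1 ReD ReN ImD ImN /=.
  have := lerD (lrP N) (liP N); move=> /le_trans; apply.
  have d0 : 0 <= q / 2 ^+ N by rewrite divr_ge0// exprn_ge0.
  by rewrite -!mulrA; move: d0; lra.
pose w k x := projT1 (cid (limit k x)).
have wP k x N : 0 <= x <= 1 -> n1 (w k x - W N k x) <= 4 * q / 2 ^+ N.
  by move=> x01; exact: (projT2 (cid (limit k x))).
have small (r c : R) : (forall N : nat, r <= c / 2 ^+ N) -> r <= 0.
  move=> rc; rewrite leNgt; apply/negP => r0.
  have := rc (Num.truncn (c / r)); set N := Num.truncn _.
  rewrite ler_pdivlMr ?exprn_gt0// => le1.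
  have lt1 : c < r * N.+1%:R by have := truncnS_gt (c / r); rewrite ltr_pdivrMr// mulrC.
  have : (N.+1%:R : R) <= 2 ^+ N by rewrite -natrX ler_nat ltn_expl.
  by move=> le2; have := ler_wpM2l (ltW r0) le2; lra.
have bw : bm w.
  move=> k; split; last first.
    have [_ [B B0]] := Wbm 0%N k; exists (4 * q / 2 ^+ 0 + B) => x x01.
    rewrite -(subrK (W 0%N k x) (w k x)); apply: (le_trans (n1D _ _)).
    by rewrite lerD ?wP ?B0.
  have conv (p : R[i] -> R) : (forall z, `|p z| <= n1 z) ->
      (forall z z', p (z - z') = p z - p z') ->
      forall x, 0 <= x <= 1 -> (fun N => p (W N k x)) @ \oo --> p (w k x).
    move=> p1 pB x x01; apply/cvgrPdist_le => /= e e0.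
    exists (Num.truncn (4 * q / e)) => // N /= leN.
    rewrite -pB; apply: (le_trans (p1 _)); apply: (le_trans (wP k x N x01)).
    rewrite ler_pdivrMr ?exprn_gt0// -ler_pdivrMl// mulrC.
    apply: (le_trans (ltW (truncnS_gt _))).
    by rewrite -natrX ler_nat (leq_ltn_trans leN)// ltn_expl.
  split.
  - apply: (@measurable_fun_cvg _ (measurableTypeR R) _ _ (fun N x => complex.Re (W N k x))).
      by move=> N; have [[]] := Wbm N k.
    move=> x; rewrite /= in_itv /= => x01.
    exact: (conv (fun z => complex.Re z) n1_Re (fun z z' => etrans (ReD _ _) (congr1 _ (ReN _))) x x01).
  - apply: (@measurable_fun_cvg _ (measurableTypeR R) _ _ (fun N x => complex.Im (W N k x))).
      by move=> N; have [[]] := Wbm N k.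
    move=> x; rewrite /= in_itv /= => x01.
    exact: (conv (fun z => complex.Im z) n1_Im (fun z z' => etrans (ImD _ _) (congr1 _ (ImN _))) x x01).
have wE k x : 0 <= x <= 1 -> w k x = T w k x.
  move=> x01; apply/subr0_eq/n1_eq0/eqP; rewrite eq_le n1_ge0 andbT.
  apply: (small _ (4 * q + q * (4 * q))) => N.
  have -> : w k x - T w k x = (w k x - W N.+1 k x) + (W N.+1 k x - T w k x).
    by rewrite addrA subrK.
  apply: (le_trans (n1D _ _)); rewrite mulrDl; apply: lerD.
    apply: (le_trans (wP _ _ _ x01)); rewrite ler_wpM2l ?mulr_ge0//.
    by rewrite lef_pV2 ?posrE ?exprn_gt0// ler_eXn2l// ltr1n.
  rewrite [W N.+1]/= TB// -mulrA; apply: system_integral_le => //.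
  - exact: bmB.
  - by move=> l y y01; rewrite -opprB n1N wP.
  - by rewrite divr_ge0 ?mulr_ge0 ?exprn_ge0.
exists w; split=> [k|k|k x x01].
- apply: CAC_eq (T_CAC w bw k) _ _ => // x x01; exact/esym/wE.
- by rewrite wE ?lexx ?ler01// /T cintegral_set1 addr0.
- by have := wP k x 0%N x01; rewrite expr0 divr1.
Qed.
End Picard.

(** * The Riemann-Lebesgue lemma *)

Section Expi.
Context {R : realType}.
Implicit Types x y s : R.

Lemma expiD x y : expi (x + y) = expi x * expi y.
Proof. by apply: complex_eq; rewrite /= ?cosD ?sinD//; ring. Qed.

Lemma expi0 : expi (0 : R) = 1.
Proof. by rewrite /expi cos0 sin0. Qed.

Lemma expiJ x : (expi x)^* = expi (- x).
Proof. by rewrite /expi cosN sinN. Qed.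

Lemma expiNM x : expi (- x) * expi x = 1.
Proof. by rewrite -expiD addNr expi0. Qed.

Lemma expiMN x : expi x * expi (- x) = 1.
Proof. by rewrite -expiD subrr expi0. Qed.

Lemma expi_neq0 x : expi x != 0.
Proof.
by apply/eqP => e0; have := expiNM x; rewrite e0 mulr0 => /esym/eqP; rewrite oner_eq0.
Qed.

Lemma n1_expi x : n1 (expi x) <= 2.
Proof. by rewrite /n1 /= [2]/(1 + 1) lerD ?ler_norml ?cos_geN1 ?cos_le1 ?sin_geN1 ?sin_le1. Qed.

Lemma CAC_expi a b s :
  CAC a b (fun x => expi (s * x)) (fun x => ('i%C * s%:C) * expi (s * x)).
Proof.
have ds x : is_derive x (1 : R) (fun y : R => s * y) s.
  have := @is_deriveZ R R R id s x 1 1 (is_derive_id x 1).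
  by rewrite /GRing.scale /= mulr1.
have cs : continuous (fun y : R => s * y) by move=> x; exact: mulrl_continuous.
apply: CAC_C1 => [x|x||] /=.
- have := @is_derive1_comp R cos (fun y => s * y) x _ _ (is_derive_cos (s * x)) (ds x).
  by congr (is_derive _ _ _ _); ring.
- have := @is_derive1_comp R sin (fun y => s * y) x _ _ (is_derive_sin (s * x)) (ds x).
  by congr (is_derive _ _ _ _); ring.
- rewrite (_ : (fun _ => _) = (fun x : R => - s * sin (s * x))); last first.
    by apply/funext => x; ring.
  move=> x; apply: (@continuous_comp _ _ _ _ (fun y : R => - s * y)); last exact: mulrl_continuous.
  by apply: continuous_comp; [exact: cs|exact: continuous_sin].
- rewrite (_ : (fun _ => _) = (fun x : R => s * cos (s * x))); last first.
    by apply/funext => x; ring.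
  move=> x; apply: (@continuous_comp _ _ _ _ (fun y : R => s * y)); last exact: mulrl_continuous.
  by apply: continuous_comp; [exact: cs|exact: continuous_cos].
Qed.
End Expi.

Section RiemannLebesgue.
Context {R : realType}.

Lemma n1CM (s : R) (z : R[i]) : n1 (s%:C * z) = `|s| * n1 z.
Proof. by case: z => a b; rewrite /n1 /= !mul0r subr0 addr0 !normrM mulrDr. Qed.

Lemma n1iM (z : R[i]) : n1 ('i%C * z) = n1 z.
Proof. by case: z => a b; rewrite /n1 /= !mul0r !mul1r sub0r add0r normrN addrC. Qed.

Lemma n1_cintegral_expi (a b s : R) : a <= b -> s != 0 ->
  n1 (cintegral `[a, b] (fun x => expi (s * x))) <= 4 / `|s|.
Proof.
move=> ab s0; have E := CAC_expi a b s.
have ei : cintegrable `[a, b] (fun x => expi (s * x)).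
  have := cintegrable_itv_cst a b 1; move/(CAC_cintegrableM E).
  by apply: eq_cintegrable => // x _; rewrite mul1r.
have := CAC_incr E (lexx a) ab (lexx b); rewrite cintegralZ// => H.
rewrite ler_pdivlMr ?normr_gt0// mulrC.
have -> : `|s| * n1 (cintegral `[a, b] (fun x => expi (s * x))) =
   n1 (expi (s * b) - expi (s * a)).
  rewrite H addrAC subrr add0r; set z := cintegral _ _.
  by rewrite -mulrA n1iM n1CM.
apply: (le_trans (n1B _ _)); rewrite [4](_ : _ = 2 + 2 :> R); last by ring.
by rewrite lerD ?n1_expi.
Qed.

Lemma cintegrable_expiM (a b s : R) (f : R -> R[i]) : cintegrable `[a, b] f ->
  cintegrable `[a, b] (fun x => expi (s * x) * f x).
Proof.
move=> fi; have := CAC_cintegrableM (CAC_expi a b s) fi.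
by apply: eq_cintegrable => // x _; exact: mulrC.
Qed.

(** For continuous amplitudes, real induction on the right end point: near any
    point the amplitude is nearly constant, and there the oscillating factor
    integrates to [O(1 / s)]. *)
Lemma Riemann_Lebesgue_continuous (g : R -> R) (e : R) : continuous g -> 0 < e ->
  exists P : R, forall s, P < `|s| ->
    n1 (cintegral `[0, 1] (fun x => expi (s * x) * (g x)%:C)) <= e.
Proof.
move=> gc e0.
have gi a b : cintegrable `[a, b] (fun x => (g x)%:C).
  split => /=; last by apply: integrable_ab_cst.
  apply: continuous_compact_integrable; first exact: segment_compact.
  exact: continuous_subspaceT.
have Ei a b s := @cintegrable_expiM a b s _ (gi a b).
pose A := [set b | 0 <= b <= 1 /\ exists P : R, forall s, P < `|s| ->
    n1 (cintegral `[0, b] (fun x => expi (s * x) * (g x)%:C)) <= e * b].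
have A0 : A 0.
  split; first by rewrite lexx ler01.
  by exists 0 => s _; rewrite cintegral_set1 n1_0 mulr0.
have Aub : has_ubound A by exists 1 => b [/andP[]].
have supA : has_sup A by split; first by exists 0.
set b0 := sup A.
have b0_0 : 0 <= b0 by apply: ub_le_sup.
have b0_1 : b0 <= 1 by apply: ge_sup => [|b [/andP[]]//]; exists 0.
have [d d0 gd] : exists2 d : R, 0 < d & forall x, `|x - b0| < d -> `|g x - g b0| <= e / 4.
  have e4 : 0 < e / 4 by rewrite divr_gt0.
  have := gc b0; move=> /cvgrPdist_le /(_ _ e4) [d d0 dP]; exists d => // x xd.
  by rewrite distrC; apply: dP; rewrite /ball /= distrC.
have [c Ac cb0] : exists2 c, A c & b0 - d < c by apply: sup_adherent.
have [/andP[c0 c1] [P cP]] := Ac.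
have cb : c <= b0 by apply: ub_le_sup.
pose c' := Num.min (b0 + d / 2) 1.
have cc' : c <= c' by rewrite le_min c1 andbT (le_trans cb)// lerDl divr_ge0// ltW.
have c'1 : c' <= 1 by rewrite ge_min lexx orbT.
have Ac' : A c'.
  move: cc'; rewrite le_eqVlt => /predU1P[<-//|cc'].
  split; first by rewrite (le_trans c0)// ltW.
  exists (Num.max P (Num.max 0 (8 * `|g b0| / (e * (c' - c))))) => s.
  rewrite !gt_max => /andP[Ps /andP[s0 gs]].
  rewrite (@cintegral_split _ 0 c' c)//; last by rewrite c0 ltW.
  apply: (le_trans (n1D _ _)).
  have -> : e * c' = e * c + e * (c' - c) by ring.
  apply: lerD; first exact: cP.
  have ei : cintegrable `[c, c'] (fun x => expi (s * x)).
    have := cintegrable_expiM s (cintegrable_itv_cst c c' 1).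
    by apply: eq_cintegrable => // x _; rewrite mulr1.
  have hi := @cintegrable_expiM c c' s _ (cintegrableD (measurable_itv _) (gi c c')
    (cintegrable_itv_cst c c' (- (g b0)%:C))).
  have -> : cintegral `[c, c'] (fun x => expi (s * x) * (g x)%:C) =
      cintegral `[c, c'] (fun x => expi (s * x) * ((g x)%:C + - (g b0)%:C)) +
      (g b0)%:C * cintegral `[c, c'] (fun x => expi (s * x)).
    rewrite -cintegralZ// -cintegralD//; last exact: cintegrableZ.
    by apply: eq_cintegral => x _; ring.
  apply: (le_trans (n1D _ _)).
  have -> : e * (c' - c) = e * (c' - c) / 2 + e * (c' - c) / 2 by field.
  have cc0 : 0 < c' - c by rewrite subr_gt0.
  apply: lerD.
    apply: (le_trans (n1_cintegral_le _ hi)) => //.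
    apply: (@le_trans _ _ (\int[leb]_(x in `[c, c']) (e / 2))).
      apply: le_Rintegral => //; first exact: cintegrable_n1.
        exact: integrable_ab_cst.
      move=> x /=; rewrite in_itv /= => /andP[cx xc'].
      apply: (le_trans (n1M _ _)).
      have -> : e / 2 = 2 * (e / 4) by field.
      apply: ler_pM; rewrite ?n1_ge0 ?n1_expi//.
      rewrite -rmorphN -rmorphD /= n1C; apply: gd.
      have : x <= b0 + d / 2 by apply: (le_trans xc'); rewrite ge_min lexx.
      by rewrite ltr_norml => xb0; apply/andP; split; lra.
    by rewrite Rintegral_ab_cst ?(ltW cc')//; lra.
  have s0' : s != 0 by rewrite -normr_gt0.
  apply: (le_trans (n1M _ _)); rewrite n1C.
  apply: (@le_trans _ _ (`|g b0| * (4 / `|s|))).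
    by rewrite ler_wpM2l// n1_cintegral_expi// ltW.
  rewrite mulrA ler_pdivrMr// mulrAC ler_pdivlMr//.
  have ec : 0 < e * (c' - c) by rewrite mulr_gt0.
  by move: gs; rewrite ltr_pdivrMr//; lra.
have : c' <= b0 by apply: ub_le_sup.
rewrite ge_min => /orP[|le1b0]; first by lra.
have c'E : c' = 1 by apply/eqP; rewrite eq_le c'1 le_min lexx andbT (le_trans le1b0)// lerDl divr_ge0// ltW.
by have [_ [P' P'P]] := Ac'; exists P' => s /P'P; rewrite c'E mulr1.
Qed.

(** Continuous functions are dense among the summable ones, and multiplication by
    the oscillating factor at most doubles the error of the approximation. *)
Lemma Riemann_Lebesgue_real (f : R -> R) (e : R) :
  leb.-integrable `[0, 1] (EFin \o f) -> 0 < e ->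
  exists P : R, forall s, P < `|s| ->
    n1 (cintegral `[0, 1] (fun x => expi (s * x) * (f x)%:C)) <= e.
Proof.
move=> fi e0.
have m01 : measurable (`[0, 1]%classic : set (measurableTypeR R)) by exact: measurable_itv.
have mfin : (leb (`[0%R, 1%R]%classic : set (measurableTypeR R)) < +oo)%E.
  by rewrite /= lebesgue_measure_itv /=; case: ifP => _; rewrite -?EFinB ltry.
have [g_ [gc gi gl]] := approximation_continuous_integrable m01 mfin fi.
have e4 : 0 < e / 4 by rewrite divr_gt0.
have [n gn] : exists n, \int[leb]_(x in `[0, 1]) `|f x - g_ n x| <= e / 4.
  move/fine_cvgP : gl => [fin /cvgrPdist_le /(_ _ e4)[n1 _ n1P]].
  have [n0 _ n0P] := fin.
  exists (maxn n0 n1); have := n1P (maxn n0 n1) (leq_maxr _ _).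
  rewrite sub0r normrN /= => /(le_trans (ler_norm _)).
  by apply: le_trans; rewrite le_eqVlt; apply/orP; left; apply/eqP.
have [|P Pg] := @Riemann_Lebesgue_continuous (g_ n) (e / 2) (gc n); first by rewrite divr_gt0.
have cf : cintegrable `[0, 1] (fun x => (f x)%:C).
  by split => //=; apply: integrable_ab_cst.
have cg : cintegrable `[0, 1] (fun x => (g_ n x)%:C).
  by split => //=; [exact: gi|apply: integrable_ab_cst].
exists P => s /Pg sg.
have fg := cintegrableD m01 cf (cintegrableZ (- 1) m01 cg).
have Efg := cintegrable_expiM s fg.
have -> : cintegral `[0, 1] (fun x => expi (s * x) * (f x)%:C) =
   cintegral `[0, 1] (fun x => expi (s * x) * ((f x)%:C + -1 * (g_ n x)%:C)) +
   cintegral `[0, 1] (fun x => expi (s * x) * (g_ n x)%:C).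
  rewrite -cintegralD//; last exact: cintegrable_expiM.
  by apply: eq_cintegral => x _; ring.
apply: (le_trans (n1D _ _)); have -> : e = e / 2 + e / 2 by field.
apply: lerD => //; apply: (le_trans (n1_cintegral_le _ Efg)) => //.
have ni : leb.-integrable `[0, 1] (EFin \o (fun x => `|f x - g_ n x|)).
  apply: rintegrable_norm => //; apply: rintegrableD => //; exact: rintegrableN.
apply: (@le_trans _ _ (\int[leb]_(x in `[0, 1]) (2 * `|f x - g_ n x|))).
  apply: le_Rintegral => //; first exact: cintegrable_n1.
    exact: rintegrableZ.
  move=> x _; apply: (le_trans (n1M _ _)).
  apply: ler_pM; rewrite ?n1_ge0 ?n1_expi//.
  by rewrite mulN1r -rmorphN -rmorphD /= n1C.
have -> : e / 2 = 2 * (e / 4) by field.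
by rewrite RintegralZl// ler_wpM2l.
Qed.

Lemma Riemann_Lebesgue (f : R -> R[i]) (e : R) :
  cintegrable `[0, 1] f -> 0 < e ->
  exists P : R, forall s, P < `|s| ->
    n1 (cintegral `[0, 1] (fun x => expi (s * x) * f x)) <= e.
Proof.
move=> [fr fi] e0; have e2 : 0 < e / 2 by rewrite divr_gt0.
have [Pr rP] := Riemann_Lebesgue_real fr e2.
have [Pi iP] := Riemann_Lebesgue_real fi e2.
exists (Num.max Pr Pi) => s; rewrite gt_max => /andP[/rP sr /iP si].
have cr : cintegrable `[0, 1] (fun x => (complex.Re (f x))%:C).
  by split => //=; apply: integrable_ab_cst.
have ci : cintegrable `[0, 1] (fun x => (complex.Im (f x))%:C).
  by split => //=; apply: integrable_ab_cst.
have Er := cintegrable_expiM s cr; have Ei := cintegrable_expiM s ci.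
have -> : cintegral `[0, 1] (fun x => expi (s * x) * f x) =
  cintegral `[0, 1] (fun x => expi (s * x) * (complex.Re (f x))%:C) +
  'i%C * cintegral `[0, 1] (fun x => expi (s * x) * (complex.Im (f x))%:C).
  rewrite -cintegralZ// -cintegralD//; last exact: cintegrableZ.
  by apply: eq_cintegral => x _; rewrite [in LHS](complexE (f x)); ring.
apply: (le_trans (n1D _ _)); have -> : e = e / 2 + e / 2 by field.
by rewrite n1iM lerD.
Qed.
End RiemannLebesgue.

(** * Invariant neutral subspaces *)

Section InvariantNeutral.
Import Num.Def.
Local Open Scope sesquilinear_scope.
Variables (C : numClosedFieldType) (n : nat) (N J : 'M[C]_n.+1).
Hypotheses (Jherm : J ^t* = J) (Junit : J \in unitmx).
Hypothesis NJ : N *m J *m N ^t* = J.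
Hypothesis no_unimodular : forall z, eigenvalue N z -> z * z^* != 1.

Lemma trmxC_mul m1 m2 m3 (A : 'M[C]_(m1, m2)) (B : 'M[C]_(m2, m3)) :
  (A *m B) ^t* = B ^t* *m A ^t*.
Proof. by rewrite trmx_mul map_mxM. Qed.

(** An eigenvector of [N] modulo [S], found inside any invariant [P] not
    contained in [S]: apply the linear factors of the characteristic polynomial
    one after the other until the vector falls into [S]. *)
Lemma eigenvector_modulo k l (S : 'M[C]_(k, n.+1)) (P : 'M[C]_(l, n.+1)) :
  (P *m N <= P)%MS -> ~~ (P <= S)%MS ->
  exists w z, [/\ (w <= P)%MS, ~~ ((w : 'rV[C]_n.+1) <= S)%MS, eigenvalue N z &
                  (w *m N - z *: w <= S)%MS].
Proof.
move=> PN /row_subPn[i vS].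
have [rs rsE] := closed_field_poly_normal (char_poly N).
have all_ev : all (eigenvalue N) rs.
  apply/allP => z zrs; rewrite eigenvalue_root_char rsE rootZ.
    by rewrite root_prod_XsubC.
  by rewrite lead_coef_eq0 monic_neq0// char_poly_monic.
have kill : (row i P *m horner_mx N (\prod_(z <- rs) ('X - z%:P)) <= S)%MS.
  have : horner_mx N (char_poly N) = 0 by apply: Cayley_Hamilton.
  rewrite rsE (monicP (char_poly_monic N)) scale1r => ->.
  by rewrite mulmx0 sub0mx.
move: kill vS (row_sub i P); move: (row i P) => v {rsE}.
elim: rs v all_ev => [|z rs IH] v /=.
  by rewrite big_nil rmorph1 mulmx1 => _ ->.
move=> /andP[ez ers]; rewrite big_cons rmorphM /= => vS vnS vP.
have vE : v *m horner_mx N ('X - z%:P) = v *m N - z *: v.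
  by rewrite rmorphB /= horner_mx_X horner_mx_C mulmxBr mul_mx_scalar.
have [inS|ninS] := boolP (v *m N - z *: v <= S)%MS; first by exists v, z.
apply: (IH (v *m N - z *: v)) => //.
  by rewrite -vE -mulmxA.
apply: addmx_sub; first exact: submx_trans (submxMr N vP) PN.
by rewrite eqmx_opp scalemx_sub.
Qed.

(** The orthogonal [P] of a neutral invariant subspace [S] is invariant, and is
    larger than [S] when [S] is not maximal; an eigenvector [w] of [N] modulo
    [S] inside [P] satisfies [w J w^* = |z| ^ 2 w J w^*] for an eigenvalue [z]
    off the unit circle, so that [w] can be added to [S]. *)
Lemma neutral_extend k (S : 'M[C]_(k, n.+1)) : (k + k < n.+1)%N ->
  row_free S -> S *m J *m S ^t* = 0 -> (S *m N <= S)%MS ->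
  exists S' : 'M[C]_(1 + k, n.+1),
    [/\ row_free S', S' *m J *m S' ^t* = 0 & (S' *m N <= S')%MS].
Proof.
move=> kn Sfree SJ SN.
have Nunit : N \in unitmx.
  have : N *m (J *m N ^t* *m invmx J) = 1%:M by rewrite !mulmxA NJ mulmxV.
  by move=> /mulmx1_unit[].
have SSN : (S <= S *m N)%MS.
  have := mxrank_leqif_eq SN.
  by rewrite mxrankMfree ?row_free_unit// => -[_ /esym]; rewrite eqxx => /andP[].
pose P := kermx (J *m S ^t*).
have PP l (v : 'M[C]_(l, n.+1)) : (v <= P)%MS = (v *m J *m S ^t* == 0).
  by rewrite sub_kermx mulmxA.
have PN : (P *m N <= P)%MS.
  rewrite PP; have [T TE] := submxP SSN.
  rewrite {1}TE !trmxC_mul mulmxA mulmxA -(mulmxA P) -(mulmxA P) NJ.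
  have : P *m J *m S ^t* == 0 by rewrite -PP.
  by move=> /eqP ->; rewrite mul0mx.
have Jt : (\rank (J *m S ^t*) <= k)%N.
  by rewrite (leq_trans (mxrankM_maxr _ _))// rank_leq_col.
have PnS : ~~ (P <= S)%MS.
  apply/negP => /mxrankS; rewrite mxrank_ker leqNgt => /negP; apply.
  rewrite (eqP Sfree) ltn_subRL; apply: leq_ltn_trans kn.
  by rewrite leq_add2r.
have [w [z [wP wnS ez wz]]] := eigenvector_modulo PN PnS.
have [s sE] := submxP wz.
have wN : w *m N = z *: w + s *m S by rewrite -sE addrC subrK.
have wJS : w *m J *m S ^t* = 0 by apply/eqP; rewrite -PP.
have SJw : S *m J *m w ^t* = 0.
  by rewrite -[S]trmxCK -Jherm -!trmxC_mul mulmxA wJS trmx0 map_mx0.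
have wJw : w *m J *m w ^t* = 0.
  have : w *m N *m J *m (w *m N) ^t* = w *m J *m w ^t*.
    by rewrite trmxC_mul !mulmxA -(mulmxA w) -(mulmxA w) NJ.
  rewrite wN linearD /= map_mxD trmxC_mul linearZ /= map_mxZ !mulmxDl !mulmxDr.
  rewrite -!scalemxAl -!scalemxAr !mulmxA wJS.
  rewrite -(mulmxA s S J) -(mulmxA s (S *m J)) SJw -(mulmxA s (S *m J)) SJ.
  rewrite !(mulmx0, mul0mx, scaler0, addr0) scalerA => H.
  apply/eqP; have : (z * z^* - 1) *: (w *m J *m w ^t*) = 0.
    by rewrite scalerBl scale1r H subrr.
  by move=> /eqP; rewrite scaler_eq0 subr_eq0 (negPf (no_unimodular ez)).
exists (col_mx w S); split.
- have lt : (\rank S < \rank (col_mx w S))%N.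
    apply: rank_ltmx; rewrite ltmxE -addsmxE addsmxSr /= col_mx_sub.
    by rewrite (negPf wnS).
  by move: lt; rewrite (eqP Sfree) -add1n /row_free eqn_leq rank_leq_row.
- by rewrite mul_col_mx mul_col_mx tr_col_mx map_row_mx !mul_mx_row wJw wJS SJw SJ !row_mx0 col_mx0.
- rewrite mul_col_mx col_mx_sub; apply/andP; split; last first.
    by apply: submx_trans SN _; rewrite -addsmxE addsmxSr.
  rewrite wN -addsmxE addmx_sub//.
    by rewrite scalemx_sub// addsmxSl.
  by rewrite (submx_trans (submxMl _ _))// addsmxSr.
Qed.

Lemma neutral_subspace k : (k + k <= n.+1)%N ->
  exists S : 'M[C]_(k, n.+1),
    [/\ row_free S, S *m J *m S ^t* = 0 & (S *m N <= S)%MS].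
Proof.
elim: k => [_|k IH kn].
  by exists 0; rewrite /row_free mxrank0 !mul0mx sub0mx.
have [|S [Sf SJ SN]] := IH; first by rewrite (leq_trans _ kn)// leq_add.
by apply: (neutral_extend _ Sf SJ SN); rewrite (leq_trans _ kn)// addSn ltnS addnS leqnSn.
Qed.
End InvariantNeutral.

Lemma neutral_subspace_exists (C : numClosedFieldType) (n k : nat) (N J : 'M[C]_n) :
  map_mx Num.conj J^T = J -> J \in unitmx ->
  N *m J *m map_mx Num.conj N^T = J ->
  (forall z, eigenvalue N z -> z * Num.conj z != 1) -> (k + k <= n)%N ->
  exists S : 'M[C]_(k, n),
    [/\ row_free S, S *m J *m map_mx Num.conj S^T = 0 & (S *m N <= S)%MS].
Proof.
case: n N J => [|n] N J Jh Ju NJ nuni kn; last exact: (neutral_subspace Jh Ju NJ nuni kn).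
move: kn; rewrite leqn0 addn_eq0 andbb => /eqP ->.
by exists 0; rewrite /row_free mxrank0 !mul0mx sub0mx.
Qed.

Section NeutralGraph.
Local Open Scope sesquilinear_scope.
Variables (C : numClosedFieldType) (m : nat).

(** The indefinite form [|a| ^ 2 - |b| ^ 2] of signature [(m, m)]. *)
Definition krein_mx : 'M[C]_(m + m) := block_mx 1%:M 0 0 (- 1%:M).

Lemma krein_herm : krein_mx ^t* = krein_mx.
Proof.
by rewrite /krein_mx tr_block_mx map_block_mx !trmx0 !map_mx0 linearN /=
  map_mxN !trmx1 !map_mx1.
Qed.

Lemma krein_unit : krein_mx \in unitmx.
Proof.
have : krein_mx *m krein_mx = 1%:M.
  rewrite /krein_mx mulmx_block !(mulmx0, mul0mx, addr0, add0r, mul1mx).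
  by rewrite mulmxN mulmx1 opprK -scalar_mx_block.
by move=> /mulmx1_unit[].
Qed.

(** The [m]-dimensional invariant neutral subspace contains no vector with
    vanishing first half, for then the second half would have norm zero too; it
    is therefore a graph, and neutrality says that the map [U] is unitary. *)
Lemma invariant_unitary_graph (N : 'M[C]_(m + m)) :
  N *m krein_mx *m N ^t* = krein_mx ->
  (forall z, eigenvalue N z -> z * z^* != 1) ->
  exists U X : 'M[C]_m, U *m U ^t* = 1%:M /\
    row_mx 1%:M U *m N = X *m row_mx 1%:M U.
Proof.
move=> NJ nuni.
have [S [Sfree SJ SN]] : exists S : 'M[C]_(m, m + m),
    [/\ row_free S, S *m krein_mx *m S ^t* = 0 & (S *m N <= S)%MS].
  exact: (neutral_subspace_exists krein_herm krein_unit NJ nuni).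
pose A := lsubmx S; pose B := rsubmx S.
have SE : S = row_mx A B by rewrite hsubmxK.
have AB : A *m A ^t* = B *m B ^t*.
  move: SJ; rewrite SE /krein_mx mul_row_block !(mulmx0, addr0, add0r, mulmx1) mulmxN mulmx1.
  rewrite tr_row_mx map_col_mx mul_row_col mulNmx => /eqP.
  by rewrite subr_eq0 => /eqP.
have norm0 (v : 'rV[C]_m) : v *m v ^t* = 0 -> v = 0.
  move=> v0; apply/rowP => j; apply/eqP; rewrite mxE.
  have : (v *m v ^t*) 0 0 = 0 by rewrite v0 mxE.
  rewrite mxE => /eqP; rewrite psumr_eq0; last first.
    by move=> i _; rewrite !mxE mul_conjC_ge0.
  by move=> /allP /(_ j); rewrite mem_index_enum !mxE mul_conjC_eq0 => /(_ isT).
have Aunit : A \in unitmx.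
  rewrite -row_free_unit -kermx_eq0; apply/eqP/row_matrixP => i; rewrite row0.
  have vA : row i (kermx A) *m A = 0 by rewrite -row_mul mulmx_ker row0.
  move: vA; move: (row i _) => v vA.
  have vB : v *m B = 0.
    apply: norm0; rewrite trmxC_mul mulmxA -(mulmxA v) -AB mulmxA vA.
    by rewrite !mul0mx.
  have : v *m S = 0 by rewrite SE mul_mx_row vA vB row_mx0.
  by move/eqP; rewrite mulmx_free_eq0// => /eqP.
have [T TE] := submxP SN.
exists (invmx A *m B), (invmx A *m T *m A); split.
  rewrite trmxC_mul mulmxA -(mulmxA (invmx A)) -AB !mulmxA mulVmx// mul1mx.
  by rewrite -trmxC_mul mulVmx// trmx1 map_mx1.
have -> : row_mx 1%:M (invmx A *m B) = invmx A *m S.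
  by rewrite SE mul_mx_row mulVmx.
by rewrite -[LHS]mulmxA TE !mulmxA mulmxK.
Qed.

Definition rnorm2 (v : 'rV[C]_m) : C := (v *m v ^t*) 0 0.

Lemma rnorm2E v : rnorm2 v = \sum_j `|v 0 j| ^+ 2.
Proof.
by rewrite /rnorm2 mxE; apply: eq_bigr => j _; rewrite !mxE normCK.
Qed.

Lemma rnorm2_unitary v (U : 'M[C]_m) : U *m U ^t* = 1%:M ->
  rnorm2 (v *m U) = rnorm2 v.
Proof.
by move=> UU; rewrite /rnorm2 trmxC_mul mulmxA -(mulmxA v) UU mulmx1.
Qed.

(** In an orthonormal eigenbasis the resolvent is bounded by the inverse distance
    to the spectrum. *)
Lemma hermitian_approximate_eigenvalue (H : 'M[C]_m) (y : 'rV[C]_m) (tau e : C) :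
  H \is hermsymmx -> 0 <= e -> 0 < rnorm2 y -> rnorm2 (y *m H - tau *: y) <= e * rnorm2 y ->
  exists2 z, eigenvalue H z & `|z - tau| ^+ 2 <= e.
Proof.
move=> /hermitian_normalmx /orthomx_spectralP HE e0 y0 He.
set P := spectralmx H in HE; set D := spectral_diag H in HE.
have Pu : P \is unitarymx by exact: spectral_unitarymx.
have PU : P \in unitmx by exact: unitarymx_unit.
have PP : P *m P ^t* = 1%:M by apply/unitarymxP.
have PP' : P ^t* *m P = 1%:M by apply: mulmx1C.
pose x := y *m P ^t*.
have PPt : (P ^t*) *m (P ^t*) ^t* = 1%:M by rewrite trmxCK.
have yx : rnorm2 x = rnorm2 y by rewrite rnorm2_unitary.
have PH : P *m H = diag_mx D *m P by rewrite [in LHS]HE !mulmxA mulmxV// mul1mx.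
have ev j : eigenvalue H (D 0 j).
  apply/eigenvalueP; exists (row j P).
    by rewrite -row_mul PH; apply/rowP => k; rewrite mxE mul_diag_mx !mxE.
  apply/eqP => Pj0; have : (P *m P ^t*) j j = 1 by rewrite PP mxE eqxx.
  have /rowP E := Pj0; rewrite mxE big1 => [/esym/eqP|k _].
    by rewrite oner_eq0.
  by have := E k; rewrite !mxE => ->; rewrite mul0r.
have xE : y *m H - tau *: y = (x *m diag_mx D - tau *: x) *m P.
  have yE : y = x *m P by rewrite -mulmxA PP' mulmx1.
  by rewrite mulmxBl -scalemxAl -yE -mulmxA -PH mulmxA -yE.
have [j Dj] : exists j, `|D 0 j - tau| ^+ 2 <= e.
  apply: contrapT => nj.
  have lt j : e < `|D 0 j - tau| ^+ 2.
    rewrite real_ltNge ?ger0_real ?exprn_ge0//.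
    by apply/negP => le; apply: nj; exists j.
  have Sx : \sum_j `|x 0 j| ^+ 2 * (`|D 0 j - tau| ^+ 2 - e) <= 0.
    move: He; rewrite xE rnorm2_unitary// -yx !rnorm2E mulr_sumr -subr_le0 -sumrB.
    congr (_ <= _); apply: eq_bigr => j _; rewrite mul_mx_diag !mxE.
    set a := \sum_k _; have -> : a * D 0 j - tau * a = a * (D 0 j - tau) by ring.
    by rewrite normrM exprMn; ring.
  have S0 j : true -> 0 <= `|x 0 j| ^+ 2 * (`|D 0 j - tau| ^+ 2 - e).
    by move=> _; rewrite mulr_ge0 ?exprn_ge0// subr_ge0 ltW.
  have /eqP : \sum_j `|x 0 j| ^+ 2 * (`|D 0 j - tau| ^+ 2 - e) == 0.
    by rewrite eq_le Sx sumr_ge0.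
  move=> /eqP; rewrite psumr_eq0// => /allP x0.
  move: y0; rewrite -yx rnorm2E big1 ?ltxx// => j _.
  have := x0 j (mem_index_enum j); rewrite mulf_eq0 /= subr_eq0 => /orP[/eqP //|].
  by rewrite gt_eqF.
by exists (D 0 j).
Qed.
End NeutralGraph.

(** * The transfer matrix at high energy *)

Section ComplexFacts.
Context {R : realType}.

Lemma conjCE (z : R[i]) : Num.conj z = z^*.
Proof. by []. Qed.

Lemma normC_real (x : R) : `|x%:C| = `|x|%:C.
Proof. by rewrite normc_def /= expr0n /= addr0 sqrtr_sqr. Qed.

Lemma norm_le_n1 (z : R[i]) : `|z| <= (n1 z)%:C.
Proof.
rewrite {1}(complexE z) (le_trans (ler_normD _ _))// normrM /n1 rmorphD /=.
by rewrite !normC_real normc_def /= expr0n /= add0r expr1n sqrtr1 mul1r.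
Qed.

Lemma unimodular_expi (z : R[i]) : z * Num.conj z = 1 ->
  exists2 t : R, - pi < t <= pi & z = expi t.
Proof.
case: z => a b; rewrite conjCE => -[] E _.
have {}E : a ^+ 2 + b ^+ 2 = 1 by rewrite -E; ring.
have a1 : -1 <= a <= 1 by apply/andP; split; nra.
have aI : cos (acos a) = a by apply: acosK; rewrite in_itv.
have s2 : sin (acos a) ^+ 2 = b ^+ 2.
  by have := cos2Dsin2 (acos a); rewrite aI -E => /addrI.
have s0 : 0 <= sin (acos a) by apply: sin_ge0_pi; rewrite acos_ge0 ?acos_lepi.
have pi0 := pi_gt0 R.
have [b0|b0] := leP 0 b.
  exists (acos a); first by rewrite acos_lepi// andbT (lt_le_trans _ (acos_ge0 _))// oppr_lt0.
  apply: complex_eq => //=; apply/eqP; rewrite eq_sym -(eqrXn2 (ltn0Sn 1))//.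
  exact/eqP.
exists (- acos a).
  have acos0 : 0 <= acos a by exact: acos_ge0.
  apply/andP; split; last by lra.
  rewrite ltrN2 lt_neqAle acos_lepi// andbT; apply/eqP => api.
  by have := s2; rewrite api sinpi expr0n /= => /esym/eqP; rewrite sqrf_eq0 lt_eqF.
rewrite /expi cosN sinN aI; congr (_ +i* _); apply/eqP.
rewrite -eqr_oppLR -(eqrXn2 (ltn0Sn 1))// ?oppr_ge0 ?ltW// sqrrN.
exact/eqP/esym.
Qed.

Lemma square_summable_cintegrable (a b : R) (f : R -> R[i]) :
  square_summable `[a, b] f -> cintegrable `[a, b] f /\
  leb.-integrable `[a, b] (EFin \o (fun x => abs2 (f x))).
Proof.
move=> [mf ff].
have [mr mi] : cmeasurable_fun (`[a, b]%classic : set (measurableTypeR R)) f by exact: mf.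
have mabs : measurable_fun (`[a, b]%classic : set (measurableTypeR R)) (fun x => abs2 (f x)).
  by apply: measurable_funD; apply: measurable_funX; [exact: mr|exact: mi].
have ai : leb.-integrable `[a, b] (EFin \o (fun x => abs2 (f x))).
  apply/integrableP; split; first exact/measurable_EFinP.
  under eq_integral do rewrite /= ger0_norm ?abs2_ge0//.
  exact: ff.
split=> //; apply: (@cintegrable_dom _ _ _ (fun x => 1 + 2 * abs2 (f x))) => //.
  move=> x _; have := n1_le_abs2 (f x); have := sqr_ge0 (n1 (f x) - 1).
  have := n1_ge0 (f x); nra.
by apply: rintegrableD => //; [exact: integrable_ab_cst|exact: rintegrableZ].
Qed.
End ComplexFacts.

Section Transfer.
Context {R : realType} (m : nat) (Q : R -> 'M[R[i]]_m).
Hypothesis hQ : periodic_potential Q.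

Lemma Q_integrable a b s j : cintegrable `[a, b] (fun x => Q x s j).
Proof. by have [_ H _] := hQ; have [] := square_summable_cintegrable (H a b s j). Qed.

Lemma Q_herm x s j : Q x s j = (Q x j s)^*.
Proof.
have [H _ _] := hQ; have /is_hermitianmxP -> := H x.
rewrite expr0 scale1r !mxE /=.
by have /is_hermitianmxP {1}-> := H x; rewrite expr0 scale1r !mxE.
Qed.

Definition osc_coef (r : R) : R[i] := - 'i%C * ((2 * r)^-1)%:C.

(** Variation of constants: in the variables [a], [b] of
    [y = e^{irx} a + e^{-irx} b], [y' = ir (e^{irx} a - e^{-irx} b)], the equation
    [- y'' + Q y = r ^ 2 y] is the linear system with this coefficient matrix. *)
Definition osc_mx (r x : R) : 'M[R[i]]_(m + m) :=
  osc_coef r *: block_mx (Q x) (expi (- (2 * r) * x) *: Q x)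
                        (- (expi (2 * r * x) *: Q x)) (- Q x).

Definition Qsum x := \sum_s \sum_j n1 (Q x s j).
Definition osc_bound := ((m + m)%:R ^+ 2 * \int[leb]_(x in `[0, 1]) Qsum x : R).

Lemma osc_mx_entry r k l : exists (c : R) (e : bool) s j, forall x,
  osc_mx r x k l = (osc_coef r * (-1) ^+ e) * (expi (c * x) * Q x s j).
Proof.
rewrite /osc_mx; case: (split_ordP k) => k' ->; case: (split_ordP l) => l' ->.
- exists 0, false, k', l' => x.
  by rewrite mxE block_mxEul mul0r expi0 mul1r expr0 mulr1.
- exists (- (2 * r)), false, k', l' => x.
  by rewrite mxE block_mxEur mxE expr0 mulr1.
- exists (2 * r), true, k', l' => x.
  by rewrite mxE block_mxEdl !mxE expr1 mulrN1 mulNr mulrN.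
- exists 0, true, k', l' => x.
  by rewrite mxE block_mxEdr mxE mul0r expi0 mul1r expr1 mulrN1 mulNr mulrN.
Qed.

Lemma osc_mx_integrable r k l : cintegrable `[0, 1] (fun x => osc_mx r x k l).
Proof.
have [c [e [s [j E]]]] := osc_mx_entry r k l.
have := cintegrableZ (osc_coef r * (-1) ^+ e) (measurable_itv _)
  (cintegrable_expiM c (Q_integrable 0 1 s j)).
by apply: eq_cintegrable => // x _; rewrite E.
Qed.

Lemma n1_osc_mx r k l x : 0 < r -> n1 (osc_mx r x k l) <= r^-1 * Qsum x.
Proof.
move=> r0; have [c [e [s [j ->]]]] := osc_mx_entry r k l.
rewrite /osc_coef !mulNr n1N -!mulrA n1iM n1CM.
rewrite ger0_norm ?invr_ge0 ?mulr_ge0 ?(ltW r0)// invfM [_^-1 * _]mulrC -mulrA.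
rewrite ler_wpM2l ?invr_ge0 ?(ltW r0)// ler_pdivrMl//.
have -> : n1 ((-1) ^+ e * (expi (c * x) * Q x s j)) = n1 (expi (c * x) * Q x s j).
  by case: e; rewrite ?expr1 ?expr0 ?mul1r// mulN1r n1N.
apply: (le_trans (n1M _ _)); apply: ler_pM; rewrite ?n1_ge0 ?n1_expi//.
rewrite /Qsum (bigD1 s)//= (bigD1 j)//= -addrA lerDl addr_ge0 ?sumr_ge0// => i _.
  exact: n1_ge0.
by rewrite sumr_ge0// => k' _; exact: n1_ge0.
Qed.

Lemma Qsum_integrable : leb.-integrable `[0, 1] (EFin \o Qsum).
Proof. exact: (gs_integrable (fun s j => Q_integrable 0 1 s j)). Qed.

Lemma osc_mx_small r : 0 < r ->
  \int[leb]_(x in `[0, 1]) (\sum_k \sum_l n1 (osc_mx r x k l)) <= osc_bound / r.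
Proof.
move=> r0; apply: (@le_trans _ _
    (\int[leb]_(x in `[0, 1]) ((m + m)%:R ^+ 2 / r * Qsum x))).
  apply: le_Rintegral => //.
  - exact: (gs_integrable (osc_mx_integrable r)).
  - by apply: rintegrableZ => //; exact: Qsum_integrable.
  move=> x _; apply: (@le_trans _ _ (\sum_(k < m + m) \sum_(l < m + m) (r^-1 * Qsum x))).
    by apply: ler_sum => k _; apply: ler_sum => l _; exact: n1_osc_mx.
  by rewrite !sumr_const !card_ord -mulr_natr -mulr_natr; lra.
rewrite RintegralZl//; last exact: Qsum_integrable.
by rewrite /osc_bound; lra.
Qed.

Lemma osc_bound_ge0 : 0 <= osc_bound.
Proof.
rewrite mulr_ge0// ?exprn_ge0//; apply: Rintegral_ge0 => x _.
by rewrite sumr_ge0// => i _; rewrite sumr_ge0// => j _; exact: n1_ge0.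
Qed.

(** The columns of [W] are obtained by successive approximation from the columns
    of the identity; after the first correction, the integral of the coefficient
    matrix, the error is quadratic in the size of the coefficients. *)
Lemma transfer_matrix r : 0 < r -> 2 * osc_bound <= r ->
  exists W : R -> 'M[R[i]]_(m + m),
    [/\ forall k l, CAC 0 1 (fun x => W x k l) (fun x => (osc_mx r x *m W x) k l),
        W 0 = 1%:M
      & forall k l, n1 (W 1 k l - ((1%:M : 'M[R[i]]_(m + m)) k l
          + cintegral `[0, 1] (fun x => osc_mx r x k l))) <= 4 * (osc_bound / r) ^+ 2].
Proof.
move=> r0 rA; set q := osc_bound / r.
have q0 : 0 <= q by rewrite divr_ge0 ?osc_bound_ge0// ltW.
have q2 : q <= 2^-1 by rewrite ler_pdivrMr// ler_pdivlMl.
have Gi := osc_mx_integrable r.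
have small := osc_mx_small r0.
pose d (l k : 'I_(m + m)) : R[i] := (1%:M : 'M[R[i]]_(m + m)) k l.
have dE l k : d l k = (k == l)%:R by rewrite /d mxE.
have d1 l k : n1 (d l k) <= 1.
  by rewrite /d mxE; case: (_ == _); rewrite ?n1_0// /n1 /= normr1 normr0 addr0.
have sol l := linear_system_solution Gi small q2 (d1 l).
pose w l := projT1 (cid (sol l)).
have wP l : [/\ forall k, CAC 0 1 (w l k) (fun x => \sum_j osc_mx r x k j * w l j x),
    forall k, w l k 0 = d l k & forall k x, 0 <= x <= 1 -> n1 (w l k x - d l k) <= 4 * q].
  exact: (projT2 (cid (sol l))).
exists (fun x => \matrix_(k, l) w l k x); split.
- move=> k l; have [H _ _] := wP l; apply: CAC_eq (H k) _ _ => x _; rewrite mxE//.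
  by apply: eq_bigr => j _; congr (_ * _); rewrite mxE.
- by apply/matrixP => k l; rewrite mxE; have [_ -> _] := wP l.
move=> k l; have [wl w0 wd] := wP l.
rewrite mxE (CAC_incr (wl k) (lexx 0) ler01 (lexx 1)) w0 -/(d l k).
rewrite opprD addrACA subrr add0r.
have bw j : cmeasurable_fun `[0, 1] (fun x => w l j x - d l j) /\
    exists B : R, forall x, 0 <= x <= 1 -> n1 (w l j x - d l j) <= B.
  split; last by exists (4 * q) => x; exact: wd.
  by apply: cmeasurableB => //; exact: CAC_measurable (wl j).
have -> : cintegral `[0, 1] (fun x => \sum_j osc_mx r x k j * w l j x) -
    cintegral `[0, 1] (fun x => osc_mx r x k l) =
    cintegral `[0, 1] (fun x => \sum_j osc_mx r x k j * (w l j x - d l j)).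
  rewrite -mulN1r -cintegralZ// -cintegralD//; last exact: cintegrableZ.
    apply: eq_cintegral => x _; rewrite mulN1r.
    have -> : osc_mx r x k l = \sum_j osc_mx r x k j * d l j.
      rewrite (bigD1 l)//= dE eqxx mulr1 big1 ?addr0// => j jl.
      by rewrite dE (negPf jl) mulr0.
    by rewrite -sumrB; apply: eq_bigr => j _; rewrite mulrBr.
  by apply: cintegrable_sum => // j; exact: CAC_cintegrableM (wl j) (Gi k j).
have -> : 4 * q ^+ 2 = q * (4 * q) by ring.
apply: (system_integral_le Gi small (w := fun j x => w l j x - d l j)) => //.
- by rewrite lexx ler01.
- by rewrite mulr_ge0.
Qed.

(** The infinitesimal form of the conservation of the indefinite form by the flow,
    a consequence of [Q x] being Hermitian. *)
Lemma osc_mx_krein r x :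
  (osc_mx r x)^T *m krein_mx _ m + krein_mx _ m *m map_mx Num.conj (osc_mx r x) = 0.
Proof.
have QJ : map_mx Num.conj (Q x) = (Q x)^T.
  by apply/matrixP => s j; rewrite !mxE conjCE -Q_herm.
have cJ : Num.conj (osc_coef r) = - osc_coef r.
  by rewrite conjCE; apply: complex_eq; rewrite /osc_coef /=; ring.
have eJ (c : R) : Num.conj (expi (c * x)) = expi (- c * x).
  by rewrite conjCE expiJ mulNr.
have conjZ k l (c : R[i]) (A : 'M[R[i]]_(k, l)) :
    map_mx Num.conj (c *: A) = Num.conj c *: map_mx Num.conj A.
  by apply/matrixP => i j; rewrite !mxE rmorphM.
have conjN (A : 'M[R[i]]_m) : map_mx Num.conj (- A) = - map_mx Num.conj A.
  by apply/matrixP => i j; rewrite !mxE rmorphN.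
have trN (A : 'M[R[i]]_m) : (- A)^T = - A^T by apply/matrixP => i j; rewrite !mxE.
have trZ k (c : R[i]) (A : 'M[R[i]]_k) : (c *: A)^T = c *: A^T.
  by apply/matrixP => i j; rewrite !mxE.
rewrite /osc_mx trZ conjZ -scalemxAl -scalemxAr cJ scaleNr -scalerBr.
rewrite tr_block_mx map_block_mx /krein_mx !mulmx_block.
rewrite !(mulmx0, mul0mx, addr0, add0r, mulmx1, mul1mx, mulmxN, mulNmx).
rewrite !conjN !trN !conjZ !trZ !eJ QJ !opprK.
by rewrite subrr scaler0.
Qed.

Lemma transfer_krein r (W : R -> 'M[R[i]]_(m + m)) :
  (forall k l, CAC 0 1 (fun x => W x k l) (fun x => (osc_mx r x *m W x) k l)) ->
  W 0 = 1%:M ->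
  (W 1)^T *m krein_mx _ m *m map_mx Num.conj (W 1) = krein_mx _ m.
Proof.
move=> WE W0; set J := krein_mx _ m.
pose F x := (W x)^T *m J *m map_mx Num.conj (W x).
pose F' x := (osc_mx r x *m W x)^T *m J *m map_mx Num.conj (W x) +
  (W x)^T *m J *m map_mx Num.conj (osc_mx r x *m W x).
have FC k l : CAC 0 1 (fun x => F x k l) (fun x => F' x k l).
  have H i j : CAC 0 1 (fun x => J i j * (W x i k * (W x j l)^*))
      (fun x => J i j * ((osc_mx r x *m W x) i k * (W x j l)^*
                    + W x i k * ((osc_mx r x *m W x) j l)^*)).
    by apply: CAC_Z; apply: CAC_mul => //; exact: CAC_J.
  have expand (A B : 'M[R[i]]_(m + m)) : (A^T *m J *m map_mx Num.conj B) k l =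
      \sum_j \sum_i J i j * (A i k * (B j l)^*).
    rewrite mxE; apply: eq_bigr => j _; rewrite mxE mulr_suml; apply: eq_bigr => i _.
    by rewrite !mxE conjCE mulrCA mulrA.
  have := @CAC_sum R 0 1 _ (index_enum _) _ _ (fun j => @CAC_sum R 0 1 _ (index_enum _) _ _ (fun i => H i j)).
  move=> /CAC_eq; apply => x _; first by rewrite /F expand.
  rewrite /F' mxE !expand -big_split /=; apply: eq_bigr => j _.
  by rewrite -big_split /=; apply: eq_bigr => i _; rewrite mulrDr.
have F'0 x : F' x = 0.
  rewrite /F' trmx_mul map_mxM.
  have := congr1 (fun A => (W x)^T *m A *m map_mx Num.conj (W x)) (osc_mx_krein r x).
  by rewrite /= mulmxDr mulmxDl mulmx0 mul0mx !mulmxA.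
have F0 : F 0 = J by rewrite /F W0 trmx1 map_mx1 mul1mx mulmx1.
rewrite -[LHS]/(F 1) -F0; apply/matrixP => k l; rewrite (CAC_incr (FC k l) (lexx 0) ler01 (lexx 1)).
under eq_cintegral do rewrite F'0 mxE.
by rewrite cintegral0 addr0.
Qed.

Lemma mean_matrix_herm : mean_matrix Q \is hermsymmx.
Proof.
apply/is_hermitianmxP; rewrite expr0 scale1r; apply/matrixP => s j.
rewrite !mxE conjCE -cintegralJ//; last exact: Q_integrable.
by apply: eq_cintegral => x _; rewrite Q_herm.
Qed.

Lemma n1_osc_coef r : 0 < r -> n1 (osc_coef r) = (2 * r)^-1.
Proof.
move=> r0; rewrite /osc_coef mulNr n1N n1iM n1C ger0_norm//.
by rewrite invr_ge0 mulr_ge0// ltW.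
Qed.

(** To first order in [1 / r] the transfer matrix only sees the mean value [C]:
    the off-diagonal blocks are Fourier coefficients of [Q] at the frequency
    [r / pi], which tend to zero. *)
Lemma transfer_asymptotics e : 0 < e -> exists2 P, 0 < P & forall r, P < r ->
  exists W : R -> 'M[R[i]]_(m + m), exists E11 E12 E21 E22 : 'M[R[i]]_m,
    [/\ forall k l, CAC 0 1 (fun x => W x k l) (fun x => (osc_mx r x *m W x) k l),
        W 0 = 1%:M,
        (W 1)^T *m krein_mx _ m *m map_mx Num.conj (W 1) = krein_mx _ m,
        W 1 = block_mx (1%:M + osc_coef r *: mean_matrix Q + E11) E12
                       E21 (1%:M - osc_coef r *: mean_matrix Q + E22)
      & forall k l, [/\ n1 (E11 k l) <= e / r, n1 (E12 k l) <= e / r,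
                        n1 (E21 k l) <= e / r & n1 (E22 k l) <= e / r]].
Proof.
move=> e0; set A := osc_bound.
have A0 : 0 <= A by exact: osc_bound_ge0.
have RL s j : exists P : R, forall c, P < `|c| ->
    n1 (cintegral `[0, 1] (fun x => expi (c * x) * Q x s j)) <= e.
  by apply: Riemann_Lebesgue => //; exact: Q_integrable.
pose Pf s j := projT1 (cid (RL s j)).
have PfP s j c : Pf s j < `|c| ->
    n1 (cintegral `[0, 1] (fun x => expi (c * x) * Q x s j)) <= e.
  exact: (projT2 (cid (RL s j))).
pose P0 := \sum_s \sum_j `|Pf s j|.
have PfP0 s j : Pf s j <= P0.
  apply: (le_trans (ler_norm _)); rewrite /P0 (bigD1 s)//= (bigD1 j)//= -addrA lerDl.
  by rewrite addr_ge0 ?sumr_ge0// => k _; rewrite sumr_ge0.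
exists (1 + P0 + 2 * A + 8 * A ^+ 2 / e) => [|r Pr].
  have P00 : 0 <= P0 by rewrite sumr_ge0// => s _; rewrite sumr_ge0.
  have : 0 <= 8 * A ^+ 2 / e by apply: divr_ge0; [apply: mulr_ge0 => //; exact: exprn_ge0|exact: ltW].
  lra.
have P00 : 0 <= P0 by rewrite sumr_ge0// => s _; rewrite sumr_ge0.
have X0 : 0 <= 8 * A ^+ 2 / e by apply: divr_ge0; [apply: mulr_ge0 => //; exact: exprn_ge0|exact: ltW].
have r0 : 0 < r by lra.
have rA : 2 * A <= r by lra.
have rX : 8 * A ^+ 2 / e <= r by lra.
have [W [WC W0 W1]] := transfer_matrix r0 rA.
pose L := 1%:M + \matrix_(k, l) cintegral `[0, 1] (fun x => osc_mx r x k l) : 'M[R[i]]_(m + m).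
have W1' k l : n1 ((W 1 - L) k l) <= e / r / 2.
  rewrite !mxE; move: (W1 k l); rewrite !mxE => /le_trans; apply.
  have r_neq0 : r != 0 by rewrite gt_eqF.
  have -> : e / r / 2 = (r * e) / (2 * r ^+ 2) by field.
  have -> : 4 * (osc_bound / r) ^+ 2 = (8 * A ^+ 2) / (2 * r ^+ 2) by rewrite /A; field.
  rewrite ler_wpM2r//; last by rewrite -ler_pdivrMr.
  by rewrite invr_ge0 mulr_ge0// exprn_ge0// ltW.
pose c := osc_coef r; pose C := mean_matrix Q.
pose B12 := \matrix_(s, j) (c * cintegral `[0, 1] (fun x => expi (- (2 * r) * x) * Q x s j)) : 'M[R[i]]_m.
pose B21 := \matrix_(s, j) - (c * cintegral `[0, 1] (fun x => expi (2 * r * x) * Q x s j)) : 'M[R[i]]_m.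
have LE : L = block_mx (1%:M + c *: C) B12 B21 (1%:M - c *: C).
  have Qi s j : cintegrable `[0, 1] (fun x => Q x s j) by exact: Q_integrable.
  have Ei (t : R) s j : cintegrable `[0, 1] (fun x => expi (t * x) * Q x s j).
    by apply: cintegrable_expiM.
  apply/matrixP => k l; rewrite /L mxE [in X in _ + X]mxE.
  case: (split_ordP k) => s ->; case: (split_ordP l) => j ->.
  - rewrite block_mxEul !mxE eq_lshift -cintegralZ//; congr (_ + _).
    by apply: eq_cintegral => x _; rewrite /osc_mx mxE block_mxEul.
  - rewrite block_mxEur !mxE eq_lrshift add0r -cintegralZ//.
    by apply: eq_cintegral => x _; rewrite /osc_mx mxE block_mxEur mxE.
  - rewrite block_mxEdl !mxE eq_rlshift add0r -mulNr -cintegralZ//.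
    by apply: eq_cintegral => x _; rewrite /osc_mx mxE block_mxEdl !mxE mulrN mulNr.
  - rewrite block_mxEdr !mxE eq_rshift -mulNr -cintegralZ//; congr (_ + _).
    by apply: eq_cintegral => x _; rewrite /osc_mx mxE block_mxEdr mxE mulrN mulNr.
have Bb s j (t : R) : r < `|t| ->
    n1 (c * cintegral `[0, 1] (fun x => expi (t * x) * Q x s j)) <= e / r / 2.
  move=> rt; apply: (le_trans (n1M _ _)); rewrite n1_osc_coef// invfM.
  have -> : e / r / 2 = (2^-1 * r^-1) * e by field; rewrite gt_eqF.
  rewrite ler_wpM2l ?mulr_ge0 ?invr_ge0 ?(ltW r0)// PfP//.
  by apply: (le_lt_trans (PfP0 s j)); apply: lt_trans rt; lra.
have r2 : r < `|2 * r| by rewrite gtr0_norm ?mulr_gt0//; lra.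
have r2' : r < `|- (2 * r)| by rewrite normrN.
pose D := W 1 - L.
have D1 k l : n1 (D k l) <= e / r / 2 by exact: W1'.
have er : 0 <= e / r by rewrite divr_ge0 ?(ltW e0) ?(ltW r0).
exists W, (ulsubmx D), (B12 + ursubmx D), (B21 + dlsubmx D), (drsubmx D); split => //.
- exact: transfer_krein WC W0.
- rewrite -/c -/C -[W 1](subrK L) -/D -{1}(submxK D) LE addrC add_block_mx.
  by [].
clearbody D; move=> k l; split.
- by rewrite !mxE; apply: (le_trans (D1 _ _)); lra.
- rewrite mxE; apply: (le_trans (n1D _ _)); have -> : e / r = e / r / 2 + e / r / 2 by field; rewrite gt_eqF.
  by apply: lerD; rewrite mxE; [exact: Bb|rewrite !mxE; exact: D1].
- rewrite mxE; apply: (le_trans (n1D _ _)); have -> : e / r = e / r / 2 + e / r / 2 by field; rewrite gt_eqF.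
  by apply: lerD; rewrite mxE; [rewrite n1N; exact: Bb|rewrite !mxE; exact: D1].
- by rewrite !mxE; apply: (le_trans (D1 _ _)); lra.
Qed.
End Transfer.

(** * Consequences of having no multiplier on the unit circle *)

Lemma eigenvalue_tr (F : fieldType) n (A : 'M[F]_n) a :
  eigenvalue A^T a = eigenvalue A a.
Proof.
have -> : A^T = (A - a%:M)^T + a%:M.
  by apply/matrixP => i j; rewrite !mxE [j == i]eq_sym subrK.
by rewrite /eigenvalue /eigenspace !kermx_eq0 !row_free_unit addrK unitmx_tr.
Qed.

Section Resonance.
Context {R : realType} (m : nat).
Implicit Types (C U : 'M[R[i]]_m).

(** One-period free propagation in the basis [e^{irx}], [e^{-irx}]. *)
Definition phase_mx (r : R) : 'M[R[i]]_(m + m) :=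
  block_mx (expi r)%:M 0 0 (expi (- r))%:M.

Lemma sqr_norm_abs2 (z : R[i]) : `|z| ^+ 2 = (abs2 z)%:C.
Proof. by rewrite -add_Re2_Im2. Qed.

Lemma norm_expi (t : R) : `|expi t| = 1 :> R[i].
Proof.
apply/eqP; rewrite -(@eqrXn2 _ 2)// expr1n sqr_norm_abs2 /abs2 /=.
by rewrite cos2Dsin2.
Qed.

Lemma phase_krein r : phase_mx r *m krein_mx _ m *m map_mx Num.conj (phase_mx r) = krein_mx _ m.
Proof.
rewrite /phase_mx /krein_mx map_block_mx !map_mx0 !map_scalar_mx /= !conjCE.
rewrite !mulmx_block !(mulmx0, mul0mx, addr0, add0r, mulmx1, mul1mx, mulmxN, mulNmx).
by rewrite -!scalar_mxM !expiJ opprK expiMN expiNM.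
Qed.

Lemma rnorm2_abs2 (v : 'rV[R[i]]_m) : rnorm2 v = (\sum_j abs2 (v 0 j))%:C.
Proof.
rewrite rnorm2E rmorph_sum; apply: eq_bigr => j _ /=.
by rewrite sqr_norm_abs2.
Qed.

Lemma unitary_entry_le1 (U : 'M[R[i]]_m) i j :
  U *m map_mx Num.conj U^T = 1%:M -> `|U i j| <= 1.
Proof.
move=> /matrixP /(_ i i); rewrite !mxE eqxx => E.
rewrite -(@ler_pXn2r _ 2) ?nnegrE// expr1n -[leRHS]/(true%:R) -E (bigD1 j)//= !mxE normCK lerDl.
by apply: sumr_ge0 => k _; rewrite !mxE mul_conjC_ge0.
Qed.

Lemma rnorm_entry_le (v : 'rV[R[i]]_m) j : `|v 0 j| <= 1 + rnorm2 v.
Proof.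
apply: (@le_trans _ _ (1 + `|v 0 j| ^+ 2)).
  have [v1|v1] := real_leP (normr_real (v 0 j)) (real1 _).
    by rewrite (le_trans v1)// lerDl exprn_ge0.
  by rewrite expr2 (le_trans (ler_peMr _ (ltW v1)))// lerDr.
rewrite lerD2l rnorm2E (bigD1 j)//= lerDl.
by apply: sumr_ge0 => k _; rewrite exprn_ge0.
Qed.

Lemma norm_row_mul_le (v : 'rV[R[i]]_m) (A : 'M[R[i]]_m) (a b : R[i]) j :
  (forall k, `|v 0 k| <= a) -> (forall k, `|A k j| <= b) ->
  `|(v *m A) 0 j| <= m%:R * (a * b).
Proof.
move=> va Ab; rewrite mxE; apply: (le_trans (ler_norm_sum _ _ _)).
apply: (@le_trans _ _ (\sum_(k < m) a * b)).
  by apply: ler_sum => k _; rewrite normrM ler_pM.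
by rewrite sumr_const card_ord mulr_natl.
Qed.

Lemma phase_transfer_krein r (W1 : 'M[R[i]]_(m + m)) :
  W1^T *m krein_mx _ m *m map_mx Num.conj W1 = krein_mx _ m ->
  (W1^T *m phase_mx r) *m krein_mx _ m *m map_mx Num.conj (W1^T *m phase_mx r)^T
    = krein_mx _ m.
Proof.
move=> WJ; have pT : (phase_mx r)^T = phase_mx r.
  by rewrite /phase_mx tr_block_mx !trmx0 !tr_scalar_mx.
rewrite trmx_mul trmxK map_mxM pT.
transitivity (W1^T *m (phase_mx r *m krein_mx _ m *m map_mx Num.conj (phase_mx r)) *m
  map_mx Num.conj W1); first by rewrite !mulmxA.
by rewrite phase_krein.
Qed.

(** The two blocks of the invariance relation, with the unknown [X] eliminated. *)
Lemma graph_relation r W1 (A B E12 E21 U X : 'M[R[i]]_m) :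
  W1 = block_mx A E12 E21 B ->
  row_mx 1%:M U *m (W1^T *m phase_mx r) = X *m row_mx 1%:M U ->
  E21^T + U *m B^T = expi (2 * r) *: (A^T + U *m E12^T) *m U.
Proof.
move=> WE; rewrite WE tr_block_mx /phase_mx mulmx_block.
rewrite !(mulmx0, addr0, add0r) !mul_mx_scalar mul_row_block mul_mx_row !mul1mx mulmx1.
rewrite -!scalemxAr -!scalerDr => /eq_row_mx[XE XU].
have {}XU := congr1 (fun A => expi r *: A) XU.
move: XU; rewrite /= scalerA expiMN scale1r -XE => ->.
by rewrite -scalemxAl scalerA -expiD -scalemxAl mulr_natl mulr2n.
Qed.

(** Applied to an eigenvector [x] of [C^T], the graph relation makes [y = x U] an
    approximate eigenvector of [C^T]: the identity matrices contribute
    [(1 - zeta) y], the mean values [- c (y C^T + zeta mu y)], and everything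
    else is an error term. *)
Lemma graph_eigenvector (c zeta mu : R[i]) C (E11 E12 E21 E22 U : 'M[R[i]]_m)
    (x : 'rV[R[i]]_m) : c != 0 ->
  E21^T + U *m (1%:M - c *: C + E22)^T =
    zeta *: ((1%:M + c *: C + E11)^T + U *m E12^T) *m U ->
  x *m C^T = mu *: x ->
  let y := x *m U in
  y *m C^T - (c^-1 * (1 - zeta) - zeta * mu) *: y =
  c^-1 *: (y *m E22^T + x *m E21^T - zeta *: ((x *m E11^T + y *m E12^T) *m U)).
Proof.
move=> c_neq0 rel xC y.
have tr3 (a : R[i]) (E : 'M[R[i]]_m) : (1%:M + a *: C + E)^T = 1%:M + a *: C^T + E^T.
  by apply/matrixP => i j; rewrite !mxE eq_sym.
set Y := y *m C^T; set a := y *m E22^T; set b := x *m E21^T.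
set p := x *m E11^T *m U; set q := y *m E12^T *m U.
have L : x *m (E21^T + U *m (1%:M - c *: C + E22)^T) = b + (y + - c *: Y + a).
  rewrite -scaleNr tr3 [LHS]mulmxDr [x *m (U *m _)]mulmxA -/y.
  by rewrite !(mulmxDr y) mulmx1 -scalemxAr.
have D : x *m (zeta *: ((1%:M + c *: C + E11)^T + U *m E12^T) *m U) =
    zeta *: (y + c *: (mu *: y) + p + q).
  rewrite tr3 mulmxA -scalemxAr -scalemxAl !(mulmxDr x) mulmx1 -scalemxAr xC.
  by rewrite (mulmxA x U) -/y !mulmxDl -!scalemxAl.
have -> : (x *m E11^T + y *m E12^T) *m U = p + q by rewrite mulmxDl.
have := congr1 (fun A => x *m A) rel; rewrite /= L D.
clear L D.
move=> /rowP H; apply/rowP => j; move: (H j).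
clearbody Y a b p q; clearbody y; rewrite !mxE => {}H.
apply/eqP; rewrite -subr_eq0; apply/eqP.
transitivity (- c^-1 * (b 0 j + (y 0 j + - c * Y 0 j + a 0 j) -
   zeta * (y 0 j + c * (mu * y 0 j) + p 0 j + q 0 j))); last first.
  by rewrite H; ring.
by field.
Qed.

(** If the transfer matrix over a period has no eigenvalue on the unit circle,
    every eigenvalue [mu] of [C] has a partner [z] with [z + mu] close to a
    number that depends on [r] only.  Indeed the invariant neutral subspace is
    the graph of a unitary [U] which, to leading order, conjugates [C^T] to
    [kappa - C^T] with [kappa = (1 - e^{2ir}) / osc_coef r]. *)
Lemma resonance C (mu : R) (x : 'rV[R[i]]_m) (Bz e : R) :
  C \is hermsymmx -> (forall z, eigenvalue C z -> `|z| <= Bz%:C) ->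
  x != 0 -> x *m C^T = mu%:C *: x -> 0 < e ->
  exists2 d : R, 0 < d & exists P : R, forall r, 0 < r -> P < r ->
  forall W1 (E11 E12 E21 E22 : 'M[R[i]]_m),
    W1^T *m krein_mx _ m *m map_mx Num.conj W1 = krein_mx _ m ->
    W1 = block_mx (1%:M + osc_coef r *: C + E11) E12
                  E21 (1%:M - osc_coef r *: C + E22) ->
    (forall k l, [/\ n1 (E11 k l) <= d / r, n1 (E12 k l) <= d / r,
                     n1 (E21 k l) <= d / r & n1 (E22 k l) <= d / r]) ->
    (forall z, eigenvalue (W1^T *m phase_mx r) z -> z * Num.conj z != 1) ->
    exists2 z, eigenvalue C z &
      `|z + mu%:C - (osc_coef r)^-1 * (1 - expi (2 * r))| <= e%:C.
Proof.
move=> Ch CB x0 xC e0.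
pose e' := e / 2; have e'0 : 0 < e' by rewrite divr_gt0.
pose s := \sum_j abs2 (x 0 j).
have sE : rnorm2 x = s%:C by exact: rnorm2_abs2.
have s_gt0 : 0 < s.
  rewrite lt_neqAle sumr_ge0 ?andbT => [|j _]; last exact: abs2_ge0.
  apply/negP => /eqP s0; move: x0 => /eqP; apply; apply/rowP => j.
  move/esym/eqP: s0; rewrite psumr_eq0 => [/allP /(_ j)|k _]; last exact: abs2_ge0.
  rewrite mem_index_enum => /(_ isT) /eqP a0; apply/eqP; rewrite mxE -normr_eq0.
  by have /eqP : `|x 0 j| ^+ 2 = 0 by [rewrite sqr_norm_abs2 a0]; rewrite sqrf_eq0.
pose k0 : R := 4 * (m%:R + m%:R ^+ 2) * (1 + s).
pose K := m%:R * k0 ^+ 2.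
have m0 : 0 <= (m%:R : R) by [].
have k00 : 0 <= k0 by rewrite /k0; nra.
have K0 : 0 <= K by rewrite mulr_ge0// exprn_ge0.
pose d := e' * s / (1 + K + s).
have den0 : 0 < 1 + K + s by lra.
have d0 : 0 < d by rewrite divr_gt0// mulr_gt0.
have dK : K * d ^+ 2 <= e' ^+ 2 * s.
  rewrite /d expr_div_n mulrA ler_pdivrMr ?exprn_gt0//.
  have -> : K * (e' * s) ^+ 2 = e' ^+ 2 * s * (K * s) by ring.
  by rewrite ler_wpM2l ?mulr_ge0 ?exprn_ge0 ?(ltW s_gt0) ?(ltW e'0)//; nra.
exists d => //; exists (`|mu| * (Bz + e' + `|mu|) / e') => r r0 Pr.
move=> W1 E11 E12 E21 E22 WJ WE Ed nuni.
set c := osc_coef r; set zeta := expi (2 * r).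
have c_neq0 : c != 0.
  rewrite /c /osc_coef mulNr oppr_eq0 mulf_neq0//.
    by rewrite eq_complex /= oner_eq0 andbF.
  by rewrite fmorph_eq0 invr_eq0 gt_eqF// mulr_gt0.
have NJ := phase_transfer_krein r WJ.
have [U [X [UU UX]]] := invariant_unitary_graph NJ nuni.
have rel := graph_relation WE UX.
pose y := x *m U.
pose v := y *m E22^T + x *m E21^T - zeta *: ((x *m E11^T + y *m E12^T) *m U).
pose tau := c^-1 * (1 - zeta) - zeta * mu%:C.
have yE : y *m C^T - tau *: y = c^-1 *: v by exact: graph_eigenvector.
have cn : `|c^-1| = (2 * r)%:C.
  rewrite normfV /c /osc_coef normrM normrN complexiE normCi mul1r normC_real.
  by rewrite ger0_norm ?invr_ge0 ?mulr_ge0 ?(ltW r0)// -fmorphV invrK.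
have eta_le (E : R[i]) : n1 E <= d / r -> `|E| <= (d / r)%:C.
  by move=> H; apply: (le_trans (norm_le_n1 E)); rewrite lecR.
have x1 j : `|x 0 j| <= (1 + s)%:C.
  by rewrite rmorphD rmorph1 /= -sE rnorm_entry_le.
have y1 j : `|y 0 j| <= (1 + s)%:C.
  by rewrite rmorphD rmorph1 /= -sE -(rnorm2_unitary x UU) rnorm_entry_le.
have cv j : `|(c^-1 *: v) 0 j| <= (k0 * d)%:C.
  have nr (w : 'rV[R[i]]_m) (A : 'M[R[i]]_m) (a b : R) i :
      (forall k, `|w 0 k| <= a%:C) -> (forall k, `|A k i| <= b%:C) ->
      `|(w *m A) 0 i| <= (m%:R * (a * b))%:C.
    by move=> wa Ab; have := norm_row_mul_le wa Ab; rewrite !rmorphM /= rmorph_nat.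
  have ent (A B D : 'rV[R[i]]_m) :
      (A + B - zeta *: D) 0 j = A 0 j + B 0 j - zeta * D 0 j by rewrite !mxE.
  have ET (E : 'M[R[i]]_m) : (forall k l, n1 (E k l) <= d / r) ->
      forall k l, `|E^T k l| <= (d / r)%:C.
    by move=> H k l; rewrite mxE; apply: eta_le.
  have e11 := ET _ (fun k l => let: And4 H _ _ _ := Ed k l in H).
  have e12 := ET _ (fun k l => let: And4 _ H _ _ := Ed k l in H).
  have e21 := ET _ (fun k l => let: And4 _ _ H _ := Ed k l in H).
  have e22 := ET _ (fun k l => let: And4 _ _ _ H := Ed k l in H).
  pose t := m%:R * ((1 + s) * (d / r)).
  have vj : `|v 0 j| <= (t + t + m%:R * ((t + t) * 1))%:C.
    rewrite /v ent rmorphD (le_trans (ler_normB _ _))// lerD//.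
      rewrite rmorphD (le_trans (ler_normD _ _))// lerD//.
        by apply: (nr _) => k; [exact: y1|exact: e22].
      by apply: (nr _) => k; [exact: x1|exact: e21].
    rewrite normrM norm_expi mul1r; apply: (nr _) => k.
      rewrite mxE rmorphD (le_trans (ler_normD _ _))// lerD//.
        by apply: (nr _) => i; [exact: x1|exact: e11].
      by apply: (nr _) => i; [exact: y1|exact: e12].
    by rewrite rmorph1; exact: unitary_entry_le1.
  rewrite mxE normrM cn; apply: (@le_trans _ _ ((2 * r)%:C * (t + t + m%:R * ((t + t) * 1))%:C)).
    by rewrite ler_wpM2l// ler0c mulr_ge0// ltW.
  rewrite -rmorphM lecR le_eqVlt /t /k0; apply/orP; left; apply/eqP.
  by field; rewrite gt_eqF.
have vK : rnorm2 (c^-1 *: v) <= (K * d ^+ 2)%:C.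
  rewrite rnorm2E; apply: (@le_trans _ _ (\sum_(j < m) ((k0 * d)%:C ^+ 2))).
    by apply: ler_sum => j _; rewrite ler_pXn2r ?nnegrE// ler0c mulr_ge0// ltW.
  by rewrite sumr_const card_ord -mulr_natl -rmorphXn /= -(rmorph_nat (real_complex R)) -rmorphM lecR /= /K exprMn mulrA.
have CT : C^T \is hermsymmx.
  apply/is_hermitianmxP; rewrite expr0 scale1r trmxK.
  have /is_hermitianmxP := Ch; rewrite expr0 scale1r => {1}->.
  by apply/matrixP => i j; rewrite !mxE.
have [|||z zev zt] := @hermitian_approximate_eigenvalue _ _ C^T y tau (e' ^+ 2)%:C CT.
- by rewrite ler0c exprn_ge0// ltW.
- by rewrite rnorm2_unitary// sE ltcR.
- rewrite yE (le_trans vK)// rnorm2_unitary// sE -rmorphM lecR.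
  exact: dK.
have zC : eigenvalue C z.
  by rewrite -eigenvalue_tr.
have zt' : `|z - tau| <= e'%:C.
  have e'C : 0 <= e'%:C :> R[i] by rewrite ler0c ltW.
  move: zt; rewrite [(e' ^+ 2)%:C](_ : _ = e'%:C ^+ 2); last exact: rmorphXn.
  by rewrite ler_pXn2r.
exists z => //.
have -> : z + mu%:C - c^-1 * (1 - zeta) = (z - tau) + mu%:C * (1 - zeta).
  by rewrite /tau; ring.
rewrite [e](_ : e = e' + e') ?rmorphD; last by rewrite /e'; field.
rewrite (le_trans (ler_normD _ _))// lerD//.
(* [tau] is close to an eigenvalue of [C], hence bounded; as [c^-1] has modulus
   [2 r], this forces [zeta] to be close to [1], and [zeta mu] to [mu]. *)
have tauB : `|c^-1 * (1 - zeta)| <= (Bz + e' + `|mu|)%:C.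
  have -> : c^-1 * (1 - zeta) = z - (z - tau) + zeta * mu%:C by rewrite /tau; ring.
  rewrite rmorphD (le_trans (ler_normD _ _))// lerD//.
    by rewrite rmorphD (le_trans (ler_normB _ _))// lerD// CB.
  by rewrite normrM norm_expi mul1r normC_real.
have z1 : `|1 - zeta| <= ((Bz + e' + `|mu|) / (2 * r))%:C.
  move: tauB; rewrite normrM cn => tauB.
  have -> : (Bz + e' + `|mu|) / (2 * r) = (2 * r)^-1 * (Bz + e' + `|mu|) by rewrite mulrC.
  have r2 : 0 < (2 * r)%:C :> R[i] by rewrite ltcR mulr_gt0.
  by rewrite rmorphM fmorphV ler_pdivlMl.
rewrite normrM normC_real.
apply: (@le_trans _ _ (`|mu|%:C * ((Bz + e' + `|mu|) / (2 * r))%:C)).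
  by rewrite ler_wpM2l// ler0c.
rewrite -rmorphM lecR mulrA ler_pdivrMr ?mulr_gt0//.
by move: Pr; rewrite ltr_pdivrMr//; nra.
Qed.
End Resonance.

(** * Bloch solutions at every high energy *)

Section HighEnergy.
Context {R : realType} (m : nat) (Q : R -> 'M[R[i]]_m).
Hypothesis hQ : periodic_potential Q.

(** [- y'' + Q y = l y] on [[a, b]], with [dy] for [y']. *)
Definition solves (l a b : R) (y dy : R -> 'cV[R[i]]_m) : Prop :=
  (forall j, CAC a b (fun x => y x j 0) (fun x => dy x j 0)) /\
  (forall j, CAC a b (fun x => dy x j 0) (fun x => (Q x *m y x - l%:C *: y x) j 0)).

Lemma expi_double (r x : R) : expi (2 * r * x) = expi (r * x) * expi (r * x).
Proof. by rewrite -expiD; congr expi; ring. Qed.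

Lemma expi_inv (x : R) : expi (- x) = (expi x)^-1.
Proof. by rewrite -[LHS]mulr1 -(divff (expi_neq0 x)) mulrA expiNM mul1r. Qed.

Lemma osc_mx_solves (r : R) (A : R -> 'cV[R[i]]_(m + m)) : 0 < r ->
  (forall k, CAC 0 1 (fun x => A x k 0) (fun x => (osc_mx Q r x *m A x) k 0)) ->
  let a x := usubmx (A x) in let b x := dsubmx (A x) in
  solves (r ^+ 2) 0 1
    (fun x => expi (r * x) *: a x + expi (- r * x) *: b x)
    (fun x => ('i%C * r%:C) *: (expi (r * x) *: a x - expi (- r * x) *: b x)).
Proof.
move=> r0 AC a b.
have AE x : A x = col_mx (a x) (b x) by rewrite vsubmxK.
pose qa x := Q x *m a x; pose qb x := Q x *m b x.
pose c := osc_coef r.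
have FE x : expi (- r * x) = (expi (r * x))^-1 by rewrite mulNr expi_inv.
have oscA x : osc_mx Q r x *m A x =
    c *: col_mx (qa x + expi (- (2 * r) * x) *: qb x) (- (expi (2 * r * x) *: qa x + qb x)).
  by rewrite AE /osc_mx -scalemxAl mul_block_col !mulNmx -!scalemxAl opprD.
have aC j : CAC 0 1 (fun x => a x j 0)
    (fun x => c * (qa x j 0 + (expi (r * x))^-1 ^+ 2 * qb x j 0)).
  apply: CAC_eq (AC (lshift m j)) _ _ => x _; first by rewrite mxE.
  rewrite oscA mxE col_mxEu; clearbody qa qb; rewrite !mxE; congr (_ * (_ + _ * _)).
  by rewrite mulNr expi_inv expi_double -expr2 exprVn.
have bC j : CAC 0 1 (fun x => b x j 0)
    (fun x => - c * (expi (r * x) ^+ 2 * qa x j 0 + qb x j 0)).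
  apply: CAC_eq (AC (rshift m j)) _ _ => x _; first by rewrite mxE.
  rewrite oscA mxE col_mxEd; clearbody qa qb; rewrite !mxE expi_double -expr2.
  by rewrite mulrN mulNr.
have E_neq0 x := expi_neq0 (r * x).
pose Y x : 'cV[R[i]]_m := expi (r * x) *: a x + expi (- r * x) *: b x.
have yE j x : Y x j 0 = expi (r * x) * a x j 0 + expi (- r * x) * b x j 0.
  by rewrite /Y; clearbody a b; rewrite !mxE.
have QyE j x : (Q x *m Y x) j 0 = expi (r * x) * qa x j 0 + (expi (r * x))^-1 * qb x j 0.
  rewrite /Y mulmxDr -!scalemxAr -/(qa x) -/(qb x) FE.
  by clearbody qa qb; rewrite !mxE.
have Ea j := CAC_mul (CAC_expi 0 1 r) (aC j).
have Fb j := CAC_mul (CAC_expi 0 1 (- r)) (bC j).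
split=> j.
- apply: CAC_eq (CAC_D (Ea j) (Fb j)) _ _ => x _ /=.
    by rewrite -/(Y x) yE.
  rewrite (_ : (('i%C * r%:C) *: (expi (r * x) *: a x - expi (- r * x) *: b x)) j 0 =
      ('i%C * r%:C) * (expi (r * x) * a x j 0 - expi (- r * x) * b x j 0)); last first.
    by clearbody a b; rewrite !mxE.
  rewrite FE rmorphN; move: (E_neq0 x); set E := expi (r * x) => En.
  by field.
- apply: CAC_eq (CAC_Z ('i%C * r%:C) (CAC_D (Ea j) (CAC_Z (- 1) (Fb j)))) _ _ => x _ /=.
    by clearbody a b; rewrite !mxE mulN1r.
  rewrite -/(Y x).
  have -> : (Q x *m Y x - (r ^+ 2)%:C *: Y x) j 0 =
      (Q x *m Y x) j 0 - (r ^+ 2)%:C * Y x j 0.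
    by rewrite [LHS]mxE; congr (_ + _); rewrite mxE; congr (- _); rewrite mxE.
  rewrite QyE yE FE rmorphN [(r ^+ 2)%:C]rmorphXn /=.
  have i2 : 'i%C * 'i%C = - 1 :> R[i] by rewrite -expr2 sqr_i.
  have ic : 'i%C * r%:C * c = 2^-1.
    rewrite /c /osc_coef; set s := (2 * r)^-1.
    have -> : 'i%C * r%:C * (- 'i%C * s%:C) = - ('i%C * 'i%C) * (r%:C * s%:C) by ring.
    rewrite i2 opprK mul1r -rmorphM /= /s.
    have -> : r * (2 * r)^-1 = 2^-1 by field; rewrite gt_eqF.
    by rewrite fmorphV rmorph_nat.
  move: (E_neq0 x); set E := expi (r * x) => En.
  transitivity (('i%C * 'i%C) * r%:C ^+ 2 * (E * a x j 0 + E^-1 * b x j 0) +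
    ('i%C * r%:C * c) * 2 * (E * qa x j 0 + E^-1 * qb x j 0)); first by field.
  rewrite i2 ic; field.
  by [].
Qed.

(** An eigenvector of the transposed multiplier matrix for an eigenvalue [e^{it}]
    provides the initial values of the Bloch solution. *)
Lemma bloch_solution (r : R) (W : R -> 'M[R[i]]_(m + m)) (z : R[i]) : 0 < r ->
  (forall k l, CAC 0 1 (fun x => W x k l) (fun x => (osc_mx Q r x *m W x) k l)) ->
  W 0 = 1%:M -> eigenvalue ((W 1)^T *m phase_mx m r) z -> z * Num.conj z = 1 ->
  exists t, exists2 y, - pi < t <= pi & exists dy,
    [/\ solves (r ^+ 2) 0 1 y dy, y 1 = expi t *: y 0, dy 1 = expi t *: dy 0 &
        (y 0 != 0) || (dy 0 != 0)].
Proof.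
move=> r0 WC W0 /eigenvalueP[v vz v0] z1.
have [t tpi zE] := unimodular_expi z1.
pose u := v^T; pose A x := W x *m u.
have AC k : CAC 0 1 (fun x => A x k 0) (fun x => (osc_mx Q r x *m A x) k 0).
  have H l := CAC_Z (u l 0) (WC k l).
  apply: CAC_eq (CAC_sum (index_enum _) H) _ _ => x _.
    by rewrite [RHS]mxE; apply: eq_bigr => l _; rewrite mulrC.
  by rewrite /A mulmxA [RHS]mxE; apply: eq_bigr => l _; rewrite mulrC.
have A0 : A 0 = u by rewrite /A W0 mul1mx.
have A1 : phase_mx m r *m A 1 = z *: A 0.
  have := congr1 (fun B => B^T) vz; rewrite !trmx_mul trmxK linearZ /= -/u A0 => <-.
  by rewrite /phase_mx tr_block_mx !trmx0 !tr_scalar_mx mulmxA.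
have := A1; rewrite -(vsubmxK (A 1)) -(vsubmxK (A 0)) /phase_mx mul_block_col.
rewrite !mul_scalar_mx !mul0mx addr0 add0r scale_col_mx => /eq_col_mx[a1 b1].
have sol := osc_mx_solves r0 AC.
exists t; eexists; first exact: tpi.
eexists; split; first exact: sol.
- by rewrite /= !mulr0 !mulr1 expi0 !scale1r a1 b1 -scalerDr zE.
- rewrite /= !mulr0 !mulr1 expi0 !scale1r a1 b1 -scalerBr zE.
  by rewrite !scalerA mulrC.
rewrite /= !mulr0 expi0 !scale1r -negb_and; apply/negP => /andP[/eqP s1 s2].
have ir : ('i%C * r%:C : R[i]) != 0.
  rewrite mulf_neq0//; first by rewrite eq_complex /= oner_eq0 andbF.
  by rewrite fmorph_eq0 gt_eqF.
move: s2; rewrite scaler_eq0 (negPf ir) /= subr_eq0 => /eqP ab.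
have a0 : usubmx (A 0) = 0.
  move: s1; rewrite -ab -mulr2n -scaler_nat => /eqP.
  by rewrite scaler_eq0 pnatr_eq0 => /eqP.
move/eqP: v0; apply; apply: trmx_inj; rewrite trmx0 -/u -A0 -(vsubmxK (A 0)) -ab a0.
by rewrite col_mx0.
Qed.
End HighEnergy.

Lemma diam_le (R : realType) (E : set R) (B : R) : E !=set0 ->
  (forall x y, E x -> E y -> `|x - y| <= B) -> diam E <= B.
Proof.
move=> [a Ea] EB; apply: ge_sup; first by exists `|a - a|, a => //; exists a.
by move=> _ [x Ex] [y Ey] <-; exact: EB.
Qed.

Lemma diam_ge0 (R : realType) (E : set R) : E !=set0 -> 0 <= diam E.
Proof.
move=> [a Ea]; rewrite /diam.
have [sE|/sup_out ->//] := pselect (has_sup [set `|x - y| | x in E & y in E]).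
by apply: ub_le_sup; [case: sE|exists a => //; exists a => //; rewrite subrr normr0].
Qed.

Section NoHighGap.
Context {R : realType} (m : nat) (Q : R -> 'M[R[i]]_m) (p : nat) (mu : 'I_p -> R).
Hypothesis hQ : periodic_potential Q.
Hypothesis mu_eigenvalues : forall z : R[i],
  eigenvalue (mean_matrix Q) z <-> exists i, z = (mu i)%:C.

Lemma resonance_mean (j : 'I_p) (e : R) : 0 < e ->
  exists2 d : R, 0 < d & exists P : R, forall r, 0 < r -> P < r ->
  forall W1 (E11 E12 E21 E22 : 'M[R[i]]_m),
    W1^T *m krein_mx _ m *m map_mx Num.conj W1 = krein_mx _ m ->
    W1 = block_mx (1%:M + osc_coef r *: mean_matrix Q + E11) E12
                  E21 (1%:M - osc_coef r *: mean_matrix Q + E22) ->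
    (forall k l, [/\ n1 (E11 k l) <= d / r, n1 (E12 k l) <= d / r,
                     n1 (E21 k l) <= d / r & n1 (E22 k l) <= d / r]) ->
    (forall z, eigenvalue (W1^T *m phase_mx m r) z -> z * Num.conj z != 1) ->
    exists i, `|(mu i + mu j)%:C - (osc_coef r)^-1 * (1 - expi (2 * r))| <= e%:C.
Proof.
move=> e0.
have /eigenvalueP[x xC x0] : eigenvalue (mean_matrix Q)^T (mu j)%:C.
  by rewrite eigenvalue_tr; apply/mu_eigenvalues; exists j.
have CB z : eigenvalue (mean_matrix Q) z -> `|z| <= (\sum_i `|mu i|)%:C.
  move=> /mu_eigenvalues[i ->]; rewrite normC_real lecR (bigD1 i)//= lerDl.
  by rewrite sumr_ge0.
have [d d0 [P dP]] := resonance (mean_matrix_herm hQ) CB x0 xC e0.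
exists d => //; exists P => r r0 Pr W1 E11 E12 E21 E22 WJ WE Ed nuni.
have [z /mu_eigenvalues[i ->] zz] := dP r r0 Pr W1 _ _ _ _ WJ WE Ed nuni.
by exists i; rewrite rmorphD.
Qed.

(** Without a Bloch solution, [mu j1], [mu j2] and [mu j3] would have partners
    whose sums with them are all close to one and the same number [kappa],
    against the lower bound [d] on the diameter. *)
Lemma high_energy_bloch (j1 j2 j3 : 'I_p) (d : R)
    (d_attained : exists i1 i2 i3 : 'I_p,
       diam [set mu j1 + mu i1; mu j2 + mu i2; mu j3 + mu i3] = d)
    (d_minimal : forall i1 i2 i3 : 'I_p,
       d <= diam [set mu j1 + mu i1; mu j2 + mu i2; mu j3 + mu i3])
    (d_neq0 : d != 0) :
  exists H : R, forall l : R, H < l ->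
    exists t, exists2 y, - pi < t <= pi & exists dy,
    [/\ solves Q l 0 1 y dy, y 1 = expi t *: y 0, dy 1 = expi t *: dy 0 &
        (y 0 != 0) || (dy 0 != 0)].
Proof.
have d0 : 0 < d.
  rewrite lt_neqAle eq_sym d_neq0 /=.
  have [i1 [i2 [i3 <-]]] := d_attained; apply: diam_ge0.
  by exists (mu j1 + mu i1); left; left.
pose e := d / 8; have e0 : 0 < e by rewrite divr_gt0.
have [d1 d10 [P1 P1P]] := resonance_mean j1 e0.
have [d2 d20 [P2 P2P]] := resonance_mean j2 e0.
have [d3 d30 [P3 P3P]] := resonance_mean j3 e0.
pose dd := Num.min d1 (Num.min d2 d3).
have dd0 : 0 < dd by rewrite !lt_min d10 d20 d30.
have [P0 P00 P0P] := transfer_asymptotics hQ dd0.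
pose P := Num.max P0 (Num.max P1 (Num.max P2 P3)).
have P_gt0 : 0 < P by rewrite lt_max P00.
exists (P ^+ 2) => l Pl.
pose r := Num.sqrt l.
have l0 : 0 <= l by rewrite (le_trans _ (ltW Pl))// exprn_ge0// ltW.
have lE : l = r ^+ 2 by rewrite sqr_sqrtr.
have Pr : P < r.
  by rewrite -(@ltr_pXn2r _ 2)// ?nnegrE ?sqrtr_ge0 ?(ltW P_gt0)// -lE.
have r0 : 0 < r by exact: lt_trans Pr.
move: (Pr); rewrite /P !gt_max => /andP[r_0 /andP[r_1 /andP[r_2 r_3]]].
have [W [E11 [E12 [E21 [E22 [WC W0 WJ WE Ed]]]]]] := P0P r r_0.
rewrite lE.
have [[z ez z1]|nz] := pselect (exists2 z, eigenvalue ((W 1)^T *m phase_mx m r) z &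
    z * Num.conj z = 1); first exact: (bloch_solution r0 WC W0 ez z1).
have nuni z : eigenvalue ((W 1)^T *m phase_mx m r) z -> z * Num.conj z != 1.
  by move=> ez; apply/eqP => z1; apply: nz; exists z.
have mono d' : dd <= d' -> forall k l, [/\ n1 (E11 k l) <= d' / r, n1 (E12 k l) <= d' / r,
                     n1 (E21 k l) <= d' / r & n1 (E22 k l) <= d' / r].
  move=> dd' k k'; have le : dd / r <= d' / r by rewrite ler_wpM2r// invr_ge0 ltW.
  by have [H1 H2 H3 H4] := Ed k k'; split; apply: le_trans le.
have dd1 : dd <= d1 by rewrite ge_min lexx.
have dd2 : dd <= d2 by rewrite !ge_min lexx orbT.
have dd3 : dd <= d3 by rewrite !ge_min lexx !orbT.
have [i1 H1] := P1P r r0 r_1 _ _ _ _ _ WJ WE (mono _ dd1) nuni.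
have [i2 H2] := P2P r r0 r_2 _ _ _ _ _ WJ WE (mono _ dd2) nuni.
have [i3 H3] := P3P r r0 r_3 _ _ _ _ _ WJ WE (mono _ dd3) nuni.
set kappa := _^-1 * _ in H1 H2 H3.
have close a b : `|a%:C - kappa| <= e%:C -> `|b%:C - kappa| <= e%:C -> `|a - b| <= d / 4.
  move=> ha hb; have : `|(a - b)%:C| <= (e + e)%:C.
    have -> : (a - b)%:C = (a%:C - kappa) - (b%:C - kappa) by rewrite rmorphB /=; ring.
    by rewrite rmorphD (le_trans (ler_normB _ _))// lerD.
  by rewrite normC_real lecR => /le_trans; apply; rewrite /e; lra.
have := d_minimal i1 i2 i3.
have : diam [set mu j1 + mu i1; mu j2 + mu i2; mu j3 + mu i3] <= d / 4.
  apply: diam_le; first by exists (mu j1 + mu i1); left; left.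
  have near x : [set mu j1 + mu i1; mu j2 + mu i2; mu j3 + mu i3] x -> `|x%:C - kappa| <= e%:C.
    by move=> [[->|->]|->]; rewrite [mu _ + mu _]addrC.
  by move=> x y /near hx /near hy; exact: close.
by move=> le1 /le_trans /(_ le1) le2; exfalso; lra.
Qed.
End NoHighGap.

(** * Eigenfunctions of the quasiperiodic problems *)

Section Eigenfunctions.
Context {R : realType}.

Lemma CAC_ae (a b : R) (u f g : R -> R[i]) : CAC a b u f -> cintegrable `[a, b] g ->
  {ae lebesgue_measure, forall x : R, a <= x <= b -> f x = g x} -> CAC a b u g.
Proof.
move=> [[fr fi] uE] [gr gi] fg; split=> // x /andP[ax xb]; rewrite uE ?ax//.
congr (_ + _).
have sub (h : R -> R) : leb.-integrable `[a, b] (EFin \o h) ->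
    measurable_fun (`[a, x]%classic : set (measurableTypeR R)) (EFin \o h).
  by move=> hi; have := integrable_subitv (lexx a) xb hi; exact: measurable_int.
have ae (F : R[i] -> R) : ae_eq leb (`[a, x]%classic : set (measurableTypeR R))
    (EFin \o (fun t => F (f t))) (EFin \o (fun t => F (g t))).
  case: fg => N [mN N0 fgN]; exists N; split=> // t nt; apply: fgN => H.
  by apply: nt; rewrite /= in_itv /= => /andP[at' tx]; rewrite H// at' (le_trans tx).
rewrite /cintegral /Rintegral; congr (fine _ +i* fine _).
- by apply: ae_eq_integral => //; [exact: sub fr|exact: sub gr|exact: (ae (fun z => complex.Re z))].
- by apply: ae_eq_integral => //; [exact: sub fi|exact: sub gi|exact: (ae (fun z => complex.Im z))].
Qed.

Lemma abs2_integrable (a b : R) (u f : R -> R[i]) : CAC a b u f ->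
  leb.-integrable `[a, b] (EFin \o (fun x => abs2 (u x))).
Proof.
move=> uf; have [B uB] := CAC_bounded uf; have [mr mi] := CAC_measurable uf.
apply: (@rintegrable_dom _ _ _ (fun=> B ^+ 2)) => //.
- by apply: measurable_funD; apply: measurable_funX; [exact: mr|exact: mi].
- move=> x /=; rewrite in_itv /= => xab; rewrite ger0_norm ?abs2_ge0//.
  apply: (le_trans (abs2_le_n1 _)).
  have := uB x xab; have := n1_ge0 (u x); nra.
- exact: integrable_ab_cst.
Qed.

Lemma CAC_square_summable (a b : R) (u f : R -> R[i]) : CAC a b u f ->
  square_summable `[a, b] u.
Proof.
move=> uf; split; first exact: CAC_measurable uf.
have /integrableP[_] := abs2_integrable uf.
by under eq_integral do rewrite /= ger0_norm ?abs2_ge0//.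
Qed.

Variables (m : nat) (Q : R -> 'M[R[i]]_m).
Hypothesis hQ : periodic_potential Q.

Lemma potential_integrable (l : R) (y dy : R -> 'cV[R[i]]_m) a b j :
  (forall j, CAC a b (fun x => y x j 0) (fun x => dy x j 0)) ->
  cintegrable `[a, b] (fun x => (Q x *m y x - l%:C *: y x) j 0).
Proof.
move=> yC.
have Qy : cintegrable `[a, b] (fun x => \sum_k Q x j k * y x k 0).
  apply: cintegrable_sum => // k.
  exact: (CAC_cintegrableM (yC k) (Q_integrable hQ a b j k)).
have yi : cintegrable `[a, b] (fun x => - l%:C * y x j 0).
  have := CAC_cintegrableM (yC j) (cintegrable_itv_cst a b (- l%:C)).
  by apply: eq_cintegrable.
apply: eq_cintegrable (cintegrableD _ Qy yi) => // x _.
by rewrite !mxE mulNr.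
Qed.

Lemma eigenfunction_solves (t l : R) (y : R -> 'cV[R[i]]_m) : eigenfunction Q t l y ->
  exists dy, [/\ solves Q l 0 1 y dy, y 1 = expi t *: y 0 & dy 1 = expi t *: dy 0].
Proof.
move=> [_ _ [dy [[yC [ddy [dyC ae]]] y1 dy1]]]; exists dy; split=> //; split=> // j.
apply: (CAC_ae (dyC j)); first exact: (potential_integrable l j yC).
case: ae => N [mN N0 aeN]; exists N; split=> // x nx; apply: aeN => H; apply: nx.
move=> x01; rewrite (_ : ddy x = Q x *m y x - l%:C *: y x)//.
by rewrite (H x01) opprD opprK addrCA subrr addr0.
Qed.

Lemma solves_eigenfunction (t l : R) (y dy : R -> 'cV[R[i]]_m) :
  solves Q l 0 1 y dy -> y 1 = expi t *: y 0 -> dy 1 = expi t *: dy 0 ->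
  eigenfunction Q t l y.
Proof.
move=> [yC dyC] y1 dy1; split.
- by move=> j; exact: CAC_square_summable (yC j).
- move=> j; apply: (@CAC_square_summable _ _ _ (fun x => l%:C * dy x j 0)).
  by apply: CAC_eq (CAC_Z l%:C (yC j)) _ _ => // x _; rewrite mxE.
exists dy; split=> //; split=> //.
exists (fun x => Q x *m y x - l%:C *: y x); split; first exact: dyC.
by apply: aeW => x _; rewrite opprB subrK.
Qed.

Lemma solves_zero (l : R) (y dy : R -> 'cV[R[i]]_m) : solves Q l 0 1 y dy ->
  (forall x, 0 <= x <= 1 -> y x = 0) -> dy 0 = 0.
Proof.
move=> [yC dyC] y0; apply/colP => j; rewrite [RHS]mxE.
have dyE x : 0 <= x <= 1 -> dy x j 0 = dy 0 j 0.
  move=> /andP[x0 x1]; rewrite (CAC_incr (dyC j) (lexx 0) x0 x1).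
  rewrite -[RHS]addr0; congr (_ + _); rewrite -[RHS](cintegral0 `[0, x]%classic).
  apply: eq_cintegral => s /=; rewrite in_itv /= => /andP[s0 sx].
  by rewrite y0 ?s0 ?(le_trans sx)// mulmx0 scaler0 subrr mxE.
have := CAC_incr (yC j) (lexx 0) ler01 (lexx 1).
rewrite !y0 ?lexx ?ler01// !mxE add0r => /esym.
rewrite (@eq_cintegral _ _ _ (fun=> dy 0 j 0)) => [|x /=]; last first.
  by rewrite in_itv /= => /dyE.
rewrite /cintegral !Rintegral_ab_cst// subr0 !mulr1 => E.
by rewrite -E; apply: complex_eq.
Qed.

(** In a gap above the [n]-th band there is no value [lam t i], whatever [i];
    the solution space of [L_t(Q) y = l y] would then have dimension zero. *)
Lemma not_in_gap (t l : R) (y dy : R -> 'cV[R[i]]_m) (lam : R -> nat -> R) n :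
  eigenvalue_listing Q t (lam t) -> - pi < t <= pi ->
  solves Q l 0 1 y dy -> y 1 = expi t *: y 0 -> dy 1 = expi t *: dy 0 ->
  (y 0 != 0) || (dy 0 != 0) -> ~ gap lam n l.
Proof.
move=> [lam_le lamP] tpi sol y1 dy1 nz [below above].
have [k [[e [_ _ espan]] card]] := lamP l.
have lam_mono i j : (i <= j)%N -> lam t i <= lam t j.
  by have /nondecreasing_seqP H := lam_le; exact: H.
have tI : t \in `]- pi, pi] by rewrite in_itv.
have k0 : k = 0%N.
  have : [set i | lam t i = l] = set0.
    rewrite -subset0 => i /= li.
    have [ni|ni] := leqP i n.
      have := below (lam t n) (ex_intro2 _ _ t tI erefl).
      by rewrite -li ltNge lam_mono.
    have := above (lam t n.+1) (ex_intro2 _ _ t tI erefl).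
    by rewrite -li ltNge lam_mono.
  by move=> S0; move: card; rewrite S0 -II0 => /card_eq_II.
have y0 x : 0 <= x <= 1 -> y x = 0.
  have [c cE] := espan y (solves_eigenfunction sol y1 dy1).
  by move=> /cE ->; rewrite big1// => i _; move: (ltn_ord i); rewrite [X in (_ < X)%N]k0.
move: nz; rewrite (solves_zero sol y0) y0 ?lexx ?ler01// eqxx.
by [].
Qed.
End Eigenfunctions.

(** * Integral inequalities *)

Section Energy.
Context {R : realType}.

Lemma CAC_cintegrable a b (u f : R -> R[i]) : CAC a b u f -> cintegrable `[a, b] u.
Proof.
move=> uf; have := CAC_cintegrableM uf (cintegrable_itv_cst a b 1).
by apply: eq_cintegrable => // x _; rewrite mul1r.
Qed.

(** The variance of [h] is nonnegative. *)
Lemma Cauchy_Schwarz_itv (a b : R) (h : R -> R) : a < b ->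
  leb.-integrable `[a, b] (EFin \o h) ->
  leb.-integrable `[a, b] (EFin \o (fun x => h x ^+ 2)) ->
  (\int[leb]_(x in `[a, b]) h x) ^+ 2 <= (b - a) * \int[leb]_(x in `[a, b]) (h x ^+ 2).
Proof.
move=> ab hi h2i; have ba0 : 0 < b - a by rewrite subr_gt0.
set I := \int[leb]_(x in `[a, b]) h x; set I2 := \int[leb]_(x in `[a, b]) (h x ^+ 2).
pose t := I / (b - a).
have : 0 <= \int[leb]_(x in `[a, b]) (h x - t) ^+ 2.
  by apply: Rintegral_ge0 => x _; exact: sqr_ge0.
have -> : \int[leb]_(x in `[a, b]) (h x - t) ^+ 2 = I2 + (- (2 * t)) * I + t ^+ 2 * (b - a).
  have Zi := rintegrableZ (- (2 * t)) (measurable_itv _) hi.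
  have Ci := integrable_ab_cst a b (t ^+ 2).
  have Di := rintegrableD (measurable_itv _) h2i Zi.
  rewrite -(Rintegral_ab_cst _ (ltW ab)) -RintegralZl// -!RintegralD//.
  by apply: eq_Rintegral => x _; ring.
have -> : I2 + - (2 * t) * I + t ^+ 2 * (b - a) = I2 - I ^+ 2 / (b - a).
  by rewrite /t; field; rewrite gt_eqF.
by rewrite subr_ge0 ler_pdivrMr// mulrC.
Qed.

Lemma n1sq_integrable (a b : R) (u f : R -> R[i]) : CAC a b u f ->
  leb.-integrable `[a, b] (EFin \o (fun x => n1 (u x) ^+ 2)).
Proof.
move=> uf; have [B uB] := CAC_bounded uf.
have mu := rintegrable_measurable (cintegrable_n1 (measurable_itv _) (CAC_cintegrable uf)).
apply: (@rintegrable_dom _ _ _ (fun=> B ^+ 2)) => //.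
- exact: measurable_funX.
- move=> x /=; rewrite in_itv /= => xab; rewrite ger0_norm ?sqr_ge0//.
  have := uB x xab; have := n1_ge0 (u x); nra.
- exact: integrable_ab_cst.
Qed.

(** Integrate from the nearest grid point on the left, over a length at most
    [1 / n], and use the Cauchy-Schwarz inequality; the factor [2] compares the
    two norms. *)
Lemma Poincare_grid n (u f g : R -> R[i]) x : (0 < n)%N ->
  CAC 0 1 u f -> CAC 0 1 f g ->
  (forall k, (k < n)%N -> u (k%:R / n%:R) = 0) -> 0 <= x <= 1 ->
  n1 (u x) ^+ 2 <= 2 / n%:R * \int[leb]_(t in `[0, 1]) abs2 (f t).
Proof.
move=> n0 uf fg u0 /andP[x0 x1].
have nR : 0 < n%:R :> R by rewrite ltr0n.
have [k [kn kx xk]] : exists k, [/\ (k < n)%N, k%:R / n%:R <= x & x <= k.+1%:R / n%:R].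
  have [xn|xn] := ltP x 1; last first.
    exists n.-1; rewrite !prednK// leqnn divff ?gt_eqF//; split=> //.
    by rewrite ler_pdivrMr// (le_trans _ (ler_wpM2r (ltW nR) xn))// mul1r ler_nat leq_pred.
  exists (Num.truncn (x * n%:R)).
  have xn0 : 0 <= x * n%:R by rewrite mulr_ge0// ltW.
  have /andP[t1 t2] := truncn_itv xn0.
  split; last by rewrite ler_pdivlMr// ltW.
    by rewrite -(ltr_nat R); apply: (le_lt_trans t1); rewrite -[ltRHS]mul1r ltr_pM2r.
  by rewrite ler_pdivrMr.
set a := k%:R / n%:R in kx *; set b := k.+1%:R / n%:R in xk *.
have ba : b - a = n%:R^-1 by rewrite /a /b -mulrBl -natr1 addrAC subrr add0r mul1r.
have ab : a < b by rewrite -subr_gt0 ba invr_gt0.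
have a0 : 0 <= a by rewrite divr_ge0.
have b1 : b <= 1 by rewrite ler_pdivrMr// mul1r ler_nat.
have fi := CAC_cintegrable fg.
have n1i := cintegrable_n1 (measurable_itv _) fi.
have n2i := n1sq_integrable fg.
have ux : n1 (u x) <= \int[leb]_(t in `[a, b]) n1 (f t).
  rewrite (CAC_incr uf a0 kx x1) u0// add0r.
  have fi' : cintegrable `[a, x] f by exact: cintegrable_subitv fi.
  apply: (le_trans (n1_cintegral_le _ fi')) => //.
  apply: Rintegral_sub_le => //; first exact: integrable_subitv n1i.
  by move=> t _; exact: n1_ge0.
have CS := Cauchy_Schwarz_itv ab (integrable_subitv a0 b1 n1i) (integrable_subitv a0 b1 n2i).
apply: (@le_trans _ _ ((\int[leb]_(t in `[a, b]) n1 (f t)) ^+ 2)).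
  by rewrite ler_pXn2r ?nnegrE ?n1_ge0// (le_trans _ ux)// n1_ge0.
apply: (le_trans CS); rewrite ba mulrAC mulrC ler_wpM2r ?invr_ge0 ?(ltW nR)//.
apply: (@le_trans _ _ (\int[leb]_(t in `[0, 1]) (n1 (f t) ^+ 2))).
  by apply: Rintegral_sub_le => // t _; exact: sqr_ge0.
rewrite -RintegralZl//; last exact: abs2_integrable fg.
apply: le_Rintegral => //.
  by apply: rintegrableZ => //; exact: abs2_integrable fg.
by move=> t _; exact: n1_le_abs2.
Qed.

(** Were [u x] nonzero, [abs2 u] would exceed half of its value at [x] on a whole
    interval. *)
Lemma CAC_integral0 (u f : R -> R[i]) x : CAC 0 1 u f ->
  \int[leb]_(t in `[0, 1]) abs2 (u t) <= 0 -> 0 <= x <= 1 -> u x = 0.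
Proof.
move=> uf I0 x01; apply: contrapT => ux.
have phi_gt0 : 0 < abs2 (u x).
  rewrite lt_neqAle abs2_ge0 andbT eq_sym; apply/eqP => a0; apply: ux.
  apply: n1_eq0; apply/eqP; rewrite -sqrf_eq0 eq_le sqr_ge0 andbT.
  by rewrite (le_trans (n1_le_abs2 _))// a0 mulr0.
have [phc _] := CAC_continuous ler01 (CAC_mul uf (CAC_J uf)).
have phiE t : complex.Re (u t * (u t)^*) = abs2 (u t) by rewrite -abs2J.
have [d d0 dP] : exists2 d : R, 0 < d & forall t, 0 <= t <= 1 -> `|t - x| < d ->
    abs2 (u x) / 2 <= abs2 (u t).
  have xI : `[0, 1]%classic x by rewrite /= in_itv.
  have /subspace_continuousP/(_ x xI)/cvgrPdist_le := phc.
  have h2 : 0 < abs2 (u x) / 2 by rewrite divr_gt0.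
  move=> /(_ _ h2)[d d0 dP]; exists d => // t t01 tx.
  have := dP t; rewrite /ball /= distrC => /(_ tx); rewrite in_itv /= => /(_ t01).
  rewrite /from_subspace !phiE => /ler_normlW; lra.
have /andP[x0 x1] := x01.
pose a := Num.max 0 (x - d / 2); pose b := Num.min 1 (x + d / 2).
have ab : a < b by rewrite /a /b gt_max !lt_min; apply/andP; split; apply/andP; split; lra.
have a0 : 0 <= a by rewrite le_max lexx.
have b1 : b <= 1 by rewrite ge_min lexx.
have ai := abs2_integrable uf.
have : \int[leb]_(t in `[a, b]) (abs2 (u x) / 2) <= 0.
  apply: le_trans I0; apply: (@le_trans _ _ (\int[leb]_(t in `[a, b]) abs2 (u t))).
    apply: le_Rintegral => //; first exact: integrable_ab_cst.
      exact: integrable_subitv ai.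
    move=> t /=; rewrite in_itv /= => /andP[at' tb]; apply: dP.
      by rewrite (le_trans a0 at') (le_trans tb b1).
    have ax : x - d / 2 <= t by rewrite (le_trans _ at')// le_max lexx orbT.
    have tx : t <= x + d / 2 by rewrite (le_trans tb)// ge_min lexx orbT.
    by rewrite ltr_norml; apply/andP; split; lra.
  by apply: Rintegral_sub_le => // t _; exact: abs2_ge0.
rewrite Rintegral_ab_cst ?(ltW ab)//; apply/negP; rewrite -ltNge mulr_gt0 ?divr_gt0//.
by rewrite subr_gt0.
Qed.
End Energy.

Section Conjugation.
Context {R : rcfType}.

Lemma conjM (a b : R[i]) : conjc (a * b) = conjc a * conjc b.
Proof. exact: rmorphM. Qed.

Lemma conjD (a b : R[i]) : conjc (a + b) = conjc a + conjc b.
Proof. exact: rmorphD. Qed.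

Lemma real_complexM (a b : R) : (a * b)%:C = a%:C * b%:C.
Proof. exact: rmorphM. Qed.

Lemma conj_sum I (r : seq I) (F : I -> R[i]) : conjc (\sum_(i <- r) F i) = \sum_(i <- r) conjc (F i).
Proof. exact: rmorph_sum. Qed.
End Conjugation.

(** * Eigenvalues below a given level *)

Section InnerProduct.
Context {R : realType} (m : nat).
Implicit Types (u v w : R -> 'cV[R[i]]_m).

Definition dotf u v (x : R) : R[i] := \sum_j u x j 0 * conjc (v x j 0).
Definition ip u v : R[i] := cintegral `[0, 1] (dotf u v).
Definition norm2 u : R := \int[leb]_(x in `[0, 1]) (\sum_j abs2 (u x j 0)).

Definition CACv u v : Prop := forall j, CAC 0 1 (fun x => u x j 0) (fun x => v x j 0).
Definition cintv u : Prop := forall j, cintegrable `[0, 1] (fun x => u x j 0).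

Lemma dotf_integrable u v w : cintv u -> CACv v w -> cintegrable `[0, 1] (dotf u v).
Proof.
move=> ui vw; apply: cintegrable_sum => // j.
exact: (CAC_cintegrableM (CAC_J (vw j)) (ui j)).
Qed.

Lemma CACv_int u v : CACv u v -> cintv u.
Proof. by move=> uv j; exact: CAC_cintegrable (uv j). Qed.

Lemma CACv_intD u v : CACv u v -> cintv v.
Proof. by move=> uv j; case: (uv j). Qed.

Lemma dotfJ u v x : conjc (dotf u v x) = dotf v u x.
Proof.
rewrite /dotf conj_sum; apply: eq_bigr => j _.
by rewrite conjM conjcK mulrC.
Qed.

Lemma ipJ u v : cintegrable `[0, 1] (dotf u v) -> conjc (ip u v) = ip v u.
Proof.
by move=> ui; rewrite /ip -cintegralJ//; apply: eq_cintegral => x _; exact: dotfJ.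
Qed.

Lemma norm2_sum u v : CACv u v ->
  leb.-integrable `[0, 1] (EFin \o (fun x => \sum_j abs2 (u x j 0))) /\
  norm2 u = \sum_j \int[leb]_(x in `[0, 1]) abs2 (u x j 0).
Proof.
move=> uv; apply: (@Rintegral_sum R _ _ (index_enum _) (fun j x => abs2 (u x j 0))) => // j.
exact: abs2_integrable (uv j).
Qed.

Lemma ip_norm2 u v : CACv u v -> ip u u = (norm2 u)%:C.
Proof.
move=> uv; apply: complex_eq => /=.
  apply: eq_Rintegral => x _; rewrite /dotf Re_sum; apply: eq_bigr => j _.
  by rewrite -abs2J.
rewrite (@eq_Rintegral _ _ _ _ _ (fun=> 0)) ?Rintegral0// => x _.
by rewrite /dotf Im_sum big1// => j _; rewrite -abs2J.
Qed.

Lemma norm2_ge0 u : 0 <= norm2 u.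
Proof. by apply: Rintegral_ge0 => x _; rewrite sumr_ge0// => j _; exact: abs2_ge0. Qed.

Lemma norm2_eq0 u v (x : R) : CACv u v -> norm2 u = 0 -> 0 <= x <= 1 -> u x = 0.
Proof.
move=> uv u0 x01; apply/colP => j; rewrite [RHS]mxE.
apply: (CAC_integral0 (uv j)) => //.
have [_ E] := norm2_sum uv; rewrite -[leRHS]u0 E (bigD1 j)//=.
rewrite lerDl sumr_ge0// => k _.
by apply: Rintegral_ge0 => t _; exact: abs2_ge0.
Qed.

Lemma ip_comb N (c : 'I_N -> R[i]) (u v : 'I_N -> R -> 'cV[R[i]]_m) :
  (forall i k, cintegrable `[0, 1] (dotf (u i) (v k))) ->
  ip (fun x => \sum_i c i *: u i x) (fun x => \sum_i c i *: v i x) =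
  \sum_i \sum_k c i * conjc (c k) * ip (u i) (v k).
Proof.
move=> uvi.
have Zi i k := cintegrableZ (c i * conjc (c k)) (measurable_itv _) (uvi i k).
under [RHS]eq_bigr do under eq_bigr do rewrite -cintegralZ//.
under [RHS]eq_bigr do rewrite -cintegral_sum//.
rewrite -cintegral_sum//; last by move=> i; exact: cintegrable_sum.
apply: eq_cintegral => x _; rewrite /dotf.
transitivity (\sum_j \sum_i \sum_k c i * conjc (c k) * (u i x j 0 * conjc (v k x j 0))).
  apply: eq_bigr => j _.
  have uE : (\sum_i c i *: u i x) j 0 = \sum_i c i * u i x j 0.
    by rewrite summxE; apply: eq_bigr => i _; rewrite mxE.
  have vE : conjc ((\sum_k c k *: v k x) j 0) = \sum_k conjc (c k) * conjc (v k x j 0).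
    by rewrite summxE conj_sum; apply: eq_bigr => k _; rewrite mxE conjM.
  rewrite uE vE mulr_suml; apply: eq_bigr => i _; rewrite mulr_sumr.
  by apply: eq_bigr => k _; rewrite mulrACA.
rewrite exchange_big; apply: eq_bigr => i _.
rewrite exchange_big; apply: eq_bigr => k _.
by rewrite mulr_sumr.
Qed.

(** Integration by parts; the boundary terms cancel by periodicity. *)
Lemma Green u du h w dw : CACv u du -> CACv du h -> CACv w dw ->
  du 1 = du 0 -> w 1 = w 0 -> ip h w + ip du dw = 0.
Proof.
move=> udu duh wdw du1 w1.
have H j := CAC_mul (duh j) (CAC_J (wdw j)).
have S := CAC_sum (index_enum 'I_m) H.
have i1 : cintegrable `[0, 1] (dotf h w) by exact: dotf_integrable (CACv_intD duh) wdw.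
have i2 : cintegrable `[0, 1] (dotf du dw).
  apply: cintegrable_sum => // j.
  have := CAC_cintegrableM (duh j) (cintegrableJ (measurable_itv _) (CACv_intD wdw j)).
  by apply: eq_cintegrable => // x _; exact: mulrC.
rewrite /ip -cintegralD//.
have := CAC_incr S (lexx 0) ler01 (lexx 1); rewrite du1 w1 => E.
have := congr1 (fun z => z - \sum_j du 0 j 0 * conjc (w 0 j 0)) E.
rewrite subrr addrAC subrr add0r => {}E; rewrite [RHS]E.
by apply: eq_cintegral => x _; rewrite /dotf -big_split.
Qed.
End InnerProduct.

Section Discreteness.
Context {R : realType} (m : nat) (Q : R -> 'M[R[i]]_m).
Hypothesis hQ : periodic_potential Q.

Definition eigenpair (l : R) (y dy : R -> 'cV[R[i]]_m) : Prop :=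
  [/\ solves Q l 0 1 y dy, y 1 = y 0 & dy 1 = dy 0].

Let Qv (y : R -> 'cV[R[i]]_m) x := Q x *m y x.

Lemma Qv_int (y dy : R -> 'cV[R[i]]_m) : CACv y dy -> cintv (Qv y).
Proof.
move=> yC j.
have := cintegrable_sum (index_enum _) (measurable_itv _)
  (fun k => CAC_cintegrableM (yC k) (Q_integrable hQ 0 1 j k)).
by apply: eq_cintegrable => // x _; rewrite /Qv mxE.
Qed.

Lemma Qv_herm (y w : R -> 'cV[R[i]]_m) x : dotf (Qv y) w x = dotf y (Qv w) x.
Proof.
rewrite /dotf /Qv.
under eq_bigr do rewrite mxE mulr_suml.
rewrite exchange_big; apply: eq_bigr => k _ /=.
rewrite mxE conj_sum mulr_sumr; apply: eq_bigr => j _.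
by rewrite (Q_herm hQ) conjM mulrAC mulrC mulrA.
Qed.

(** The quadratic form of the periodic problem, evaluated at an eigenfunction. *)
Lemma eigenpair_form l y dy w dw : eigenpair l y dy -> CACv w dw -> w 1 = w 0 ->
  ip dy dw + ip (Qv y) w = l%:C * ip y w.
Proof.
move=> [[yC dyC] y1 dy1] wC w1.
have := Green yC dyC wC dy1 w1.
have i1 := dotf_integrable (Qv_int yC) wC.
have i2 := dotf_integrable (CACv_int yC) wC.
have -> : ip (fun x => Q x *m y x - l%:C *: y x) w = ip (Qv y) w - l%:C * ip y w.
  rewrite /ip -mulNr -cintegralZ// -cintegralD//; last exact: cintegrableZ.
  apply: eq_cintegral => x _; rewrite /dotf mulr_sumr -big_split /=.
  by apply: eq_bigr => j _; rewrite -/(Qv y x); move: (Qv y x) => q; rewrite !mxE; ring.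
move=> E; apply/eqP; rewrite -subr_eq0 -E; apply/eqP; ring.
Qed.

Lemma eigenpair_orthogonal l l' y dy w dw : eigenpair l y dy -> eigenpair l' w dw ->
  l != l' -> ip y w = 0.
Proof.
move=> ey ew ll'.
have [[yC dyC] y1 dy1] := ey; have [[wC dwC] w1 dw1] := ew.
have E1 := eigenpair_form ey wC w1.
have E2 := eigenpair_form ew yC y1.
have dd : cintegrable `[0, 1] (dotf dw dy) by exact: dotf_integrable (CACv_int dwC) dyC.
have wy : cintegrable `[0, 1] (dotf w y) by exact: dotf_integrable (CACv_int wC) yC.
have Qwy : cintegrable `[0, 1] (dotf (Qv w) y) by exact: dotf_integrable (Qv_int wC) yC.
have := congr1 (fun z : R[i] => conjc z) E2.
rewrite conjD conjM conjc_real !ipJ//.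
have -> : ip y (Qv w) = ip (Qv y) w by apply: eq_cintegral => x _; rewrite Qv_herm.
rewrite E1 => /eqP; rewrite -subr_eq0 -mulrBl mulf_eq0 => /orP[|/eqP//].
by rewrite -rmorphB fmorph_eq0 subr_eq0 (negPf ll').
Qed.

(** With more than [n m] eigenfunctions there is a nontrivial combination [F]
    whose [m] components vanish at the [n] points [k / n].  Its energy
    [A = \int |F'| ^ 2] is then at most a constant times [A / n], the constant
    coming from [H] and the potential; for large [n] this leaves [A = 0], hence
    [F = 0], against the orthogonality of the eigenfunctions. *)
Lemma few_eigenvalues_below (H : R) : exists N : nat,
  forall (l : 'I_N -> R) (y dy : 'I_N -> R -> 'cV[R[i]]_m),
    injective l -> (forall i, l i <= H) -> (forall i, eigenpair (l i) (y i) (dy i)) ->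
    exists i, forall x, 0 <= x <= 1 -> y i x = 0.
Proof.
pose q0 := \int[leb]_(x in `[0, 1]) Qsum Q x.
have q00 : 0 <= q0.
  by apply: Rintegral_ge0 => x _; rewrite sumr_ge0// => i _; rewrite sumr_ge0// => j _; exact: n1_ge0.
pose K := 2 * (`|H| * m%:R + q0).
pose n := (Num.truncn K).+1.
have nK : K < n%:R by exact: truncnS_gt.
have K0 : 0 <= K by rewrite mulr_ge0// addr_ge0// mulr_ge0.
exists (n * m).+1 => l y dy linj lH ey.
apply: contrapT => nz.
have ynz i : norm2 (y i) != 0.
  apply/eqP => y0; apply: nz; exists i => x.
  have [[yC _] _ _] := ey i; exact: norm2_eq0 yC y0.
pose M : 'M[R[i]]_((n * m).+1, n * m) :=
  \matrix_i mxvec (\matrix_(k < n, j < m) y i (k%:R / n%:R) j 0).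
have [c c0 cM] : exists2 c : 'rV[R[i]]_(n * m).+1, c != 0 & c *m M = 0.
  have : kermx M != 0.
    rewrite kermx_eq0 /row_free; apply/eqP => rM.
    by have := rank_leq_col M; rewrite rM ltnn.
  by move=> /rowV0Pn[c /sub_kermxP cM c0]; exists c.
pose F x := \sum_i c 0 i *: y i x.
pose dF x := \sum_i c 0 i *: dy i x.
pose ddF x := \sum_i c 0 i *: (Q x *m y i x - (l i)%:C *: y i x).
have comb (u v : 'I_(n * m).+1 -> R -> 'cV[R[i]]_m) : (forall i, CACv (u i) (v i)) ->
    CACv (fun x => \sum_i c 0 i *: u i x) (fun x => \sum_i c 0 i *: v i x).
  move=> uv j.
  have := CAC_sum (index_enum _) (fun i => CAC_Z (c 0 i) (uv i j)).
  move=> /CAC_eq; apply => x _; rewrite summxE; apply: eq_bigr => i _.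
    by rewrite [RHS]mxE.
  by rewrite [RHS]mxE.
have FC : CACv F dF by apply: comb => i; have [[]] := ey i.
have dFC : CACv dF ddF by apply: comb => i; have [[]] := ey i.
have Fgrid k j : (k < n)%N -> F (k%:R / n%:R) j 0 = 0.
  move=> kn; have := congr1 (fun A : 'rV[R[i]]_(n * m) => A 0 (mxvec_index (Ordinal kn) j)) cM.
  rewrite /= [in RHS]mxE mxE => <-; rewrite /F summxE; apply: eq_bigr => i _.
  by rewrite !mxE mxvecE mxE.
pose A := norm2 dF.
have A0 : 0 <= A by exact: norm2_ge0.
have nR : 0 < n%:R :> R by rewrite ltr0n.
pose e := 2 / n%:R * A.
have e0 : 0 <= e by rewrite mulr_ge0// divr_ge0// ltW.
have Fsmall x j : 0 <= x <= 1 -> n1 (F x j 0) ^+ 2 <= e.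
  move=> x01; apply: (le_trans (Poincare_grid (ltn0Sn _) (FC j) (dFC j) (fun k kn => Fgrid k j kn) x01)).
  rewrite ler_wpM2l ?divr_ge0//.
  have [_ nE] := norm2_sum dFC; rewrite /A nE (bigD1 j)//= lerDl sumr_ge0// => k _.
  by apply: Rintegral_ge0 => t _; exact: abs2_ge0.
have NF : norm2 F <= m%:R * e.
  have [_ ->] := norm2_sum FC.
  apply: (@le_trans _ _ (\sum_(j < m) e)); last by rewrite sumr_const card_ord mulr_natl.
  apply: ler_sum => j _.
  apply: (@le_trans _ _ (\int[leb]_(x in `[0, 1]) e)).
    apply: le_Rintegral => //; [exact: abs2_integrable (FC j)|exact: integrable_ab_cst|].
    move=> x /=; rewrite in_itv /= => x01.
    by apply: (le_trans (abs2_le_n1 _)); exact: Fsmall.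
  by rewrite Rintegral_ab_cst// subr0 mulr1.
have QF : n1 (ip (Qv F) F) <= q0 * e.
  have i1 := dotf_integrable (Qv_int FC) FC.
  apply: (le_trans (n1_cintegral_le _ i1)) => //.
  apply: (@le_trans _ _ (\int[leb]_(x in `[0, 1]) (e * Qsum Q x))); last first.
    by rewrite RintegralZl// ?[q0 * e]mulrC//; exact: Qsum_integrable hQ.
  apply: le_Rintegral => //; first exact: cintegrable_n1.
    by apply: rintegrableZ => //; exact: Qsum_integrable hQ.
  move=> x /=; rewrite in_itv /= => x01.
  apply: (le_trans (n1_sum _ _ _)); rewrite /Qsum mulr_sumr; apply: ler_sum => s _.
  apply: (le_trans (n1M _ _)); rewrite n1J /Qv mxE.
  apply: (@le_trans _ _ ((\sum_j n1 (Q x s j * F x j 0)) * n1 (F x s 0))).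
    by rewrite ler_wpM2r ?n1_ge0// n1_sum.
  rewrite mulr_suml mulr_sumr; apply: ler_sum => j _.
  apply: (@le_trans _ _ (n1 (Q x s j) * (n1 (F x j 0) * n1 (F x s 0)))).
    by rewrite mulrA ler_wpM2r ?n1_ge0// n1M.
  rewrite mulrC ler_wpM2r ?n1_ge0//.
  have := Fsmall x j x01; have := Fsmall x s x01.
  have := sqr_ge0 (n1 (F x j 0) - n1 (F x s 0)); lra.
have yyi i k : cintegrable `[0, 1] (dotf (y i) (y k)).
  have [[yiC _] _ _] := ey i; have [[ykC _] _ _] := ey k.
  exact: dotf_integrable (CACv_int yiC) ykC.
have orth i k : ip (y i) (y k) = (i == k)%:R * (norm2 (y i))%:C.
  have [<-|ik] := eqVneq i k.
    by have [[yiC _] _ _] := ey i; rewrite mul1r (ip_norm2 yiC).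
  rewrite mul0r (eigenpair_orthogonal (ey i) (ey k))//.
  by apply: contra_neq ik => /linj.
have FF : norm2 F = \sum_i abs2 (c 0 i) * norm2 (y i).
  apply: complexI; rewrite -(ip_norm2 FC) (ip_comb _ yyi).
  rewrite [RHS]rmorph_sum; apply: eq_bigr => i _ /=.
  rewrite (bigD1 i)//= big1 ?addr0 => [|k ki].
    by rewrite orth eqxx mul1r real_complexM abs2J.
  by rewrite orth eq_sym (negPf ki) mul0r mulr0.
have energy : A%:C + ip (Qv F) F = (\sum_i l i * (abs2 (c 0 i) * norm2 (y i)))%:C.
  have dyi i k : cintegrable `[0, 1] (dotf (dy i) (dy k)).
    have [[_ yiC] _ _] := ey i; have [[_ ykC] _ _] := ey k.
    exact: dotf_integrable (CACv_int yiC) ykC.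
  have Qyi i k : cintegrable `[0, 1] (dotf (Qv (y i)) (y k)).
    have [[yiC _] _ _] := ey i; have [[ykC _] _ _] := ey k.
    exact: dotf_integrable (Qv_int yiC) ykC.
  rewrite /A -(ip_norm2 dFC) (ip_comb _ dyi).
  have -> : ip (Qv F) F = \sum_i \sum_k c 0 i * conjc (c 0 k) * ip (Qv (y i)) (y k).
    rewrite -(ip_comb _ Qyi); apply: eq_cintegral => x _; rewrite /dotf.
    apply: eq_bigr => j _; congr (_ j 0 * _); rewrite /Qv /F mulmx_sumr.
    by under eq_bigr do rewrite -scalemxAr.
  rewrite -big_split [RHS]rmorph_sum; apply: eq_bigr => i _ /=.
  rewrite -big_split (bigD1 i)//= big1 ?addr0 => [|k ki].
    have [[yiC _] yi1 _] := ey i.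
    rewrite -mulrDr (eigenpair_form (ey i) yiC yi1) orth eqxx mul1r.
    by rewrite !real_complexM abs2J mulrCA mulrA.
  have [[ykC _] yk1 _] := ey k.
  by rewrite -mulrDr (eigenpair_form (ey i) ykC yk1) orth eq_sym (negPf ki) mul0r !mulr0.
have A_le : A <= e * (`|H| * m%:R + q0).
  have /(congr1 (fun z => complex.Re z)) := energy; rewrite ReD /= => AE.
  have s1 : \sum_i l i * (abs2 (c 0 i) * norm2 (y i)) <= `|H| * norm2 F.
    rewrite FF mulr_sumr; apply: ler_sum => i _.
    rewrite ler_wpM2r ?mulr_ge0 ?abs2_ge0 ?norm2_ge0//.
    by rewrite (le_trans (lH i))// ler_norm.
  have s2 : `|H| * norm2 F <= `|H| * (m%:R * e) by rewrite ler_wpM2l.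
  have s3 : - complex.Re (ip (Qv F) F) <= q0 * e.
    by rewrite (le_trans _ QF)// (le_trans _ (n1_Re _))// -normrN ler_norm.
  rewrite (_ : A = A + complex.Re (ip (Qv F) F) - complex.Re (ip (Qv F) F)); last by rewrite addrK.
  rewrite AE; have -> : e * (`|H| * m%:R + q0) = `|H| * (m%:R * e) + q0 * e by ring.
  by apply: lerD => //; apply: le_trans s1 _.
have A_eq0 : A = 0.
  apply/eqP; rewrite eq_le A0 andbT leNgt; apply/negP => Apos.
  have : A * n%:R <= A * K.
    rewrite -ler_pdivlMr//; apply: (le_trans A_le); rewrite /e /K le_eqVlt; apply/orP; left.
    by apply/eqP; ring.
  by rewrite ler_pM2l// leNgt nK.
have F0 : norm2 F = 0.
  by apply/eqP; rewrite eq_le norm2_ge0 andbT (le_trans NF)// /e A_eq0 !mulr0.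
move/eqP: c0; apply; apply/rowP => i; rewrite [RHS]mxE.
move/eqP: F0; rewrite FF psumr_eq0 => [/allP /(_ i)|k _]; last first.
  by rewrite mulr_ge0 ?abs2_ge0 ?norm2_ge0.
rewrite mem_index_enum mulf_eq0 (negPf (ynz i)) orbF => /(_ isT) /eqP c0.
by apply/eqP; have := abs2J (c 0 i); rewrite c0 => /esym/eqP; rewrite mulf_eq0 conjc_eq0 orbb.
Qed.
End Discreteness.

(** * Finiteness of the number of gaps *)

Section FinitelyManyGaps.
Context {R : realType} (m : nat) (Q : R -> 'M[R[i]]_m).
Hypothesis hQ : periodic_potential Q.

Lemma listed_eigenpair (lam : nat -> R) n : eigenvalue_listing Q 0 lam ->
  exists2 y, exists dy, eigenpair Q (lam n) y dy & ~ forall x, 0 <= x <= 1 -> y x = 0.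
Proof.
move=> [_ /(_ (lam n))[[|k] [[e [eE efree _]] card]]].
  have : [set j | lam j = lam n] = set0.
    by apply/eqP; move: card; rewrite II0 card_eq0.
  by move=> /seteqP[/(_ n)]; case.
exists (e ord0); last first.
  move=> e0; have c0 : forall i : 'I_k.+1, (i == ord0)%:R = 0 :> R[i].
    apply: efree => x x01; rewrite (bigD1 ord0)//= e0// scaler0 add0r.
    by rewrite big1// => i /negPf->; rewrite scale0r.
  by have /eqP := c0 ord0; rewrite eqxx oner_eq0.
have [dy [sol y1 dy1]] := eigenfunction_solves hQ (eE ord0).
by exists dy; split=> //; rewrite ?y1 ?dy1 expi0 scale1r.
Qed.

(** Each value is listed finitely often, so a listing bounded above would contain
    infinitely many distinct eigenvalues below its bound. *)
Lemma eigenvalues_unbounded (lam : nat -> R) : eigenvalue_listing Q 0 lam ->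
  forall H : R, exists n, H < lam n.
Proof.
move=> hl H; apply: contrapT => lamH.
have {}lamH n : lam n <= H by rewrite leNgt; apply/negP => Hn; apply: lamH; exists n.
have [lam_le lamP] := hl.
have lam_mono i j : (i <= j)%N -> lam i <= lam j.
  by have /nondecreasing_seqP mono := lam_le; exact: mono.
have next n : exists n', lam n < lam n'.
  apply: contrapT => nlt.
  have [k [_ card]] := lamP (lam n).
  apply: infinite_nat.
  apply: (@sub_finite_set _ _ (`I_n `|` [set j | lam j = lam n])).
    move=> j _; have [jn|nj] := ltnP j n; [by left|right].
    apply/eqP; rewrite eq_le [lam n <= _]lam_mono// andbT leNgt; apply/negP => lt.
    by apply: nlt; exists j.
  by rewrite finite_setU; split; [exact: finite_II|exists k].
have [g gP] := choice next.
pose l i := lam (iter i g 0%N).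
have linc : {homo l : i j / (i < j)%N >-> i < j}.
  by apply: (homo_ltn (@lt_trans _ R)) => i; exact: gP.
have linj : injective l.
  by move=> i j; have [/linc|/linc|//] := ltngtP i j => + E; rewrite E ltxx.
have [N few] := few_eigenvalues_below hQ H.
have ex (i : 'I_N) : exists yd : (R -> 'cV[R[i]]_m) * (R -> 'cV[R[i]]_m),
    eigenpair Q (l i) yd.1 yd.2 /\ ~ forall x, 0 <= x <= 1 -> yd.1 x = 0.
  have [y [dy ep] nz] := listed_eigenpair (iter i g 0%N) hl.
  by exists (y, dy).
have [yd ydP] := choice ex.
have [|||i yi0] := few (fun i => l i) (fun i => (yd i).1) (fun i => (yd i).2).
- by move=> i j /linj/val_inj.
- by move=> i; exact: lamH.
- by move=> i; exact: (ydP i).1.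
- exact: (ydP i).2 yi0.
Qed.

(** A nonempty gap following the [n]-th band contains a point at most [H], so that
    [lam 0 n] lies below [H]; this happens for finitely many [n] only. *)
Lemma finitely_many_gaps (H : R) (lam : R -> nat -> R) :
  (forall l, H < l -> exists t, exists2 y, - pi < t <= pi & exists dy,
     [/\ solves Q l 0 1 y dy, y 1 = expi t *: y 0, dy 1 = expi t *: dy 0 &
         (y 0 != 0) || (dy 0 != 0)]) ->
  (forall t : R, - pi < t <= pi -> eigenvalue_listing Q t (lam t)) ->
  finite_set (gaps lam).
Proof.
move=> bloch lamP.
have pi0 : - pi < (0 : R) <= pi by rewrite oppr_lt0 pi_gt0 pi_ge0.
have [n0 Hn0] := eigenvalues_unbounded (lamP 0 pi0) H.
apply: (@sub_finite_set _ _ [set gap lam n | n in `I_n0]); last first.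
  by apply: finite_image; exact: finite_II.
move=> G [[x Gx] [n Gn]]; exists n => //=; rewrite ltnNge; apply/negP => n0n.
move: Gx; rewrite Gn => Gx.
have [below _] := Gx.
have lx : lam 0 n < x by apply: below; exists 0 => //=; rewrite in_itv.
have Hx : H < x.
  apply: (lt_trans _ lx); apply: (lt_le_trans Hn0).
  by have [/nondecreasing_seqP mono _] := lamP 0 pi0; exact: mono.
have [t [y tpi [dy [sol y1 dy1 nz]]]] := bloch x Hx.
exact: (not_in_gap (lamP t tpi) tpi sol y1 dy1 nz Gx).
Qed.
End FinitelyManyGaps.

(** * Bloch solutions on the half line and their truncation *)

Section BlochExtension.
Context {R : realType} (m : nat) (Q : R -> 'M[R[i]]_m).
Hypothesis hQ : periodic_potential Q.

(** The quasiperiodic continuation of [u] from [[0, 1]] to the half line. *)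
Definition bloch_ext (t : R) (u : R -> 'cV[R[i]]_m) (x : R) : 'cV[R[i]]_m :=
  let k : R := (Num.truncn x)%:R in expi (t * k) *: u (x - k).

(** The boundary condition makes the formula of the [k]-th period valid at its
    right end point as well, which allows pieces to be glued. *)
Lemma bloch_extE (t : R) (u : R -> 'cV[R[i]]_m) (k : nat) (x : R) :
  u 1 = expi t *: u 0 -> k%:R <= x <= k%:R + 1 ->
  bloch_ext t u x = expi (t * k%:R) *: u (x - k%:R).
Proof.
move=> u1 /andP[kx xk].
have x0 : 0 <= x by exact: le_trans kx.
have [xk'|kx'] := ltP x (k%:R + 1).
  have -> // : bloch_ext t u x = expi (t * k%:R) *: u (x - k%:R).
  rewrite /bloch_ext; suff -> : Num.truncn x = k by [].
  by apply: truncn_def; rewrite kx -natr1.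
have {kx' xk} -> : x = k.+1%:R by rewrite -natr1; apply/eqP; rewrite eq_le xk.
rewrite /bloch_ext natrK subrr -natr1 addrAC subrr add0r u1 scalerA -expiD.
by congr (expi _ *: _); ring.
Qed.

Lemma bloch_ext_CAC (t : R) (u v : R -> 'cV[R[i]]_m) (k : nat) j :
  u 1 = expi t *: u 0 -> CAC 0 1 (fun x => u x j 0) (fun x => v x j 0) ->
  CAC k%:R (k%:R + 1) (fun x => bloch_ext t u x j 0)
    (fun x => expi (t * k%:R) * v (x - k%:R) j 0).
Proof.
move=> u1 /(CAC_shift k%:R)/(CAC_Z (expi (t * k%:R))).
rewrite add0r [1 + _]addrC => /CAC_eq; apply => // x xk.
by rewrite (bloch_extE u1 xk) mxE.
Qed.

Lemma potential_shift k x : Q (x - k%:R) = Q x.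
Proof.
have [_ _ per] := hQ; elim: k x => [|k IH] x; first by rewrite subr0.
by rewrite -natr1 opprD addrA -(IH x) -[in RHS](subrK 1 (x - k%:R)) per.
Qed.

Lemma bloch_ext_solves (l t : R) (y dy : R -> 'cV[R[i]]_m) (N : nat) :
  solves Q l 0 1 y dy -> y 1 = expi t *: y 0 -> dy 1 = expi t *: dy 0 ->
  solves Q l 0 N%:R (bloch_ext t y) (bloch_ext t dy).
Proof.
move=> [yC dyC] y1 dy1.
have step k : solves Q l k%:R (k%:R + 1) (bloch_ext t y) (bloch_ext t dy).
  split=> j.
    have := bloch_ext_CAC k y1 (yC j).
    move/CAC_eq; apply => // x xk; by rewrite (bloch_extE dy1 xk) mxE.
  have := bloch_ext_CAC k dy1 (dyC j).
  move/CAC_eq; apply => // x xk; rewrite (bloch_extE y1 xk) potential_shift.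
  set z := y (x - k%:R); rewrite -scalemxAr; set q := Q x *m z.
  by clearbody q z; rewrite !mxE; ring.
elim: N => [|N [IH1 IH2]].
  have [s1 s2] := step 0%N; rewrite add0r in s1 s2.
  by split=> j; [apply: CAC_sub (s1 j) _ _|apply: CAC_sub (s2 j) _ _].
have [s1 s2] := step N; rewrite -natr1.
have N01 : 0 <= (N%:R : R) <= N%:R + 1.
  by apply/andP; split; [exact: ler0n|rewrite lerDl ler01].
by split=> j; apply: (CAC_glue N01).
Qed.

Lemma bloch_ext_bounded (t : R) (u v : R -> 'cV[R[i]]_m) :
  u 1 = expi t *: u 0 ->
  (forall j, CAC 0 1 (fun x => u x j 0) (fun x => v x j 0)) ->
  exists2 B : R, 0 <= B & forall x j, 0 <= x -> n1 (bloch_ext t u x j 0) <= B.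
Proof.
move=> u1 uC.
have [B BP] := choice (fun j => CAC_bounded (uC j)).
have B0 j : 0 <= B j by apply: (le_trans (n1_ge0 _) (BP j 0 _)); rewrite lexx ler01.
exists (\sum_j 2 * B j) => [|x j x0]; first by rewrite sumr_ge0// => j _; rewrite mulr_ge0.
apply: (@le_trans _ _ (2 * B j)); last first.
  by rewrite (bigD1 j)//= lerDl sumr_ge0// => i _; rewrite mulr_ge0.
have /andP[k1 k2] := truncn_itv x0.
rewrite /bloch_ext mxE; apply: (le_trans (n1M _ _)).
apply: ler_pM; rewrite ?n1_ge0 ?n1_expi//; apply: BP.
by rewrite subr_ge0 k1 lerBlDl ltW// natr1.
Qed.
End BlochExtension.

Section Cutoff.
Context {R : realType}.
Implicit Types (w a b x : R).

Definition cut (V : nmodType) w (u : R -> V) x : V := if 0 <= x <= w then u x else 0.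

Lemma CAC_cut w a b (u f : R -> R[i]) : 0 <= w -> CAC 0 w u f ->
  u 0 = 0 -> u w = 0 -> f 0 = 0 -> f w = 0 -> CAC a b (cut w u) (cut w f).
Proof.
move=> w0 uf u0 uw f0 fw.
have cut0 (h : R -> R[i]) x : h 0 = 0 -> h w = 0 -> (x <= 0) || (w <= x) -> 0 = cut w h x.
  rewrite /cut => h0 hw; case: ifPn => // /andP[x0 xw] /orP[x0'|wx].
    by rewrite (_ : x = 0)//; apply/eqP; rewrite eq_le x0'.
  by rewrite (_ : x = w)//; apply/eqP; rewrite eq_le xw.
pose A := Num.min a 0; pose B := Num.max b w.
have A0 : A <= 0 by rewrite ge_min lexx orbT.
have wB : w <= B by rewrite le_max lexx orbT.
apply: (@CAC_sub _ A B); rewrite ?ge_min ?le_max ?lexx//.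
apply: (@CAC_glue _ A B 0); first by rewrite A0 (le_trans w0).
  by apply: (CAC_eq (CAC_cst A 0 0)) => x /andP[_ x0]; apply: cut0; rewrite ?x0.
apply: (@CAC_glue _ 0 B w); first by rewrite w0.
  by apply: (CAC_eq uf) => x x0w; rewrite /cut x0w.
by apply: (CAC_eq (CAC_cst w B 0)) => x /andP[wx _]; apply: cut0; rewrite ?wx ?orbT.
Qed.

Lemma cut_patch w (f : R -> R) : cut w f = (f \_ `[0, w])%R.
Proof. by apply/funext => x; rewrite /cut patchE mem_setE in_itv. Qed.

Lemma integral_cut w (F : R -> R) :
  (\int[leb]_x (cut w F x)%:E = \int[leb]_(x in `[(0 : R)%R, w]) (F x)%:E)%E.
Proof.
rewrite [RHS]integral_mkcond; apply: eq_integral => x _.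
by rewrite /cut patchE mem_setE in_itv /=; case: ifP.
Qed.

Lemma measurable_cut w (f : R -> R[i]) : cmeasurable_fun `[0, w] f ->
  cmeasurable_fun setT (cut w f).
Proof.
have E (h : R -> R) : measurable_fun (`[0, w] : set (measurableTypeR R)) h ->
    measurable_fun (setT : set (measurableTypeR R)) (cut w h).
  by rewrite cut_patch => /measurable_restrictT; apply; exact: measurable_itv.
move=> [fr fi]; split.
  by have := E _ fr; congr (measurable_fun _ _); apply/funext => x; rewrite /cut; case: ifP.
by have := E _ fi; congr (measurable_fun _ _); apply/funext => x; rewrite /cut; case: ifP.
Qed.

Lemma measurable_abs2 (A : set (measurableTypeR R)) (f : R -> R[i]) : cmeasurable_fun A f ->
  measurable_fun A (fun x => abs2 (f x)).
Proof. by move=> [fr fi]; apply: measurable_funD; exact: measurable_funX. Qed.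

Lemma L2norm2_cut (m : nat) w (u : R -> 'cV[R[i]]_m) :
  L2norm2 setT (cut w u) = (\int[leb]_(x in `[(0 : R)%R, w]) (\sum_j abs2 (u x j 0))%:E)%E.
Proof.
rewrite -integral_cut /L2norm2; apply: eq_integral => x _; congr EFin.
rewrite /cut; case: ifP => // _; rewrite big1// => j _.
by rewrite mxE /abs2 /= expr0n addr0.
Qed.

Lemma L2_cut (m : nat) w (u : R -> 'cV[R[i]]_m) (M : R) : 0 <= w ->
  (forall j, cmeasurable_fun `[0, w] (fun x => u x j 0)) ->
  (forall x j, 0 <= x <= w -> n1 (u x j 0) <= M) ->
  in_L2 setT (cut w u) /\ (L2norm2 setT (cut w u) <= (m%:R * (M ^+ 2 * w))%:E)%E.
Proof.
move=> w0 um uM.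
have bound (F : R -> R) (c : R) : measurable_fun (`[0, w] : set (measurableTypeR R)) F ->
    (forall x, 0 <= x <= w -> 0 <= F x <= c) ->
    (\int[leb]_(x in `[(0 : R)%R, w]) (F x)%:E <= (c * w)%:E)%E.
  move=> mF Fc.
  apply: (@le_trans _ _ (\int[leb]_(x in `[(0 : R)%R, w]) c%:E)%E); last first.
    rewrite integral_cst//= lebesgue_measure_itv/= lte_fin.
    case: ltP => [_|w0']; first by rewrite oppr0 adde0 -EFinM.
    have -> : w = 0 by apply/eqP; rewrite eq_le w0' w0.
    by rewrite mulr0 mule0.
  apply: ge0_le_integral => //.
  - by move=> x /=; rewrite in_itv /= lee_fin => /Fc/andP[].
  - exact/measurable_EFinP.
  - by move=> x /=; rewrite in_itv /= lee_fin => /Fc/andP[].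
have abs2M x j : 0 <= x <= w -> 0 <= abs2 (u x j 0) <= M ^+ 2.
  move=> x0w; rewrite abs2_ge0 (le_trans (abs2_le_n1 _))//.
  have := n1_ge0 (u x j 0); have := uM x j x0w; nra.
split.
  move=> j; have cutj : (fun x => cut w u x j 0) = cut w (fun x => u x j 0).
    by apply/funext => x; rewrite /cut; case: ifP => // _; rewrite mxE.
  rewrite cutj; split; first exact: measurable_cut.
  rewrite (_ : (\int[_]_(x in _) _)%E = (\int[leb]_(x in `[(0 : R)%R, w]) (abs2 (u x j 0))%:E)%E).
    by apply: (le_lt_trans (bound _ (M ^+ 2) _ _)); [exact: measurable_abs2|move=> x; exact: abs2M|exact: ltry].
  rewrite -integral_cut; apply: eq_integral => x _; congr EFin.
  by rewrite /cut; case: ifP => // _; rewrite /abs2 /= expr0n addr0.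
rewrite L2norm2_cut mulrA; apply: bound => [|x x0w].
  by apply: measurable_sum => j; exact: measurable_abs2.
rewrite sumr_ge0 => [/=|j _]; last by have /andP[] := abs2M x j x0w.
rewrite mulr_natl -[X in _ *+ X]card_ord -sumr_const; apply: ler_sum => j _.
by have /andP[] := abs2M x j x0w.
Qed.
End Cutoff.

(** * Bloch energies belong to the spectrum *)

Section WeylSequence.
Context {R : realType}.
Implicit Types (w a b x : R).

(** A cutoff on [[0, w]] that vanishes together with its first two derivatives at
    both ends, followed by these derivatives. *)
Definition bump w x : R[i] := let s : R[i] := (x / w)%:C in (s * (1 - s)) ^+ 3.
Definition dbump w x : R[i] :=
  let s : R[i] := (x / w)%:C in 3 * (w^-1)%:C * ((s * (1 - s)) ^+ 2 * (1 - 2 * s)).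
Definition ddbump w x : R[i] :=
  let s : R[i] := (x / w)%:C in
  6 * (w^-1)%:C ^+ 2 * (s * (1 - s) * ((1 - 2 * s) ^+ 2 - s * (1 - s))).

Lemma CAC_linear a b w : CAC a b (fun x => (x / w)%:C) (fun=> (w^-1)%:C).
Proof.
split; first exact: cintegrable_itv_cst.
move=> x /andP[ax _]; apply: complex_eq => /=.
  by rewrite Rintegral_ab_cst//; ring.
by rewrite Rintegral0 addr0.
Qed.

Lemma CAC_bump a b w : CAC a b (bump w) (dbump w).
Proof.
have sC := CAC_linear a b w.
have tC := CAC_D (CAC_cst a b 1) (CAC_Z (-1) sC).
have pC := CAC_mul sC tC.
have := CAC_mul pC (CAC_mul pC pC).
by move=> /CAC_eq; apply => x _; rewrite /bump /dbump /=; ring.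
Qed.

Lemma CAC_dbump a b w : CAC a b (dbump w) (ddbump w).
Proof.
have sC := CAC_linear a b w.
have tC := CAC_D (CAC_cst a b 1) (CAC_Z (-1) sC).
have uC := CAC_D (CAC_cst a b 1) (CAC_Z (-2) sC).
have pC := CAC_mul sC tC.
have := CAC_Z (3 * (w^-1)%:C) (CAC_mul (CAC_mul pC pC) uC).
by move=> /CAC_eq; apply => x _; rewrite /dbump /ddbump /=; ring.
Qed.

Lemma bump_ends w : 0 < w ->
  [/\ bump w 0 = 0, bump w w = 0, dbump w 0 = 0, dbump w w = 0 &
      (ddbump w 0 = 0) /\ (ddbump w w = 0)].
Proof.
move=> w0; rewrite /bump /dbump /ddbump mul0r divff ?gt_eqF//=.
by do !split; ring.
Qed.

Lemma bump_bounds w x : 0 < w -> 0 <= x <= w ->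
  [/\ n1 (bump w x) <= 1, n1 (dbump w x) <= 3 / w & n1 (ddbump w x) <= 12 / w ^+ 2].
Proof.
move=> w0 /andP[x0 xw].
have s1 : x / w <= 1 by rewrite ler_pdivrMr// mul1r.
have s0 : 0 <= x / w by rewrite divr_ge0// ltW.
have sE : n1 (x / w)%:C <= 1 by rewrite n1C ger0_norm.
have tE : n1 (1 - (x / w)%:C) <= 1.
  have -> : 1 - (x / w)%:C = (1 - x / w)%:C by apply: complex_eq => /=; ring.
  by rewrite n1C ger0_norm ?subr_ge0// gerBl.
have uE : n1 (1 - 2 * (x / w)%:C) <= 1.
  have -> : 1 - 2 * (x / w)%:C = (1 - 2 * (x / w))%:C.
    by apply: complex_eq => /=; ring.
  rewrite n1C ler_norml; lra.
have M1 (y z : R[i]) : n1 y <= 1 -> n1 z <= 1 -> n1 (y * z) <= 1.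
  move=> y1 z1; apply: (le_trans (n1M _ _)); rewrite -[leRHS]mulr1.
  by apply: ler_pM; rewrite ?n1_ge0.
have w'0 : 0 <= w^-1 by rewrite invr_ge0 ltW.
move: sE tE uE; rewrite /bump /dbump /ddbump /=.
move: (x / w)%:C => s sE tE uE.
have pE := M1 _ _ sE tE.
split.
- by rewrite exprS expr2; exact: (M1 _ _ pE (M1 _ _ pE pE)).
- apply: (le_trans (n1M _ _)); rewrite -[leRHS]mulr1.
  apply: ler_pM; rewrite ?n1_ge0//; last by rewrite expr2; exact: (M1 _ _ (M1 _ _ pE pE) uE).
  have -> : 3 * (w^-1)%:C = (3 / w)%:C by apply: complex_eq => /=; ring.
  by rewrite n1C ger0_norm// mulr_ge0.
apply: (le_trans (n1M _ _)).
have -> : 12 / w ^+ 2 = 6 * w^-1 ^+ 2 * 2 by rewrite -exprVn; ring.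
apply: ler_pM; rewrite ?n1_ge0//.
  have -> : 6 * (w^-1)%:C ^+ 2 = (6 * w^-1 ^+ 2)%:C by rewrite !expr2; apply: complex_eq => /=; ring.
  by rewrite n1C ger0_norm// mulr_ge0// sqr_ge0.
apply: (le_trans (n1M _ _)); rewrite -[leRHS]mul1r.
apply: ler_pM; rewrite ?n1_ge0//.
apply: (le_trans (n1D _ _)); rewrite n1N [2]/(1 + 1); apply: lerD => //.
by rewrite expr2; exact: (M1 _ _ uE uE).
Qed.

Lemma bump_middle (k : nat) x : (2 <= k)%N -> k%:R <= x <= k%:R + 1 ->
  (8^-1 ^+ 3) ^+ 2 <= abs2 (bump (2 * k)%:R x).
Proof.
move=> k2 /andP[kx xk].
have k2R : 2 <= k%:R :> R by rewrite ler_nat.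
have w0 : 0 < (2 * k)%:R :> R by rewrite ltr0n muln_gt0/= (leq_trans _ k2).
have s1 : 2^-1 <= x / (2 * k)%:R by rewrite ler_pdivlMr// natrM; lra.
have s2 : x / (2 * k)%:R <= 3 / 4 by rewrite ler_pdivrMr// natrM; lra.
rewrite /bump /=; move: (x / _) s1 s2 => s s1 s2.
have -> : (s%:C * (1 - s%:C)) ^+ 3 = ((s * (1 - s)) ^+ 3)%:C.
  by rewrite !exprS !expr0; apply: complex_eq => /=; ring.
rewrite /abs2 /= [in leRHS]expr0n addr0.
have p8 : 8^-1 <= s * (1 - s) by nra.
by rewrite lerXn2r ?nnegrE ?exprn_ge0// ?lerXn2r ?nnegrE//; lra.
Qed.
End WeylSequence.

Section VectorCutoff.
Context {R : realType} (m : nat).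
Implicit Types (u f : R -> 'cV[R[i]]_m).

Lemma cut_coord (w : R) u j : (fun x => cut w u x j 0) = cut w (fun x => u x j 0).
Proof. by apply/funext => x; rewrite /cut; case: ifP => // _; rewrite mxE. Qed.

Lemma AC_cut (w a b : R) u f : 0 <= w ->
  (forall j, CAC 0 w (fun x => u x j 0) (fun x => f x j 0)) ->
  u 0 = 0 -> u w = 0 -> f 0 = 0 -> f w = 0 ->
  AC_with_derivative a b (cut w u) (cut w f).
Proof.
move=> w0 uf u0 uw f0 fw j.
have := CAC_cut a b w0 (uf j); rewrite -!cut_coord u0 uw f0 fw !mxE => H.
exact: (H erefl erefl erefl erefl).
Qed.
End VectorCutoff.

Section BlochInSpectrum.
Context {R : realType} (m : nat) (Q : R -> 'M[R[i]]_m).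
Hypothesis hQ : periodic_potential Q.
Variables (l t : R) (y dy : R -> 'cV[R[i]]_m).
Hypotheses (sol : solves Q l 0 1 y dy) (y1 : y 1 = expi t *: y 0)
  (dy1 : dy 1 = expi t *: dy 0).

Lemma abs2_expi (s : R) : abs2 (expi s) = 1.
Proof. by rewrite /abs2 /= cos2Dsin2. Qed.

(* A Weyl sequence: the truncated Bloch solution [trial k] and the error
   [defect k] it makes in the equation. *)
Let Y := bloch_ext t y.
Let dY := bloch_ext t dy.
Let w (k : nat) : R := (2 * k)%:R.
Let trial k x := bump (w k) x *: Y x.
Let defect k x := - (ddbump (w k) x *: Y x + (2 * dbump (w k) x) *: dY x).

Let w_gt0 k : (0 < k)%N -> 0 < w k.
Proof. by move=> k0; rewrite ltr0n muln_gt0. Qed.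

Let solY k : solves Q l 0 (w k) Y dY.
Proof. exact: (bloch_ext_solves hQ (2 * k) sol y1 dy1). Qed.

Let trial_CAC k j : CAC 0 (w k) (fun x => trial k x j 0)
  (fun x => (dbump (w k) x *: Y x + bump (w k) x *: dY x) j 0).
Proof.
have [YC _] := solY k.
by apply: (CAC_eq (CAC_mul (CAC_bump 0 (w k) (w k)) (YC j))) => x _; rewrite !mxE.
Qed.

Let defect_int k j : cintegrable `[0, w k] (fun x => defect k x j 0).
Proof.
have [YC dYC] := solY k.
have m0 := measurable_itv `[(0 : R), w k].
have a1 := CAC_cintegrableM (YC j) (CAC_dbump 0 (w k) (w k)).1.
have a2 := cintegrableZ 2 m0 (CAC_cintegrableM (dYC j) (CAC_bump 0 (w k) (w k)).1).
have := cintegrableN m0 (cintegrableD m0 a1 a2).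
apply: eq_cintegrable => // x _; rewrite /defect !mxE; ring.
Qed.

Lemma trial_operator k (M : R) : (0 < k)%N ->
  (forall x j, 0 <= x <= w k -> n1 (defect k x j 0) <= M) ->
  operator_L Q (cut (w k) (trial k))
    (fun x => cut (w k) (defect k) x + l%:C *: cut (w k) (trial k) x).
Proof.
move=> k0 dM.
have wk := w_gt0 k0.
have [YC dYC] := solY k.
have m0 := measurable_itv `[(0 : R), w k].
have [B BP] := choice (fun j => CAC_bounded (trial_CAC k j)).
split.
- apply: (proj1 (@L2_cut _ _ _ _ (\sum_j `|B j|) (ltW wk) _ _)).
    by move=> j; exact: CAC_measurable (trial_CAC k j).
  move=> x j x0w; apply: (le_trans (BP j x x0w)); apply: (le_trans (ler_norm _)).
  by rewrite (bigD1 j)//= lerDl sumr_ge0.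
- have -> : (fun x => cut (w k) (defect k) x + l%:C *: cut (w k) (trial k) x) =
      cut (w k) (fun x => defect k x + l%:C *: trial k x).
    by apply/funext => x; rewrite /cut; case: ifP => // _; rewrite scaler0 addr0.
  apply: (proj1 (@L2_cut _ _ _ _ (M + n1 l%:C * \sum_j `|B j|) (ltW wk) _ _)).
    move=> j; apply: cintegrable_measurable => //.
    have := cintegrableD m0 (defect_int k j)
      (cintegrableZ l%:C m0 (CAC_cintegrable (trial_CAC k j))).
    apply: eq_cintegrable => // x _.
    by rewrite [RHS]mxE; congr (_ + _); rewrite [RHS]mxE.
  move=> x j x0w; rewrite mxE; apply: (le_trans (n1D _ _)); apply: lerD; first exact: dM.
  rewrite mxE; apply: (le_trans (n1M _ _)); rewrite ler_wpM2l ?n1_ge0//.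
  apply: (le_trans (BP j x x0w)); apply: (le_trans (ler_norm _)).
  by rewrite (bigD1 j)//= lerDl sumr_ge0.
have [b0 bw d0 dw [e0 ew]] := bump_ends wk.
pose S x := ddbump (w k) x *: Y x + (2 * dbump (w k) x) *: dY x +
  bump (w k) x *: (Q x *m Y x - l%:C *: Y x).
exists (cut (w k) (fun x => dbump (w k) x *: Y x + bump (w k) x *: dY x)) => a b ab.
split.
  apply: AC_cut (ltW wk) (trial_CAC k) _ _ _ _.
  - by rewrite /trial b0 scale0r.
  - by rewrite /trial bw scale0r.
  - by rewrite b0 d0 !scale0r addr0.
  - by rewrite bw dw !scale0r addr0.
exists (cut (w k) S); split.
  apply: AC_cut (ltW wk) _ _ _ _ _.
  - move=> j; have := CAC_D (CAC_mul (CAC_dbump 0 (w k) (w k)) (YC j))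
      (CAC_mul (CAC_bump 0 (w k) (w k)) (dYC j)).
    move=> /CAC_eq; apply => x _; first by rewrite !mxE.
    by rewrite /S; set q := (Q x *m Y x - _); clearbody q; rewrite !mxE; ring.
  - by rewrite b0 d0 !scale0r addr0.
  - by rewrite bw dw !scale0r addr0.
  - by rewrite /S b0 d0 e0 mulr0 !scale0r !addr0.
  - by rewrite /S bw dw ew mulr0 !scale0r !addr0.
apply: aeW => x _; rewrite /cut; case: ifP => _; last first.
  by rewrite mulmx0 scaler0 oppr0 !addr0.
rewrite /defect /S /trial; move: (Y x) (dY x) => z dz.
rewrite -scalemxAr; set q := Q x *m z; clearbody q.
by apply/colP => j; rewrite !mxE; ring.
Qed.

(** The period [[k, k + 1]] lies in the middle of [[0, 2 k]], where the cutoff is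
    bounded below, and [|Y|] is periodic. *)
Lemma trial_mass k : (2 <= k)%N ->
  (((8^-1 ^+ 3) ^+ 2 * norm2 y)%:E <= L2norm2 setT (cut (w k) (trial k)))%E.
Proof.
move=> k2.
have [yC _] := sol.
set c : R := (8^-1 ^+ 3) ^+ 2.
have c0 : 0 <= c by exact: sqr_ge0.
have [iF _] := norm2_sum yC.
have [iF' EF] := integrable_shift k%:R iF.
rewrite add0r [1 + _]addrC in iF' EF.
have k0 : 0 <= k%:R :> R by exact: ler0n.
have kw : k%:R + 1 <= w k.
  by rewrite /w natr1 ler_nat mul2n -addnn -addn1 leq_add2l (leq_trans _ k2).
have mk := measurable_itv `[(k%:R : R), k%:R + 1].
rewrite L2norm2_cut.
apply: (@le_trans _ _ (\int[leb]_(x in `[k%:R, (k%:R + 1)%R]) (\sum_j abs2 (trial k x j 0))%:E)%E).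
  have iG := rintegrableZ c mk iF'.
  rewrite /norm2 -EF -RintegralZl// /Rintegral fineK; last exact: integrable_fin_num iG.
  apply: ge0_le_integral => //.
  - move=> x _; rewrite lee_fin mulr_ge0// sumr_ge0// => j _; exact: abs2_ge0.
  - by apply/measurable_EFinP; exact: (rintegrable_measurable iG).
  - apply/measurable_EFinP; apply: measurable_sum => j; apply: measurable_abs2.
    exact: CAC_measurable (CAC_sub (trial_CAC k j) k0 kw).
  - move=> x /=; rewrite in_itv /= => xk; rewrite lee_fin mulr_sumr.
    apply: ler_sum => j _; rewrite /trial mxE abs2M.
    rewrite /Y (bloch_extE y1 xk) mxE abs2M abs2_expi mul1r.
    by apply: ler_wpM2r; [exact: abs2_ge0|exact: bump_middle].
apply: ge0_subset_integral => //.
- apply/measurable_EFinP; apply: measurable_sum => j; apply: measurable_abs2.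
  exact: CAC_measurable (trial_CAC k j).
- by move=> x _; rewrite lee_fin sumr_ge0// => j _; exact: abs2_ge0.
- by apply: subset_itv; rewrite bnd_simp.
Qed.

(** Cutting the bounded Bloch solution off at scale [2 k] leaves a defect of
    size [1 / k] on an interval of length [2 k], hence of squared norm of order
    [1 / k], while a fixed mass survives in the middle: no bounded inverse can
    exist. *)
Lemma bloch_in_spectrum : (y 0 != 0) || (dy 0 != 0) -> spectrum Q l%:C.
Proof.
move=> nz [_ [K bound]].
have [yC dyC] := sol.
have E0 : 0 < norm2 y.
  rewrite lt_neqAle norm2_ge0 andbT eq_sym; apply/negP => /eqP E.
  have y0 x : 0 <= x <= 1 -> y x = 0 by exact: norm2_eq0 yC E.
  by move: nz; rewrite (solves_zero sol y0) y0 ?lexx ?ler01// eqxx.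
have [B B0 YB] := bloch_ext_bounded y1 yC.
have [B' B'0 dYB] := bloch_ext_bounded dy1 dyC.
pose M := 12 * B + 6 * B'.
have M0 : 0 <= M by rewrite addr_ge0// mulr_ge0.
pose c : R := (8^-1 ^+ 3) ^+ 2.
have c0 : 0 < c by rewrite exprn_gt0// exprn_gt0// invr_gt0.
pose D := `|K| * (m%:R * M ^+ 2).
have test k : (2 <= k)%N -> c * norm2 y * k%:R <= D.
  move=> k2; have k0 : (0 < k)%N by exact: leq_trans k2.
  have wk := w_gt0 k0.
  have w1 : 1 <= w k by rewrite ler1n muln_gt0.
  have small (x : R) j : 0 <= x <= w k -> n1 (defect k x j 0) <= M / w k.
    move=> x0w; have [_ d1 d2] := bump_bounds wk x0w; have /andP[x0 _] := x0w.
    rewrite /defect mxE n1N mxE; apply: (le_trans (n1D _ _)).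
    have -> : M / w k = 12 * B / w k + 6 * B' / w k by rewrite /M; ring.
    apply: lerD.
      rewrite mxE; apply: (le_trans (n1M _ _)).
      apply: (@le_trans _ _ (12 / w k ^+ 2 * B)).
        by apply: ler_pM; rewrite ?n1_ge0//; exact: YB.
      have v1 : (w k)^-1 <= 1 by rewrite invf_le1.
      have v0 : 0 <= (w k)^-1 by rewrite invr_ge0 ltW.
      rewrite -exprVn; move: (w k)^-1 v0 v1 => v v0 v1.
      have : 0 <= B * (v * (1 - v)) by rewrite !mulr_ge0// subr_ge0.
      by nra.
    rewrite mxE; apply: (le_trans (n1M _ _)).
    have -> : 6 * B' / w k = (3 / w k + 3 / w k) * B' by ring.
    apply: ler_pM; rewrite ?n1_ge0//; last exact: dYB.
    have -> : 2 * dbump (w k) x = dbump (w k) x + dbump (w k) x by ring.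
    by apply: (le_trans (n1D _ _)); exact: lerD.
  have op := trial_operator k0 small.
  have [gL2 gle] := L2_cut (ltW wk) (fun j => cintegrable_measurable (defect_int k j)) small.
  have := bound _ _ gL2 op => /(le_trans (trial_mass k2)) H1.
  have H2 : ((c * norm2 y)%:E <= (`|K| * (m%:R * ((M / w k) ^+ 2 * w k)))%:E)%E.
    apply: (le_trans H1); rewrite EFinM.
    apply: (@le_trans _ _ (`|K|%:E * L2norm2 setT (cut (w k) (defect k)))%E).
      apply: lee_wpmul2r; last by rewrite lee_fin ler_norm.
      by apply: integral_ge0 => x _; rewrite lee_fin sumr_ge0// => j _; exact: abs2_ge0.
    by apply: lee_wpmul2l => //; rewrite lee_fin.
  rewrite lee_fin in H2.
  have -> : D = `|K| * (m%:R * ((M / w k) ^+ 2 * w k)) * w k.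
    have := lt0r_neq0 wk; move: (w k) => v v0.
    by rewrite /D; field.
  have kw : k%:R <= w k by rewrite ler_nat leq_pmull.
  by apply: ler_pM => //; rewrite mulr_ge0// ltW.
have := test (Num.truncn (D / (c * norm2 y))).+2 isT.
rewrite leNgt mulrC -ltr_pdivrMr ?mulr_gt0//.
by rewrite (lt_trans (truncnS_gt _))// ltr_nat.
Qed.
End BlochInSpectrum.

Theorem theorem4 (R : realType) (m : nat) (hm : (1 <= m)%N)
    (Q : R -> 'M[R[i]]_m) (hQ : periodic_potential Q)
    (p : nat) (mu : 'I_p -> R)
    (mu_increasing : forall i j : 'I_p, (i < j)%N -> mu i < mu j)
    (mu_eigenvalues : forall z : R[i],
       eigenvalue (mean_matrix Q) z <-> exists i, z = (mu i)%:C)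
    (j1 j2 j3 : 'I_p) (d : R)
    (d_attained : exists i1 i2 i3 : 'I_p,
       diam [set mu j1 + mu i1; mu j2 + mu i2; mu j3 + mu i3] = d)
    (d_minimal : forall i1 i2 i3 : 'I_p,
       d <= diam [set mu j1 + mu i1; mu j2 + mu i2; mu j3 + mu i3])
    (d_neq0 : d != 0) :
  (exists H : R, forall l : R, H < l -> spectrum Q l%:C) /\
  (forall lam : R -> nat -> R,
     (forall t : R, - pi < t <= pi -> eigenvalue_listing Q t (lam t)) ->
     finite_set (gaps lam)).
Proof.
have [H bloch] := high_energy_bloch hQ mu_eigenvalues d_attained d_minimal d_neq0.
split; last by move=> lam; exact: finitely_many_gaps bloch.
exists H => l /bloch[t [y _ [dy [sol y1 dy1 nz]]]].
exact: (bloch_in_spectrum hQ sol y1 dy1 nz).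
Qed.
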